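(* Let $\mathbb{K}$ be a field of characteristic $0$ and $\mathbb{K}[\mathbf{x}]=\mathbb{K}[x_1,\ldots,x_n]$. Let $\mathbb{K}[\mathbf{x}]/I$ be a finite monomial algebra (with $I$ a full monomial ideal), and let $(B,\mathfrak{m})$ be a finite-dimensional local $\mathbb{K}$-algebra with residue field $\mathbb{K}$. Assume that $\dim_{\mathbb{K}}(\mathfrak{m}/\mathfrak{m}^2)=n$ and that $\operatorname{Aut}^0_{\mathbb{K}}(B)$ is isomorphic to $\operatorname{Aut}^0_{\mathbb{K}}(\mathbb{K}[\mathbf{x}]/I)$ as algebraic $\mathbb{K}$-groups. Then $B$ is isomorphic to $\mathbb{K}[\mathbf{x}]/I$ as $\mathbb{K}$-algebras.
   Context: A monomial ideal $I\subset\mathbb{K}[\mathbf{x}]$ is an ideal generated by monomials $\mathbf{x}^m=x_1^{m_1}\cdots x_n^{m_n}$, $m\in\mathbb{Z}_{\ge0}^n$; a monomial algebra is a quotient $\mathbb{K}[\mathbf{x}]/I$ by a monomial ideal. Standing convention: monomial ideals are full, i.e. $x_i\notin I$ for all $1\le i\le n$, and ''finite'' means finite-dimensional as a $\mathbb{K}$-vector space. For a finite $\mathbb{K}$-algebra $A$, $\operatorname{Aut}_{\mathbb{K}}(A)$ is a linear algebraic group and $\operatorname{Aut}^0_{\mathbb{K}}(A)$ denotes its neutral (identity) connected component. *)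

(* Defs.v *)
From HB Require Import structures.
From mathcomp Require Import all_boot all_order all_algebra all_field.
From mathcomp Require Import mpoly.
Set Implicit Arguments. Unset Strict Implicit. Unset Printing Implicit Defensive.
Import GRing.Theory.
Local Open Scope ring_scope.

Section Defs.
Variable K : fieldType.

(* A finite K-algebra is an [falgType K] (finite-dimensional unital K-algebra);
   commutativity is imposed as a separate hypothesis.  We identify A with
   K^(dim A) through the canonical linear isomorphism v2r of the vectType
   structure, and K-linear endomorphisms of A with d x d matrices acting on
   row vectors. *)
Definition adim (A : falgType K) : nat := dim A.

Definition mx_act (A : falgType K) (M : 'M[K]_(adim A)) (v : A) : A :=
  @VectorInternalTheory.r2v K A (VectorInternalTheory.v2r v *m M).

(* K-points of Aut_K(A), as a subgroup of GL_d(K) (d = dim A). *)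
Definition AutMx (A : falgType K) (M : 'M[K]_(adim A)) : Prop :=
  [/\ M \in unitmx, mx_act M 1 = 1 &
      forall x y : A, mx_act M (x * y) = mx_act M x * mx_act M y].

Definition mx_eval (d : nat) (p : {mpoly K[d * d]}) (M : 'M[K]_d) : K :=
  p.@[fun i => mxvec M 0 i].

Definition Zclosed (d : nat) (Z : 'M[K]_d -> Prop) : Prop :=
  exists S : seq {mpoly K[d * d]},
    forall M, Z M <-> (forall p, p \in S -> mx_eval p M = 0).

Definition Zconnected (d : nat) (C : 'M[K]_d -> Prop) : Prop :=
  forall Z1 Z2 : 'M[K]_d -> Prop, Zclosed Z1 -> Zclosed Z2 ->
    (forall M, C M -> Z1 M \/ Z2 M) ->
    (forall M, C M -> Z1 M -> Z2 M -> False) ->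
    (forall M, C M -> Z1 M) \/ (forall M, C M -> Z2 M).

Definition identity_component (d : nat) (G : 'M[K]_d -> Prop) (M : 'M[K]_d) : Prop :=
  exists C : 'M[K]_d -> Prop,
    [/\ forall N, C N -> G N, C 1%:M, Zconnected C & C M].

Definition regular_on (d e : nat) (G : 'M[K]_d -> Prop) (f : 'M[K]_d -> 'M[K]_e) : Prop :=
  exists (k : nat) (P : 'I_e -> 'I_e -> {mpoly K[d * d]}),
    forall M, G M -> forall i j, f M i j = mx_eval (P i j) M / (\det M) ^+ k.

Definition alg_group_iso (d e : nat) (G : 'M[K]_d -> Prop) (H : 'M[K]_e -> Prop) : Prop :=
  exists (f : 'M[K]_d -> 'M[K]_e) (g : 'M[K]_e -> 'M[K]_d),
    [/\ regular_on G f, regular_on H g,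
        (forall M, G M -> H (f M)) /\ (forall N, H N -> G (g N)),
        (forall M, G M -> g (f M) = M) /\ (forall N, H N -> f (g N) = N) &
        forall M N, G M -> G N -> f (M *m N) = f M *m f N].

Definition Aut0 (A : falgType K) : 'M[K]_(adim A) -> Prop :=
  identity_component (@AutMx A).

Definition is_ideal (B : falgType K) (J : {vspace B}) : Prop :=
  forall x y : B, y \in J -> x * y \in J.

Definition is_local_max (B : falgType K) (m : {vspace B}) : Prop :=
  [/\ is_ideal m, m != fullv &
      forall J : {vspace B}, is_ideal J -> J != fullv -> (J <= m)%VS].

(* residue field B/m is K, i.e. dim_K (B/m) = 1 *)
Definition residue_field_K (B : falgType K) (m : {vspace B}) : Prop :=
  (\dim m).+1 = \dim (fullv : {vspace B}).

Definition cotangent_dim (B : falgType K) (m : {vspace B}) : nat :=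
  (\dim m - \dim (m * m)%VS)%N.

Definition evalA (n : nat) (A : falgType K) (a : 'I_n -> A) (p : {mpoly K[n]}) : A :=
  mmap (fun c : K => c%:A) a p.

(* (A, a) presents A as K[x]/I with I = ker a full monomial ideal:
   the K-algebra map K[x] -> A, x_i |-> a i is surjective, its kernel is the
   ideal generated by the monomials it contains, and no x_i lies in it. *)
Definition monomial_presentation (n : nat) (A : falgType K) (a : 'I_n -> A) : Prop :=
  [/\ forall x : A, exists p : {mpoly K[n]}, evalA a p = x,
      forall p : {mpoly K[n]}, evalA a p = 0 <->
        exists s : seq ({mpoly K[n]} * 'X_{1..n}),
          p = \sum_(t <- s) t.1 * 'X_[t.2] /\
          (forall t, t \in s -> evalA a 'X_[t.2] = 0) &
      forall i : 'I_n, evalA a 'X_i != 0].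

Definition alg_iso (A B : falgType K) : Prop :=
  exists f : A -> B,
    [/\ bijective f, forall (c : K) (x y : A), f (c *: x + y) = c *: f x + f y,
        f 1 = 1 & forall x y, f (x * y) = f x * f y].

End Defs.

(* Main.v *)
(** Since K has characteristic 0, the element g0 acting on x^s by a product of powers of distinct primes
    generates a subgroup that is as good as the full torus: its eigenvalues theta w, w in Z^n, determine w.
    The image H of g0 in Aut0(B) has powers with exponential-sum entries, hence is diagonalizable with
    eigenvalues of the form theta w. Eigenvectors y_k of weights w_k lifting a basis of m/m^2 generate B,
    and transporting back to A shows that the w_k form a basis of Z^n. So distinct monomials in the y_k
    have distinct weights and B is a monomial algebra as well.

    For every nonzero weight, the group isomorphism identifies the derivations of A and of B of that
    weight, through polynomial curves t |-> E_t in Aut0 and their linear terms. So the two staircases of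
    nonzero monomials, placed in the same lattice Z^n, have the same root multiplicities, where the
    multiplicity of a is the number of i such that x_i -> x^(a + e_i) is a derivation.

    It remains to recover the staircase up to a permutation of the variables. Call e_j thick if it has
    multiplicity at least 2 or if 2 e_j is a root. Thick vectors are common to both bases, and both
    staircases agree on the monomials in the thick variables. Each thin variable multiplies with at most
    one variable; the numbers of thin variables of each kind are then read off the multiplicities. *)

Require Import Defs.
From HB Require Import structures.
From mathcomp Require Import all_boot all_order all_fingroup all_algebra all_field.
From mathcomp Require Import zify mpoly.
Set Implicit Arguments. Unset Strict Implicit. Unset Printing Implicit Defensive.

(** The multiplicities do not determine the weights of the variables as vectors: when all products
    of two variables vanish, the roots are the differences [e_i - e_j], which do not change when the
    basis is negated. This is why the thin variables have to be reconstructed by counting and not by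
    comparing vectors. [K] need not be algebraically closed and only [K]-points are at hand, so
    eigenvalues and tangent vectors are produced explicitly: the former from the powers of one
    rational element, by Vandermonde, the latter from curves with polynomial entries. A regular map
    has powers of [det] in its denominators; along a curve of nonzero weight the determinant is
    constantly 1, so the image is again a polynomial curve. Weight 0 escapes this argument, but
    there the multiplicity is [n] on both sides. *)

Ltac clia := clear; lia.

(** * Staircases *)

(** Both families have [n] members, so the count of the remaining value [d] is forced. A type that
    is awkward to count can thus serve as the default. *)
Lemma perm_of_counts n (T : eqType) (t1 t2 : 'I_n -> T) (d : T) :
  (forall t, t != d -> #|[set i | t1 i == t]| = #|[set i | t2 i == t]|) ->
  exists s : {perm 'I_n}, forall i, t2 (s i) = t1 i.
Proof.
move=> h.
pose l (t : 'I_n -> T) := [tuple t i | i < n].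
have cnt (t' : 'I_n -> T) t : count_mem t (l t') = #|[set i | t' i == t]|.
  rewrite -sum1_card -sum1_count /= big_map big_enum_cond /=.
  by apply: eq_bigl => i; rewrite inE.
have pf : perm_eq [seq x <- l t1 | x != d] [seq x <- l t2 | x != d].
  apply/allP => t _; rewrite /= !count_filter /=.
  have [->|td] := eqVneq t d.
    have e (r : seq T) : count (predI (pred1 d) (fun x => x != d)) r = 0.
      by rewrite (@eq_count _ _ pred0) ?count_pred0 // => x; rewrite /= andbN.
    by rewrite !e.
  have e (r : seq T) : count (predI (pred1 t) (fun x => x != d)) r = count_mem t r.
    by apply: eq_count => x /=; case: (x =P t) => // ->; rewrite td.
  by rewrite !e !cnt h.
have pe : perm_eq (l t1) (l t2).
  rewrite /perm_eq; apply/allP => u _; apply/eqP => /=; case: (u =P d) => [->|/eqP ud]; last first.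
    by rewrite !cnt h.
  have e (t' : 'I_n -> T) : count_mem d (l t') + size [seq x <- l t' | x != d] = n.
    by rewrite size_filter count_predC size_tuple.
  by apply/eqP; rewrite -(eqn_add2r (size [seq x <- l t1 | x != d])) [X in X == _]e (perm_size pf) [X in _ == X]e.
case/tuple_permP: pe => p e; exists p => i.
have {}e : l t1 = [tuple tnth (l t2) (p i) | i < n] by apply: val_inj.
by have := congr1 (fun u => tnth u i) e; rewrite /l !tnth_mktuple.
Qed.

Lemma count_add (T : Type) (a b c : pred T) (r : seq T) :
  (forall x, c x = a x + b x :> nat) -> count c r = count a r + count b r.
Proof. by move=> h; elim: r => //= x r ->; rewrite h addnACA. Qed.

Lemma mnm_gt0 n (s : 'X_{1..n}) : s != 0%MM -> exists i, 0 < s i.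
Proof.
move=> sn; apply/existsP; apply: contraNT sn; rewrite negb_exists => /forallP h.
by apply/eqP/mnmP => i; rewrite mnm0E; have := h i; lia.
Qed.

Lemma mnm_subU n (s : 'X_{1..n}) i : 0 < s i -> s = (s - U_(i) + U_(i))%MM.
Proof. by move=> si; apply/mnmP => j; rewrite mnmDE mnmBE mnm1E; case: eqP => [<-|]; lia. Qed.

Lemma mnm_ind n (P : 'X_{1..n} -> Prop) :
  P 0%MM -> (forall v j, P v -> P (v + U_(j))%MM) -> forall v, P v.
Proof.
move=> P0 PU v; have [k] := ubnP (mdeg v); elim: k v => // k IH v vk.
have [->//|/mnm_gt0 [i hi]] := eqVneq v 0%MM.
rewrite (mnm_subU hi); apply: PU; apply: IH.
by move: vk; rewrite {1}(mnm_subU hi) mdegD mdeg1; lia.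
Qed.

Section Stair.
Variable n : nat.
Implicit Types (S : seq 'X_{1..n}) (s v x y : 'X_{1..n}) (i j k : 'I_n).

Definition stair S := [/\ uniq S, 0%MM \in S, (forall i, U_(i)%MM \in S) &
  forall s i, (s + U_(i))%MM \in S -> s \in S].

(* [S] is the set of exponents of the nonzero monomials; [xAA S i s] says that [x^s] is killed by the
   annihilator of [x_i], i.e. that [x_i -> x^s], [x_j -> 0] extends to a derivation. *)
Definition xAA S i s :=
  (s \in S) && all (fun v => ((v + s)%MM \in S) ==> ((v + U_(i))%MM \in S)) S.
(** The sum of all root multiplicities ([total_ev], [total_sum]), hence an invariant that refers to
    no basis. *)
Definition xtotal S := \sum_i count (xAA S i) S.
Definition adj S j i := (U_(j) + U_(i))%MM \in S.
Definition pm (p : {perm 'I_n}) s := [multinom s ((p^-1)%g i) | i < n].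

Lemma pmE p s i : pm p s (p i) = s i.
Proof. by rewrite mnmE permK. Qed.
Lemma pmV p s i : pm p s i = s ((p^-1)%g i).
Proof. by rewrite mnmE. Qed.
Lemma pmD p s v : pm p (s + v)%MM = (pm p s + pm p v)%MM.
Proof. by apply/mnmP => i; rewrite mnmDE !pmV mnmDE. Qed.
Lemma pmU p j : pm p U_(j)%MM = U_(p j)%MM.
Proof.
apply/mnmP => i; rewrite pmV !mnm1E; congr nat_of_bool.
by apply/eqP/eqP => [->|<-]; rewrite ?permKV ?permK.
Qed.
Lemma pm0 p : pm p 0%MM = 0%MM.
Proof. by apply/mnmP => i; rewrite pmV !mnm0E. Qed.
Lemma pmK p : cancel (pm p) (pm p^-1%g).
Proof. by move=> s; apply/mnmP => i; rewrite !pmV invgK permK. Qed.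
Lemma pmVK p : cancel (pm p^-1%g) (pm p).
Proof. by move=> s; apply/mnmP => i; rewrite !pmV invgK permKV. Qed.
Lemma pmM p q s : pm (p * q)%g s = pm q (pm p s).
Proof. by apply/mnmP => i; rewrite !pmV invMg permM. Qed.

Definition permS p S := [seq pm p^-1%g s | s <- S].
Lemma mem_permS p S s : (s \in permS p S) = (pm p s \in S).
Proof.
apply/mapP/idP => [[x xS ->]|h]; first by rewrite pmVK.
by exists (pm p s); rewrite ?pmK.
Qed.
Lemma stair_permS p S : stair S -> stair (permS p S).
Proof.
case=> h1 h2 h3 h4; split.
- by rewrite map_inj_uniq //; exact: can_inj (pmVK p).
- by rewrite mem_permS pm0.
- by move=> i; rewrite mem_permS pmU.
- by move=> s i; rewrite !mem_permS pmD pmU; apply: h4.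
Qed.
Lemma xtotal_permS p S : xtotal (permS p S) = xtotal S.
Proof.
rewrite /xtotal (reindex_inj (@perm_inj _ (p^-1)%g)) /=; apply: eq_bigr => i _.
rewrite /permS count_map; apply: eq_count => s /=.
rewrite /xAA mem_permS pmVK; congr (_ && _).
rewrite all_map; apply: eq_all => v /=.
by rewrite !mem_permS !pmD pmU !pmVK permKV.
Qed.

Lemma st_leq S x y : stair S -> y \in S -> (forall i, x i <= y i) -> x \in S.
Proof.
move=> [_ _ _ sd] yS le.
have e : y = (x + (y - x))%MM by apply/mnmP => i; rewrite mnmDE mnmBE; have := le i; lia.
move: (y - x)%MM e yS => d -> {le y}.
by elim/mnm_ind: d => [|d j IH]; rewrite ?addm0 // addmA => /sd.
Qed.

(** [H] will be the set of thick indices. The first condition reflects that [e_j] has multiplicity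
    at most 1, the second that [2 e_j] is not a root. *)
Definition thin S (H : {set 'I_n}) := forall j, j \notin H ->
  (forall i i', adj S j i -> adj S j i' -> i = i') /\
  (forall i, (U_(j) + U_(j) + U_(i))%MM \notin S).
Definition supp (H : {set 'I_n}) x := [forall i, (i \in H) || (x i == 0)].
Definition tc S (H : {set 'I_n}) x := #|[set j | (j \notin H) && ((x + U_(j))%MM \in S)]|.

Lemma adjC S i j : adj S i j = adj S j i.
Proof. by rewrite /adj addmC. Qed.

(** Every variable dividing [x^s / x_j] is a neighbour of [x_j], and there is at most one neighbour.
    If it is [x_j] itself, the second part of [thin] stops at [x_j^2]. *)
Lemma thin_form S H j s : stair S -> thin S H -> j \notin H -> s \in S -> 0 < s j ->
  exists i c, [/\ s = (U_(j) + U_(i) *+ c)%MM, 0 < c -> adj S j i & i = j -> c <= 1].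
Proof.
move=> stS tS jH sS sj; have [tj1 tj2] := tS j jH.
have es : s = (U_(j) + (s - U_(j)))%MM by rewrite addmC -mnm_subU.
have adjd i : 0 < (s - U_(j))%MM i -> adj S j i.
  move=> di; apply: (st_leq stS sS) => k; rewrite es !mnmDE !mnm1E.
  by case: (i =P k) => [<-|_]; move: di; clia.
have [z|/existsP [i di]] := boolP [forall i, (s - U_(j))%MM i == 0] ; last first.
  exists i, ((s - U_(j))%MM i); split.
  - apply/mnmP => k; rewrite {1}es !mnmDE; congr (_ + _); rewrite mulmnE mnm1E.
    have [->|ik] := eqVneq k i; first by rewrite mul1n.
    rewrite mul0n; apply/eqP; apply: contraT; rewrite -lt0n => dk.
    by move: ik; rewrite (tj1 k i) ?adjd ?eqxx //; move: di; case: (_ i).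
  - exact: adjd.
  - move=> ij; subst i; rewrite leqNgt; apply/negP => d2; apply: (negP (tj2 j)).
    by apply: (st_leq stS sS) => k; rewrite es !mnmDE !mnm1E; case: (j =P k) => [<-|_]; move: d2; clia.
exists j, 0; split=> //; rewrite {1}es; congr (_ + _)%MM.
by apply/mnmP => k; rewrite mulmnE muln0; apply/eqP; move/forallP: z.
Qed.

Definition hgt S j h := \max_(s <- S | (U_(j) + U_(h) *+ s h)%MM == s) s h.

Lemma hgtP S j h c : stair S -> h != j -> ((U_(j) + U_(h) *+ c)%MM \in S) = (c <= hgt S j h).
Proof.
move=> stS hj; apply/idP/idP => [sS|].
  have e : (U_(j) + U_(h) *+ c)%MM h = c.
    by rewrite mnmDE mulmnE !mnm1E eq_sym (negPf hj) eqxx mul1n.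
  by rewrite -{1}e; apply: leq_bigmax_seq => //; rewrite e.
move=> le; apply: contraT => nS; case: c le nS => [_|c le nS].
  by case: stS => _ _ h3 _; rewrite mulm0n addm0 h3.
suff : hgt S j h <= c by move: le; clia.
apply/bigmax_leqP_seq => s sS /eqP es; rewrite leqNgt; apply/negP => lt.
apply: (negP nS); apply: (st_leq stS sS) => k; rewrite -es !mnmDE !mulmnE leq_add2l.
by rewrite leq_mul2l lt orbT.
Qed.

(* [tyA], [tyB] record the orbit type of a variable: equal numbers of variables of each type in two
   staircases yield the permutation through [perm_of_counts]. The value [None] is left out there. *)
Definition tyA S (H : {set 'I_n}) j : option ('I_n + 'I_n * nat) :=
  if j \in H then Some (inl j) else
  if [pick h in H | adj S j h] is Some h then Some (inr (h, hgt S j h)) else None.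

Lemma tyA_inl S H j h : (tyA S H j == Some (inl h)) = (j == h) && (h \in H).
Proof.
rewrite /tyA; case: ifP => jH.
  apply/eqP/andP => [[<-]|[/eqP -> _] //]; by rewrite eqxx.
case: pickP => [h' _|_]; apply/esym; apply/negP => /andP [/eqP <-]; by rewrite jH.
Qed.

Lemma tyA_inr S H j h q : thin S H ->
  (tyA S H j == Some (inr (h, q))) = [&& j \notin H, h \in H, adj S j h & hgt S j h == q].
Proof.
move=> tS; rewrite /tyA; case: ifP => [jH|/negbT jH] //=.
case: pickP => [h' /andP [hH' a']|no].
  apply/eqP/and3P => [[<- <-] //|[hH a /eqP <-]].
  by rewrite (proj1 (tS j jH) _ _ a a').
by apply/esym/negP => /and3P [hH a _]; have := no h; rewrite hH a.
Qed.

(** The thin variables counted on the left are those of height at least [q] over [h], so the ones of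
    height exactly [q] appear as a difference of consecutive values of [tc]. *)
Lemma tc_hgt S H h q : stair S -> thin S H -> h \in H -> 0 < q ->
  tc S H (U_(h) *+ q)%MM = #|[set j | tyA S H j == Some (inr (h, q))]| + tc S H (U_(h) *+ q.+1)%MM.
Proof.
move=> stS tS hH q0.
have mem j c : j \notin H -> ((U_(h) *+ c + U_(j))%MM \in S) = (c <= hgt S j h).
  by move=> jH; rewrite addmC hgtP //; apply: contraNneq jH => <-.
rewrite /tc -[LHS](cardsID [set j | hgt S j h == q]); congr (_ + _); apply: eq_card => j; rewrite !inE.
  rewrite tyA_inr // hH; case: (boolP (j \in H)) => //= jH; rewrite mem //.
  apply/andP/andP => [[le /eqP e]|[a /eqP e]]; rewrite e eqxx; split=> //.
  by rewrite /adj -[U_(h)%MM]mulm1n addmC mem // e.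
case: (boolP (j \in H)) => [|jH] /=; rewrite ?andbF //.
rewrite !mem //; case: eqP; clia.
Qed.

(* Variables outside the core multiply to a nonzero element with at most one variable, itself outside
   the core, so they are isolated, of square nonzero, or come in pairs. *)
Definition nonc S (Co : {set 'I_n}) := forall j, j \notin Co ->
  [/\ forall i i', adj S j i -> adj S j i' -> i = i',
      forall i, (U_(j) + U_(j) + U_(i))%MM \notin S & forall i, adj S j i -> i \notin Co].

(** The thick variables together with the thin ones attached to a thick variable. *)
Definition core S (H : {set 'I_n}) := [set j | tyA S H j != None].

Lemma coreP S H j : thin S H -> j \notin H -> j \in core S H -> exists2 h, h \in H & adj S j h.
Proof.
move=> tS jH; rewrite inE /tyA (negPf jH); case: pickP => // h /andP [? ?] _; by exists h.
Qed.

Lemma nonc_core S H : thin S H -> nonc S (core S H).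
Proof.
move=> tS j; rewrite inE negbK => tj.
have jH : j \notin H by apply/negP => jH; move: tj; rewrite /tyA jH.
have [t1 t2] := tS j jH; split=> // i a; apply/negP => iC.
have nh h : h \in H -> ~~ adj S j h.
  move=> hH; apply/negP => ah; have : tyA S H j == Some (inr (h, hgt S j h)).
    by rewrite tyA_inr // jH hH ah eqxx.
  by rewrite (eqP tj).
case: (boolP (i \in H)) => iH; first by have := nh i iH; rewrite a.
have [h hH ah] := coreP tS iH iC.
by move: jH; rewrite (proj1 (tS i iH) j h) ?hH // adjC.
Qed.

Lemma adj_permS p S i j : adj (permS p S) i j = adj S (p i) (p j).
Proof. by rewrite /adj mem_permS pmD !pmU. Qed.

(** Only [x_h] can accompany [x_j], so membership depends on [j] only through the pair recorded by
    [tyA]. *)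
Lemma att_mem S H j h s : stair S -> thin S H -> j \notin H -> h \in H -> adj S j h ->
  0 < s j -> (s \in S) = (s == (U_(j) + U_(h) *+ s h)%MM) && (s h <= hgt S j h).
Proof.
move=> stS tS jH hH a sj; have hj : h != j by apply: contraNneq jH => <-.
apply/idP/andP => [sS|[/eqP e le]]; last by rewrite e hgtP // -e.
have [i [c [e1 e2 e3]]] := thin_form stS tS jH sS sj.
have es : s = (U_(j) + U_(h) *+ c)%MM.
  case: (posnP c) => [c0|/e2 ai]; first by rewrite e1 c0 !mulm0n.
  by rewrite e1 (proj1 (tS j jH) _ _ ai a).
have ec : s h = c by rewrite es mnmDE mulmnE !mnm1E eq_sym (negPf hj) eqxx mul1n.
by rewrite -hgtP // ec -es eqxx.
Qed.

(** By [tc_hgt] the hypotheses count the attached variables by thick neighbour and height, and by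
    [att_mem] these data decide all monomials containing such a variable. A type-preserving
    permutation fixes the thick variables and therefore matches all monomials of the core. *)
Lemma core_match S S' H : stair S -> stair S' -> thin S H -> thin S' H ->
  (forall x, supp H x -> (x \in S) = (x \in S')) ->
  (forall x, supp H x -> x != 0%MM -> tc S H x = tc S' H x) ->
  exists p Co, [/\ forall s, supp Co s -> (s \in S) = (s \in permS p S'),
    nonc S Co & nonc (permS p S') Co].
Proof.
move=> stS stS' tS tS' eH et.
have sH h c : h \in H -> supp H (U_(h) *+ c)%MM.
  move=> hH; apply/forallP => i; rewrite mulmnE mnm1E.
  by case: (h =P i) => [<-|_]; rewrite ?hH // mul0n eqxx orbT.
have [|p hp] := @perm_of_counts n _ (tyA S H) (tyA S' H) None.
  move=> [[h|[h q]]|] // _; first by apply: eq_card => j; rewrite !inE !tyA_inl.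
  have none T : thin T H -> stair T -> ~~ ((h \in H) && (0 < q)) -> #|[set i | tyA T H i == Some (inr (h, q))]| = 0.
    move=> tT sT nhq; apply: eq_card0 => j; rewrite inE tyA_inr //.
    apply/negbTE/negP => /and4P [jH hH a /eqP e]; case/negP: nhq; rewrite hH -e -hgtP //.
    by apply: contraNneq jH => <-.
  case: (boolP ((h \in H) && (0 < q))) => [/andP [hH q0]|nhq]; last by rewrite !none.
  have n0 c : 0 < c -> (U_(h) *+ c)%MM != 0%MM.
    move=> c0; apply/eqP => /mnmP/(_ h); rewrite mulmnE mnm1E eqxx mnm0E; move: c0; clia.
  have := tc_hgt stS tS hH q0; have := tc_hgt stS' tS' hH q0.
  by rewrite !et ?sH ?n0 // => -> /addIn.
have pH i : i \in H -> p i = i.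
  move=> iH; have : tyA S H i == Some (inl i) by rewrite tyA_inl eqxx.
  by rewrite -hp tyA_inl => /andP [/eqP].
have pH' i : (p i \in H) = (i \in H).
  apply/idP/idP => [h|/[dup] /pH -> //].
  by have := pH _ h => /perm_inj e; rewrite -e.
exists p, (core S H); split; [|exact: nonc_core|].
  move=> s sC; rewrite mem_permS.
  case: (boolP (supp H s)) => [sHs|].
    suff -> : pm p s = s by apply: eH.
    apply/mnmP => i; rewrite pmV; case: (boolP (i \in H)) => iH.
      by rewrite -{1}(pH i iH) permK.
    have iH' : (p^-1)%g i \notin H by rewrite -pH' permKV.
    have z i' : i' \notin H -> s i' = 0.
      by move=> i'H; move/forallP/(_ i'): sHs; rewrite (negPf i'H) /= => /eqP.
    by rewrite !z.
  rewrite negb_forall => /existsP [j]; rewrite negb_or -lt0n => /andP [jH sj].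
  have jC : j \in core S H.
    by move/forallP: sC => /(_ j) /orP [//|/eqP z]; rewrite z in sj.
  have [h hH a] := coreP tS jH jC.
  have : tyA S H j == Some (inr (h, hgt S j h)) by rewrite tyA_inr // jH hH a eqxx.
  rewrite -hp tyA_inr // => /and4P [jH' _ a' /eqP eh].
  rewrite (att_mem stS tS jH hH a sj) (@att_mem S' H (p j) h) // ?pmE // eh.
  have -> : pm p s h = s h by rewrite -{1}(pH h hH) pmE.
  congr (_ && _); rewrite -(inj_eq (can_inj (pmK p))) pmD pmU; congr (_ == (_ + _))%MM.
  apply/mnmP => i; rewrite pmV !mulmnE !mnm1E; congr (_ * _); congr nat_of_bool.
  by rewrite -{2}(pH h hH) -(inj_eq (@perm_inj _ p)) permKV.
move=> j; rewrite inE -hp -[_ != None]/(_) => jC.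
have jC' : p j \notin core S' H by rewrite inE.
have [h1 h2 h3] := nonc_core tS' jC'; split.
- by move=> i i'; rewrite !adj_permS => a a'; apply: (@perm_inj _ p); apply: h1.
- by move=> i; rewrite mem_permS !pmD !pmU.
by move=> i; rewrite adj_permS => /h3; rewrite !inE hp.
Qed.

(** * Monomials and derivations outside the core *)

Definition xmax S s := (s \in S) && [forall i, (s + U_(i))%MM \notin S].
Definition nbmax S Co := count (fun s => xmax S s && ~~ supp Co s) S.
Definition soc S j := [forall i, ~~ adj S j i].

Section Nonc.
Variables (S : seq 'X_{1..n}) (Co : {set 'I_n}).
Hypotheses (stS : stair S) (nS : nonc S Co).

(** Beyond [thin_form]: a second factor [x_i] with [i] different from [j] would make [x_i] a
    neighbour of itself and of [x_j], while [x_i], being noncore too, has only one neighbour. *)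
Lemma nonc_form j s : j \notin Co -> s \in S -> 0 < s j ->
  s = U_(j)%MM \/ exists2 i, adj S j i & s = (U_(j) + U_(i))%MM.
Proof.
move=> jC sS sj.
have tS : thin S Co by move=> k /nS [].
have [i [c [e1 e2 e3]]] := thin_form stS tS jC sS sj.
case: (posnP c) => [c0|c0]; first by left; rewrite e1 c0 mulm0n addm0.
right; exists i; first exact: e2.
suff c1 : c = 1 by rewrite e1 c1.
apply/eqP; rewrite eqn_leq c0 andbT; have [ij|ij] := eqVneq i j; first exact: e3.
have a := e2 c0; rewrite leqNgt; apply/negP => c2.
have [_ _ /(_ i a) iC] := nS jC; have [u _ _] := nS iC.
have ii : adj S i i.
  apply: (st_leq stS sS) => k; rewrite e1 !mnmDE mulmnE !mnm1E.
  by case: (i == k); move: c2; clia.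
by move: ij; rewrite (u i j ii) ?eqxx // adjC.
Qed.

Lemma adjP s i : (s + U_(i))%MM \in S -> forall k, 0 < s k -> adj S k i.
Proof.
move=> h k sk; apply: (st_leq stS h) => k'; rewrite !mnmDE !mnm1E leq_add2r.
by case: (k =P k') => [<-|].
Qed.

Lemma core_ext s i : supp Co s -> s != 0%MM -> (s + U_(i))%MM \in S -> i \in Co.
Proof.
move=> sC sn sS; apply: contraT => iC.
have [k sk] := mnm_gt0 sn.
have kC : k \in Co by move/forallP/(_ k): sC => /orP [//|/eqP z]; rewrite z in sk.
have [_ _ /(_ k)] := nS iC; rewrite adjC kC; apply; exact: adjP sS _ sk.
Qed.

Lemma suppN s : ~~ supp Co s -> exists2 j, j \notin Co & 0 < s j.
Proof. by rewrite negb_forall => /existsP [j]; rewrite negb_or -lt0n => /andP [? ?]; exists j. Qed.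

Lemma xmax_AA i s : xmax S s -> xAA S i s.
Proof.
move=> /andP [sS /forallP h]; rewrite /xAA sS; apply/allP => v vS; apply/implyP => vs.
have -> : v = 0%MM.
  apply/eqP; apply: contraT => vn; have [k vk] := mnm_gt0 vn.
  exfalso; apply: (negP (h k)); apply: (st_leq stS vs) => k'; rewrite !mnmDE mnm1E.
  by case: (k =P k') => [<-|_]; move: vk; clia.
by rewrite add0m; case: stS.
Qed.

Lemma xAAE i s v : xAA S i s -> (v + s)%MM \in S -> (v + U_(i))%MM \in S.
Proof.
move=> /andP [sS /allP h] vs; have vS : v \in S.
  by apply: (st_leq stS vs) => k; rewrite mnmDE leq_addr.
by have := h v vS; rewrite vs.
Qed.

(** Otherwise multiplication by [x_i] would keep nonzero monomials nonzero, and all powers of [x_i]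
    would lie in the finite list [S]. *)
Lemma xAA0 i : ~~ xAA S i 0%MM.
Proof.
apply/negP => A.
have [m mS mi] : exists2 m, m \in S & (m + U_(i))%MM \notin S.
  case: (boolP (has (fun m => (m + U_(i))%MM \notin S) S)) => [/hasP [m ? ?]|/hasPn h].
    by exists m.
  exfalso; have all_in c : (U_(i) *+ c)%MM \in S.
    elim: c => [|c IH]; first by rewrite mulm0n; case: stS.
    by have := h _ IH; rewrite negbK addmC -mulmS.
  have us : uniq [seq (U_(i) *+ c)%MM | c <- iota 0 (size S).+1].
    rewrite map_inj_uniq ?iota_uniq // => c c' /mnmP/(_ i).
    by rewrite !mulmnE mnm1E eqxx !mul1n.
  have /uniq_leq_size : {subset [seq (U_(i) *+ c)%MM | c <- iota 0 (size S).+1] <= S}.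
    by move=> x /mapP [c _ ->].
  by move/(_ us); rewrite size_map size_iota ltnn.
by have := @xAAE i 0%MM m A; rewrite addm0 (negPf mi) => /(_ mS).
Qed.

Lemma nonmax_noncore j : j \notin Co -> ~~ soc S j -> exists2 p, p \notin Co & adj S j p.
Proof.
move=> jC; rewrite negb_forall => /existsP [p]; rewrite negbK => a; exists p => //.
by have [_ _] := nS jC; apply.
Qed.

Lemma pair_max j i : j \notin Co -> adj S j i -> xmax S (U_(j) + U_(i))%MM.
Proof.
move=> jC a; have [u1 u2 u3] := nS jC; have iC := u3 i a; have [v1 v2 v3] := nS iC.
rewrite /xmax; apply/andP; split=> //; apply/forallP => k; apply/negP => h.
have jk : adj S j k by apply: (adjP h); rewrite mnmDE mnm1E eqxx.
have ik : adj S i k by apply: (adjP h); rewrite mnmDE !mnm1E eqxx addn1.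
have ki := u1 _ _ jk a; subst k.
have ij : adj S i j by rewrite adjC.
have ij' := v1 _ _ ij ik; subst i.
exact: (negP (u2 j)).
Qed.

(** A noncore monomial that is not maximal is a single [x_j] with a neighbour [x_p]. Since [x_p x_j]
    is nonzero so is [x_p x_i], and [x_p] has only one neighbour, whence [i = j]. *)
Lemma xAA_noncore i s : ~~ supp Co s ->
  xAA S i s = xmax S s || ((s == U_(i))%MM && (i \notin Co)).
Proof.
move=> sN; apply/idP/orP => [A|[/xmax_AA //|/andP [/eqP -> _]]]; last first.
  by rewrite /xAA; case: stS => _ _ h3 _; rewrite h3; apply/allP => v _; apply/implyP.
have sS : s \in S by case/andP: A.
have [j jC sj] := suppN sN.
case: (nonc_form jC sS sj) => [e|[k a ->]]; last by left; apply: pair_max.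
case: (boolP (soc S j)) => [sc|/(nonmax_noncore jC) [p pC a]].
  left; rewrite /xmax sS; apply/forallP => k; rewrite e; exact: (forallP sc).
have : (U_(p) + U_(i))%MM \in S by apply: (xAAE A); rewrite e -/(adj S p j) adjC.
rewrite -/(adj S p i) => pi; have [u _ _] := nS pC.
by right; rewrite e (u i j pi) ?eqxx // adjC.
Qed.

(** If [x^s x_k] is nonzero then [x_k] is in the core, and [xAA] would make the noncore [x_i] a
    neighbour of [x_k]. *)
Lemma xAA_core i s : supp Co s -> i \notin Co -> xAA S i s = xmax S s && (s != 0%MM).
Proof.
move=> sC iC; have [->|sn] := eqVneq s 0%MM; first by rewrite andbF; apply/negbTE/xAA0.
rewrite andbT; apply/idP/idP => [A|/xmax_AA //].
rewrite /xmax; case/andP: (A) => -> _ /=; apply/forallP => k; apply/negP => h.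
have kC := core_ext sC sn h.
have : adj S k i by apply: (xAAE A); rewrite addmC.
by have [_ _ /(_ k)] := nS iC; rewrite adjC kC => u /u.
Qed.

Definition cc i := count (fun s => supp Co s && xAA S i s) S.
Definition mu0 := count (fun s => [&& supp Co s, xmax S s & s != 0%MM]) S.

(** The summand [~~ soc S i] stands for the derivation [x_i -> x_i], which [nbmax] already counts
    when [x_i] is maximal. *)
Lemma count_split i : count (xAA S i) S =
  if i \in Co then cc i + nbmax S Co else mu0 + nbmax S Co + ~~ soc S i.
Proof.
have -> : count (xAA S i) S = cc i + count (fun s => xAA S i s && ~~ supp Co s) S.
  by apply: count_add => s; case: supp; case: xAA.
have cU : i \notin Co -> count (fun s => (s == U_(i)%MM) && ~~ soc S i) S = ~~ soc S i.
  move=> iC; case: (soc S i) => /=.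
    by rewrite (@eq_count _ _ pred0) ?count_pred0 // => s; rewrite /= andbF.
  rewrite (@eq_count _ _ (pred1 U_(i)%MM)); last by move=> s; rewrite /= andbT.
  by case: stS => uS _ h3 _; rewrite count_uniq_mem // h3.
case: ifP => [iC|/negbT iC].
  congr (_ + _); apply: eq_count => s /=; case: (boolP (supp Co s)) => sC; rewrite ?andbF //.
  by rewrite xAA_noncore // iC andbF orbF.
rewrite -addnA; congr (_ + _).
  by apply: eq_count => s /=; case: (boolP (supp Co s)) => sC //=; rewrite xAA_core.
rewrite -(cU iC) /nbmax; apply: count_add => s /=.
case: (boolP (supp Co s)) => sC; rewrite ?andbF ?andbT /=.
  case: eqP => // e; move: sC; rewrite e => /forallP/(_ i).
  by rewrite (negPf iC) mnm1E eqxx.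
rewrite xAA_noncore // iC andbT; case: eqP => [->|_]; last by rewrite orbF addn0.
have -> : xmax S U_(i)%MM = soc S i by rewrite /xmax /soc; case: stS => _ _ -> _.
by case: soc.
Qed.

(* The core being known, this determines [n * nbmax - z], [z] the number of noncore socle variables;
   as [z <= n] and [z = n] is detected separately, both [nbmax] and [z] are determined. *)
Lemma xtotalE : xtotal S + #|[set j | (j \notin Co) && soc S j]| =
  \sum_(i in Co) cc i + #|~: Co| * mu0 + n * nbmax S Co + #|~: Co|.
Proof.
rewrite /xtotal (bigID (fun i => i \in Co)) /=.
have -> : \sum_(i in Co) count (xAA S i) S = \sum_(i in Co) cc i + #|Co| * nbmax S Co.
  rewrite -sum_nat_const -big_split /=; apply: eq_bigr => i iC.
  by rewrite count_split iC.
have -> : \sum_(i < n | i \notin Co) count (xAA S i) S =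
   #|~: Co| * mu0 + #|~: Co| * nbmax S Co + #|[set j | (j \notin Co) && ~~ soc S j]|.
  have s1 X : #|~: Co| * X = \sum_(i < n | i \notin Co) X.
    by rewrite -sum_nat_const; apply: eq_bigl => i; rewrite inE.
  have s2 : #|[set j | (j \notin Co) && ~~ soc S j]| = \sum_(i < n | i \notin Co) ~~ soc S i.
    rewrite -sum1_card (eq_bigl (fun j => (j \notin Co) && ~~ soc S j)) => [|j]; last by rewrite inE.
    by rewrite big_mkcondr; apply: eq_bigr => i _; case: soc.
  rewrite s2 !s1 -!big_split /=; apply: eq_bigr => i iC.
  by rewrite count_split (negPf iC).
have e1 : #|Co| + #|~: Co| = n by rewrite cardsC card_ord.
have e2 : #|[set j | (j \notin Co) && soc S j]| + #|[set j | (j \notin Co) && ~~ soc S j]| = #|~: Co|.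
  rewrite -(cardsID [set j | soc S j] (~: Co)); congr (_ + _); apply: eq_card => j; rewrite !inE //.
  by rewrite andbC.
rewrite -[in n * _]e1 -e2.
move: (\sum_(i in Co) cc i) #|Co| #|[set j | (j \notin Co) && soc S j]| #|[set j | (j \notin Co) && ~~ soc S j]| mu0 (nbmax S Co) => A c p q m b.
clear; nia.
Qed.

End Nonc.

Section CoreEq.
Variables (S S' : seq 'X_{1..n}) (Co : {set 'I_n}).
Hypotheses (stS : stair S) (nS : nonc S Co) (stS' : stair S') (nS' : nonc S' Co).
Hypothesis eC : forall s, supp Co s -> (s \in S) = (s \in S').

Lemma suppD x y : supp Co x -> supp Co y -> supp Co (x + y)%MM.
Proof.
move=> /forallP hx /forallP hy; apply/forallP => i; rewrite mnmDE addn_eq0.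
by have := hx i; have := hy i; case: (i \in Co) => //= -> ->.
Qed.

Lemma suppU i : supp Co U_(i)%MM = (i \in Co).
Proof.
apply/forallP/idP => [/(_ i)|iC j]; first by rewrite mnm1E eqxx orbF.
by rewrite mnm1E; have [<-|_] := eqVneq i j; rewrite ?iC ?orbT.
Qed.

(** By [core_ext], a monomial with nonzero product with a nontrivial core monomial is itself
    supported in the core, so the condition tests core monomials only, and these agree. *)
Lemma core_xAA i s : i \in Co -> supp Co s -> xAA S i s -> xAA S' i s.
Proof.
move=> iC sC A; have sn : s != 0%MM by apply: contraTneq A => ->; exact: xAA0.
rewrite /xAA -eC // (proj1 (andP A)); apply/allP => v vS; apply/implyP => vs.
have vC : supp Co v.
  apply/forallP => k; case: (posnP (v k)) => [_|vk]; rewrite ?orbT //; apply/orP; left.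
  apply: (core_ext stS' nS' sC sn); apply: (st_leq stS' vs) => k'.
  by rewrite !mnmDE mnm1E; case: (k =P k') => [<-|_]; move: vk; clia.
rewrite -eC; last by rewrite suppD ?suppU.
by apply: (xAAE stS A); rewrite eC // suppD.
Qed.

Lemma core_xmax s : supp Co s -> s != 0%MM -> xmax S s -> xmax S' s.
Proof.
move=> sC sn /andP [sS /forallP h]; rewrite /xmax -eC // sS; apply/forallP => i.
apply/negP => iS; have iC := core_ext stS' nS' sC sn iS.
by have := h i; rewrite eC ?iS // suppD ?suppU.
Qed.
End CoreEq.

Lemma core_count S S' Co (P P' : pred 'X_{1..n}) : stair S -> stair S' ->
  (forall s, supp Co s -> (s \in S) = (s \in S')) -> (forall s, supp Co s -> P s = P' s) ->
  count (fun s => supp Co s && P s) S = count (fun s => supp Co s && P' s) S'.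
Proof.
move=> [uS _ _ _] [uS' _ _ _] e eP.
have -> : count (fun s => supp Co s && P s) S = count (fun s => supp Co s && P' s) S.
  by apply: eq_count => s /=; case: (boolP (supp Co s)) => // /eP ->.
rewrite -!size_filter; apply: perm_size; apply: uniq_perm; rewrite ?filter_uniq //.
by move=> s; rewrite !mem_filter; case: (boolP (supp Co s)) => //= /e ->.
Qed.

(** * Types of the noncore variables *)

Definition prt S j := if [pick i | adj S j i] is Some i then i else j.

(** Noncore types: 0 is isolated, 1 has a nonzero square; in a pair the smaller index gets 2 and the
    larger one [None], so that 2 counts the pairs. *)
Definition tyB S (Co : {set 'I_n}) j : option ('I_n + nat) :=
  if j \in Co then Some (inl j) else if soc S j then Some (inr 0)
  else if prt S j == j then Some (inr 1) else if j < prt S j then Some (inr 2) else None.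

Section Types.
Variables (S : seq 'X_{1..n}) (Co : {set 'I_n}).
Hypotheses (stS : stair S) (nS : nonc S Co).

Lemma prtP j : ~~ soc S j -> adj S j (prt S j).
Proof.
rewrite /prt; case: pickP => // no; rewrite negb_forall => /existsP [i].
by rewrite no.
Qed.

Lemma prtE j i : j \notin Co -> adj S j i -> prt S j = i.
Proof.
move=> jC a; have [u _ _] := nS jC; apply: (u _ _ _ a); apply: prtP.
by rewrite negb_forall; apply/existsP; exists i; rewrite a.
Qed.

Lemma adj_soc j i : adj S j i -> ~~ soc S j.
Proof. by move=> a; rewrite negb_forall; apply/existsP; exists i; rewrite a. Qed.

Lemma prt_prop j : j \notin Co -> ~~ soc S j ->
  [/\ prt S j \notin Co, ~~ soc S (prt S j) & prt S (prt S j) = j].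
Proof.
move=> jC js; have a := prtP js; have [_ _ /(_ _ a) pC] := nS jC.
have a' : adj S (prt S j) j by rewrite adjC.
by split=> //; [exact: adj_soc a'|exact: prtE].
Qed.

(** [prt] is an involution exchanging the two members of each pair. *)
Lemma pair_card : #|[set j | tyB S Co j == Some (inr 2)]| = #|[set j | tyB S Co j == None]|.
Proof.
have t2 j : (tyB S Co j == Some (inr 2)) = [&& j \notin Co, ~~ soc S j & j < prt S j].
  rewrite /tyB; case: (j \in Co) => //; case: soc => //.
  have [e|_] := eqVneq (prt S j) j; first by rewrite e ltnn.
  by case: ltnP.
have t3 j : (tyB S Co j == None) = [&& j \notin Co, ~~ soc S j & prt S j < j].
  rewrite /tyB; case: (j \in Co) => //; case: soc => //.
  have [e|ne] := eqVneq (prt S j) j; first by rewrite e ltnn.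
  by case: ltngtP => // e; rewrite -val_eqE /= e eqxx in ne.
have inj (A : {set 'I_n}) : (forall j, j \in A -> (j \notin Co) && ~~ soc S j) -> {in A &, injective (prt S)}.
  move=> h j j' /h /andP [h1 h2] /h /andP [h1' h2'] e.
  by have [_ _ <-] := prt_prop h1 h2; rewrite e; have [_ _ ->] := prt_prop h1' h2'.
apply/eqP; rewrite eqn_leq -{1}(card_in_imset (f := prt S)); last first.
  by apply: inj => j; rewrite inE t2 => /and3P [-> ->].
rewrite -[X in _ && (X <= _)](card_in_imset (f := prt S)); last first.
  by apply: inj => j; rewrite inE t3 => /and3P [-> ->].
apply/andP; split; apply: subset_leq_card; apply/subsetP => k /imsetP [j]; rewrite inE.
  by rewrite t2 => /and3P [h1 h2 h3] ->; have [h4 h5 h6] := prt_prop h1 h2; rewrite inE t3 h4 h5 h6.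
by rewrite t3 => /and3P [h1 h2 h3] ->; have [h4 h5 h6] := prt_prop h1 h2; rewrite inE t2 h4 h5 h6.
Qed.

(** A maximal monomial outside the core is [x_j], [x_j^2] or a product of the two members of a pair;
    [rep] reaches each one once, from the smaller index. *)
Lemma nbmaxE : nbmax S Co = #|[set j | (j \notin Co) && (tyB S Co j != None)]|.
Proof.
pose rep j := if soc S j then U_(j)%MM else (U_(j) + U_(prt S j))%MM.
pose A := [set j | (j \notin Co) && (tyB S Co j != None)].
have AP j : (j \in A) = (j \notin Co) && (soc S j || (j <= prt S j)).
  rewrite inE /tyB; case: (j \in Co) => //=; case: soc => //=.
  have [->|ne] := eqVneq (prt S j) j; first by rewrite leqnn.
  by case: ltngtP => // e; rewrite -val_eqE /= e eqxx in ne.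
rewrite /nbmax -size_filter cardE -(size_map rep); apply: perm_size; apply: uniq_perm.
- by rewrite filter_uniq //; case: stS.
- rewrite map_inj_in_uniq ?enum_uniq // => j j'; rewrite !mem_enum -/A !AP /rep.
  move=> /andP [jC +] /andP [jC' +]; case: (boolP (soc S j)) => sj; case: (boolP (soc S j')) => sj' /=.
  + by move=> _ _ /mnmP/(_ j); rewrite !mnm1E eqxx; case: eqP.
  + by move=> _ _ /(congr1 mdeg); rewrite mdegD !mdeg1.
  + by move=> _ _ /(congr1 mdeg); rewrite mdegD !mdeg1.
  move=> h h' /mnmP em; apply/eqP; apply: contraT => jj.
  have e1 : prt S j' = j.
    by apply/eqP; have := em j; rewrite !mnmDE !mnm1E eqxx (eq_sym j') (negPf jj); case: (prt S j' == j).
  have e2 : prt S j = j'.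
    by apply/eqP; have := em j'; rewrite !mnmDE !mnm1E eqxx (negPf jj); case: (prt S j == j').
  by rewrite -val_eqE /= eqn_leq -{2}e1 -{1}e2 h h' in jj.
move=> s; rewrite mem_filter; apply/andP/mapP.
  move=> [/andP [sm sN] sS]; have [j jC sj] := suppN sN.
  case: (nonc_form stS nS jC sS sj) => [e|[i a e]].
    have sc : soc S j by apply/forallP => i; case/andP: sm => _ /forallP/(_ i); rewrite e.
    by exists j; rewrite ?mem_enum -/A ?AP ?jC ?sc // /rep sc.
  have js := adj_soc a; have ep := prtE jC a; have [h4 h5 h6] := prt_prop jC js.
  case: (leqP j i) => ji.
    by exists j; rewrite ?mem_enum -/A ?AP ?jC ?ep ?ji ?orbT // /rep (negPf js) ep.
  rewrite ep in h4 h5 h6; exists i; last by rewrite /rep (negPf h5) h6 addmC.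
  by rewrite mem_enum -/A AP h4 h6 ltnW ?orbT.
move=> [j]; rewrite mem_enum -/A AP => /andP [jC h] ->; rewrite /rep.
case: (boolP (soc S j)) h => [sj _|sj /= h].
  case: stS => _ _ h3 _; rewrite h3 /xmax h3 suppU jC andbT; split=> //.
have := pair_max stS nS jC (prtP sj) => mx; rewrite mx; case/andP: (mx) => -> _; split=> //.
by apply/negP => /forallP/(_ j); rewrite (negPf jC) mnmDE mnm1E eqxx.
Qed.
End Types.

(** The unknowns are the numbers of isolated variables, squares and pairs. [xtotal] fixes the number
    of isolated ones and [nbmax]; the value of [nbmax] and the number of noncore variables then form
    a linear system for the other two. *)
Lemma tyB_counts S S' Co : stair S -> stair S' -> nonc S Co -> nonc S' Co ->
  (forall s, supp Co s -> (s \in S) = (s \in S')) -> xtotal S = xtotal S' ->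
  ((forall i j, ~~ adj S i j) <-> (forall i j, ~~ adj S' i j)) ->
  forall t, t != None -> #|[set j | tyB S Co j == t]| = #|[set j | tyB S' Co j == t]|.
Proof.
move=> stS stS' nS nS' eC et eS.
have eC' s : supp Co s -> (s \in S') = (s \in S) by move=> /eC ->.
have ecc i : i \in Co -> cc S Co i = cc S' Co i.
  move=> iC; apply: core_count => // s sC.
  by apply/idP/idP; [apply: core_xAA eC _ _ _ _|apply: core_xAA eC' _ _ _ _].
have emu : mu0 S Co = mu0 S' Co.
  apply: core_count => // s sC; case: (boolP (s == 0%MM)) => sn; rewrite ?andbF ?andbT //.
  by apply/idP/idP; [apply: core_xmax eC _ _ _|apply: core_xmax eC' _ _ _].
pose z T := #|[set j | (j \notin Co) && soc T j]|.
have zn T : (z T = n) -> forall i j, ~~ adj T i j.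
  move=> e; suff full : [set j | (j \notin Co) && soc T j] = setT.
    move=> i; have : i \in [set j | (j \notin Co) && soc T j] by rewrite full inE.
    by rewrite inE => /andP [_ /forallP].
  by apply/eqP; rewrite eqEcard subsetT cardsT card_ord -[#|_|]/(z T) e leqnn.
have zle T : z T <= n by rewrite -[X in _ <= X]card_ord max_card.
have zn' T T' : ((forall i j, ~~ adj T i j) -> (forall i j, ~~ adj T' i j)) -> z T = n -> z T' = n.
  move=> h /[dup] e /zn /h no; rewrite -e; apply: eq_card => j; rewrite !inE; congr (_ && _).
  apply/forallP/forallP => [_ i|_ i //]; apply: zn e _ _.
have key : z S = z S' /\ nbmax S Co = nbmax S' Co.
  have es : \sum_(i in Co) cc S Co i = \sum_(i in Co) cc S' Co i by apply: eq_bigr => i /ecc.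
  have h1 := xtotalE stS nS; have h2 := xtotalE stS' nS'.
  rewrite -/(z S) et es emu in h1; rewrite -/(z S') in h2.
  have h : z S + n * nbmax S' Co = z S' + n * nbmax S Co.
    have gen (A z1 z2 a b B1 B2 c : nat) :
      A + z1 = a + b + B1 + c -> A + z2 = a + b + B2 + c -> z1 + B2 = z2 + B1 by clia.
    exact: gen h1 h2.
  have [n0|n0] := posnP n.
    have nb T : nbmax T Co = 0.
      rewrite /nbmax (@eq_count _ _ pred0) ?count_pred0 // => s /=.
      by apply/negP => /andP [_ /suppN [[j hj] _ _]]; move: hj; rewrite n0.
    by rewrite !nb; split=> //; move: (zle S) (zle S'); rewrite n0; clia.
  have zz : z S = z S'.
    have [e|ne] := eqVneq (z S) n; first by rewrite e (zn' _ _ (proj1 eS) e).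
    have [e'|ne'] := eqVneq (z S') n; first by rewrite e' (zn' _ _ (proj2 eS) e').
    have lt : z S < n by rewrite ltn_neqAle ne zle.
    have lt' : z S' < n by rewrite ltn_neqAle ne' zle.
    (* Both [z S] and [z S'] are now less than [n], so reducing modulo [n] identifies them. *)
    have := congr1 (fun c : nat => c %% n) h.
    by rewrite /= ![_ + n * _]addnC !(mulnC n) !modnMDl !modn_small.
  split=> //; apply/eqP; rewrite -(eqn_pmul2l n0); apply/eqP/esym.
  by move: h; rewrite zz => /addnI.
case: key => ez eB.
have t0 T : #|[set j | tyB T Co j == Some (inr 0)]| = z T.
  apply: eq_card => j; rewrite !inE /tyB; case: (j \in Co) => //=; case: soc => //=.
  by case: (prt T j == j) => //; case: (j < prt T j).
pose c T t := #|[set j | tyB T Co j == t]|.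
have cs (P : pred 'I_n) : #|[set j | P j]| = \sum_(j < n) P j.
  by rewrite -sum1_card big_mkcond; apply: eq_bigr => j _; rewrite inE; case: (P j).
have cB T : #|[set j | (j \notin Co) && (tyB T Co j != None)]| = c T (Some (inr 0)) + c T (Some (inr 1)) + c T (Some (inr 2)).
  rewrite /c !cs -!big_split /=; apply: eq_bigr => j _; rewrite /tyB.
  case: (j \in Co) => //=; case: soc => //=; case: (prt T j == j) => //=.
  by case: (j < prt T j).
have cW T : c T (Some (inr 0)) + c T (Some (inr 1)) + c T (Some (inr 2)) + c T None = #|~: Co|.
  have -> : ~: Co = [set j | j \notin Co] by apply/setP => j; rewrite !inE.
  rewrite /c !cs -!big_split /=; apply: eq_bigr => j _; rewrite /tyB.
  case: (j \in Co) => //=; case: soc => //=; case: (prt T j == j) => //=.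
  by case: (j < prt T j).
have p1 := pair_card nS; have p2 := pair_card nS'.
have b1 := nbmaxE stS nS; have b2 := nbmaxE stS' nS'.
have w1 := cW S; have w2 := cW S'.
rewrite !cB in b1 b2.
rewrite -!/(c _ _) in p1 p2.
have z1 := t0 S; have z2 := t0 S'; rewrite -!/(c _ _) in z1 z2.
move=> [[i|q]|] // _.
  have inlE T j : (tyB T Co j == Some (inl i)) = (j \in Co) && (j == i).
    rewrite /tyB; case: (j \in Co) => //=; case: (soc T j) => //.
    by case: (prt T j == j) => //; case: (j < prt T j).
  by apply: eq_card => j; rewrite !inE !inlE.
have gen (z0 B W a0 a1 a2 a3 b0 b1' b2' b3 : nat) : a2 = a3 -> b2' = b3 -> B = a0 + a1 + a2 ->
  B = b0 + b1' + b2' -> a0 + a1 + a2 + a3 = W -> b0 + b1' + b2' + b3 = W -> a0 = z0 -> b0 = z0 ->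
  a1 = b1' /\ a2 = b2' by clia.
rewrite ez in z1; rewrite eB in b1.
rewrite -!/(c _ _); case: q => [|[|[|q]]].
- by rewrite z1 z2.
- by have [] := gen _ _ _ _ _ _ _ _ _ _ _ p1 p2 b1 b2 w1 w2 z1 z2.
- by have [] := gen _ _ _ _ _ _ _ _ _ _ _ p1 p2 b1 b2 w1 w2 z1 z2.
have no T : c T (Some (inr q.+3)) = 0.
  apply: eq_card0 => j; rewrite inE /tyB; case: (j \in Co) => //=; case: soc => //=.
  by case: (prt T j == j) => //; case: (j < prt T j).
by rewrite !no.
Qed.

Lemma stair_match S S' Co : stair S -> stair S' -> nonc S Co -> nonc S' Co ->
  (forall s, supp Co s -> (s \in S) = (s \in S')) -> xtotal S = xtotal S' ->
  ((forall i j, ~~ adj S i j) <-> (forall i j, ~~ adj S' i j)) ->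
  exists p, forall s, (s \in S) = (pm p s \in S').
Proof.
move=> stS stS' nS nS' eC et eS.
have [p0 hp0] := perm_of_counts (tyB_counts stS stS' nS nS' eC et eS).
have tCo T j : j \in Co -> tyB T Co j = Some (inl j) by rewrite /tyB => ->.
have Cot T j i : tyB T Co j = Some (inl i) -> j \in Co /\ j = i.
  rewrite /tyB; case: (j \in Co) => [[] //|]; case: soc => //.
  by case: (prt T j == j) => //; case: (j < prt T j).
have p0C j : j \in Co -> p0 j = j.
  by move=> jC; have := hp0 j; rewrite (tCo S) // => /Cot [].
have p0C' j : j \notin Co -> p0 j \notin Co.
  by apply: contra => h; have := hp0 j; rewrite (tCo S') // => /esym /Cot [].
have socP T j : j \notin Co -> soc T j = (tyB T Co j == Some (inr 0)).
  move=> jC; rewrite /tyB (negPf jC); case: soc => //=.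
  by case: (prt T j == j) => //; case: (j < prt T j).
have p0s j : j \notin Co -> soc S' (p0 j) = soc S j.
  by move=> jC; rewrite !socP ?p0C' // hp0.
(* [p0] preserves types but may separate the members of a pair. It is kept on the member of type 2,
   and the other member is sent to the partner of that image. *)
pose f j := if tyB S Co j == None then prt S' (p0 (prt S j)) else p0 j.
have noneP T j : tyB T Co j = None -> j \notin Co /\ ~~ soc T j.
  by rewrite /tyB; case: (j \in Co) => //; case: soc.
have prt_none T j : nonc T Co -> tyB T Co j = None -> tyB T Co (prt T j) = Some (inr 2).
  move=> nT h; have [jC js] := noneP T j h; have [h4 h5 h6] := prt_prop nT jC js.
  move: h; rewrite /tyB (negPf jC) (negPf js) (negPf h4) (negPf h5) h6.
  by rewrite -!val_eqE /=; case: ltngtP.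
have two_prt T j : nonc T Co -> tyB T Co j = Some (inr 2) -> [/\ j \notin Co, ~~ soc T j & tyB T Co (prt T j) = None].
  move=> nT; rewrite {1}/tyB; case: (boolP (j \in Co)) => // jC; case: (boolP (soc T j)) => // js.
  have [h4 h5 h6] := prt_prop nT jC js.
  rewrite /tyB (negPf h4) (negPf h5) h6 -!val_eqE /=.
  by case: ltngtP.
have tf j : tyB S' Co (f j) = tyB S Co j.
  rewrite /f; case: eqP => [e|_]; last exact: hp0.
  by have := prt_none S j nS e; rewrite -hp0 => /(two_prt S' _ nS') [_ _ ->].
have finj : injective f.
  move=> j j' e; have et' : tyB S Co j = tyB S Co j' by rewrite -!tf e.
  move: e; rewrite /f -et'; case: eqP => [tj|_]; last exact: perm_inj.
  have tj' : tyB S Co j' = None by rewrite -et'.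
  have := prt_none S j nS tj; rewrite -hp0 => /(two_prt S' _ nS') [a1 a2 _].
  have := prt_none S j' nS tj'; rewrite -hp0 => /(two_prt S' _ nS') [a1' a2' _].
  have [_ _ b] := prt_prop nS' a1 a2; have [_ _ b'] := prt_prop nS' a1' a2'.
  move=> e; have := congr1 (prt S') e; rewrite b b' => /perm_inj e2.
  have [c1 c2] := noneP _ _ tj; have [c1' c2'] := noneP _ _ tj'.
  have [_ _ <-] := prt_prop nS c1 c2; have [_ _ <-] := prt_prop nS c1' c2'.
  by rewrite e2.
pose p := perm finj; exists p => s.
have pf j : p j = f j by rewrite permE.
have fC j : j \in Co -> p j = j by move=> jC; rewrite pf /f (tCo S) //= p0C.
have fC' j : (p j \in Co) = (j \in Co).
  apply/idP/idP => [h|/[dup] /fC -> //].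
  by have := fC _ h => /perm_inj e; rewrite -e.
have fs j : j \notin Co -> soc S' (p j) = soc S j.
  by move=> jC; rewrite !socP ?fC' // pf tf.
have fprt j : j \notin Co -> ~~ soc S j -> prt S' (p j) = p (prt S j).
  move=> jC js; have [h4 h5 h6] := prt_prop nS jC js; rewrite !pf.
  have [tj|tj] := eqVneq (tyB S Co j) None.
    have t2 := prt_none _ _ nS tj.
    rewrite /f tj eqxx t2 /=; have := t2; rewrite -hp0 => /(two_prt S' _ nS') [a1 a2 _].
    by have [_ _ ->] := prt_prop nS' a1 a2.
  rewrite {1}/f (negPf tj); have [e|ne] := eqVneq (prt S j) j.
    rewrite e /f (negPf tj); have : tyB S Co j = Some (inr 1).
      by rewrite /tyB (negPf jC) (negPf js) e eqxx.
    rewrite -hp0 /tyB (negPf (p0C' _ jC)) p0s // (negPf js).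
    by case: eqP => //; case: ltnP.
  have t2 : tyB S Co j = Some (inr 2).
    by move: tj; rewrite /tyB (negPf jC) (negPf js) (negPf ne); case: ltnP.
  have [_ _ tn] := two_prt _ _ nS t2.
  by rewrite /f tn eqxx h6.
case: (boolP (supp Co s)) => [sC|/suppN [j jC sj]].
  suff -> : pm p s = s by apply: eC.
  apply/mnmP => i; rewrite pmV; case: (boolP (i \in Co)) => iC.
    by rewrite -{1}(fC i iC) permK.
  have iC' : (p^-1)%g i \notin Co by rewrite -fC' permKV.
  have z i' : i' \notin Co -> s i' = 0.
    by move=> i'H; move/forallP/(_ i'): sC; rewrite (negPf i'H) /= => /eqP.
  by rewrite !z.
have pjC : p j \notin Co by rewrite fC'.
have psj : 0 < pm p s (p j) by rewrite pmE.
apply/idP/idP => sS.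
  case: (nonc_form stS nS jC sS sj) => [->|[i a ->]]; first by rewrite pmU; case: stS'.
  rewrite -(prtE nS jC a) pmD !pmU -fprt //; last exact: adj_soc a.
  by apply: prtP; rewrite fs //; exact: adj_soc a.
case: (nonc_form stS' nS' pjC sS psj) => [e|[i a e]].
  have -> : s = U_(j)%MM by apply: (can_inj (pmK p)); rewrite pmU.
  by case: stS.
have js : ~~ soc S j by rewrite -fs //; exact: adj_soc a.
have -> : s = (U_(j) + U_(prt S j))%MM.
  by apply: (can_inj (pmK p)); rewrite pmD !pmU -fprt // (prtE nS' pjC a).
exact: prtP.
Qed.

Lemma stair_iso S S' H : stair S -> stair S' -> thin S H -> thin S' H ->
  (forall x, supp H x -> (x \in S) = (x \in S')) ->
  (forall x, supp H x -> x != 0%MM -> tc S H x = tc S' H x) ->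
  xtotal S = xtotal S' -> ((forall i j, ~~ adj S i j) <-> (forall i j, ~~ adj S' i j)) ->
  exists p, forall s, (s \in S) = (pm p s \in S').
Proof.
move=> stS stS' tS tS' eH et ext eS.
have [p [Co [eC nS nS']]] := core_match stS stS' tS tS' eH et.
have [||q hq] := stair_match stS (stair_permS p stS') nS nS' eC.
- by rewrite xtotal_permS.
- apply: (iff_trans eS); split=> h i j; first by rewrite adj_permS.
  by have := h ((p^-1)%g i) ((p^-1)%g j); rewrite adj_permS !permKV.
by exists (q * p)%g => s; rewrite hq mem_permS pmM.
Qed.

End Stair.

Import GRing.Theory Num.Theory Order.TTheory VectorInternalTheory.
Local Open Scope ring_scope.

Ltac dord := repeat (match goal with
  |- context[@eq_op _ ?a ?b] => match type of a with 'I_ _ =>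
     case: (a =P b) => [?|?]; subst; rewrite ?eqxx end end);
  try (exfalso; congruence); try lia.

(** * Recovering a staircase from its root multiplicities *)

Section Frames.
Variables (n : nat) (M : zmodType).

(* A staircase [st] in a lattice [M] with basis [vec]. The lattice is the character group of a torus, and
   two frames on the same lattice are two algebras with a common torus. *)
Record frame := Frame {
  vec : 'I_n -> M;
  crd : 'I_n -> M -> int;
  st : seq M;
  crdD : forall i x y, crd i (x + y) = crd i x + crd i y;
  crd_vec : forall i j, crd i (vec j) = (i == j)%:Z;
  crd_inj : forall x y, (forall i, crd i x = crd i y) -> x = y;
  st_uniq : uniq st;
  st_ge0 : forall i x, x \in st -> 0 <= crd i x;
  st_down : forall i x, x \in st -> 0 < crd i x -> x - vec i \in st;
  st_vec : forall i, vec i \in st;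
  st_0 : 0 \in st }.

Definition AA (F : frame) i s :=
  (s \in st F) && all (fun v => (v + s \in st F) ==> (v + vec F i \in st F)) (st F).
(* the dimension of the space of derivations of weight [a] *)
Definition mult (F : frame) a := #|[set i | AA F i (a + vec F i)]|.
Definition maxi (F : frame) s := (s \in st F) && [forall i, s + vec F i \notin st F].

Section OneFrame.
Variable F : frame.
Implicit Types (x y s v a : M).
Notation e := (vec F).
Notation c := (crd F).

Lemma crd0 i : c i 0 = 0.
Proof. by have := crdD F i 0 0; rewrite addr0; lia. Qed.
Lemma crdN i x : c i (- x) = - c i x.
Proof. by have := crdD F i x (- x); rewrite subrr crd0; lia. Qed.
Lemma crdB i x y : c i (x - y) = c i x - c i y.
Proof. by rewrite crdD crdN. Qed.
Lemma crdMn i x k : c i (x *+ k) = c i x * k%:Z.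
Proof. by elim: k => [|k IH]; rewrite ?mulr0n ?crd0 ?mulrS ?crdD ?IH; lia. Qed.
Lemma crd_sum i (I : Type) (r : seq I) (P : pred I) (f : I -> M) :
  c i (\sum_(k <- r | P k) f k) = \sum_(k <- r | P k) c i (f k).
Proof. by apply: (big_morph (c i)) => [x y|]; rewrite ?crdD ?crd0. Qed.

Definition crdE := (crdD, crdN, crdMn, crd_vec, crd0).

Lemma st_le y x : y \in st F -> (forall i, 0 <= c i x <= c i y) -> x \in st F.
Proof.
move: {2}(absz (\sum_i (c i y - c i x))) (erefl (absz (\sum_i (c i y - c i x)))) => k.
elim: k y => [|k IH] y ek yS le.
  have z : \sum_i (c i y - c i x) = 0 by lia.
  suff -> : x = y by [].
  apply: (@crd_inj F) => i.
  have /psumr_eq0P H : forall i, true -> 0 <= c i y - c i x.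
    by move=> j _; have := le j; lia.
  by have := H z i isT; lia.
have [j hj] : exists j, c j x < c j y.
  apply/existsP; apply: contraT; rewrite negb_exists => /forallP h.
  suff : \sum_i (c i y - c i x) = 0 by lia.
  by apply: big1 => i _; have := le i; have := h i; lia.
have := le j => lej.
apply: (IH (y - e j)).
- have -> : \sum_i (c i (y - e j) - c i x) = \sum_i (c i y - c i x) - 1.
    have -> : \sum_i (c i (y - e j) - c i x) = \sum_i ((c i y - c i x) - (i == j)%:Z).
      by apply: eq_bigr => i _; rewrite !crdE -addrA [- _ + _]addrC addrA.
    rewrite sumrB; congr (_ - _).
    by rewrite (bigD1 j) //= eqxx big1 ?addr0 // => i /negPf ->.
  have : 0 <= \sum_i (c i y - c i x) by apply: sumr_ge0 => i _; have := le i; lia.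
  lia.
- by apply: st_down => //; lia.
- by move=> i; rewrite !crdE; have := le i; case: eqP => [->|_]; lia.
Qed.

Lemma AAP i s : reflect (s \in st F /\ forall v, (forall k, 0 <= c k v) ->
   v + s \in st F -> v + e i \in st F) (AA F i s).
Proof.
apply: (iffP andP) => [] [sS h]; split => //.
  move=> v v0 vs; have /allP/(_ v) := h.
  rewrite vs /=; apply; apply: (st_le vs) => k.
  by rewrite crdE v0 /=; have := st_ge0 k sS; lia.
apply/allP => v vS; apply/implyP => vs; apply: h => // k; exact: st_ge0.
Qed.

Definition wroot a := (0 < mult F a)%N.

Lemma wrootP a : reflect (exists i, AA F i (a + e i)) (wroot a).
Proof.
rewrite /wroot /mult card_gt0; apply: (iffP (set0Pn _)) => -[i hi]; exists i; move: hi; rewrite inE //.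
Qed.

Lemma AA_st i s : AA F i s -> s \in st F.
Proof. by case/andP. Qed.

Lemma AA_ge0 a i j : AA F i (a + e i) -> 0 <= c j a + (j == i)%:Z.
Proof. by move/AA_st => /(st_ge0 j); rewrite !crdE. Qed.

Lemma AA_pos a i : (forall k, 0 <= c k a) -> AA F i (a + e i) = (a + e i \in st F).
Proof.
move=> a0; apply/idP/idP => [/AA_st //|h]; apply/AAP; split => // v v0 vs.
by apply: (st_le vs) => k; rewrite !crdE; have := v0 k; have := a0 k; lia.
Qed.

Lemma AA_neg a i j : c j a < 0 -> AA F i (a + e i) -> i = j.
Proof. by move=> aj /(@AA_ge0 _ _ j); case: eqP => [->//|_]; lia. Qed.

Lemma mult_neg a j : c j a < 0 -> (mult F a <= 1)%N.
Proof.
move=> aj; rewrite -(cards1 j); apply/subset_leq_card/subsetP => i.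
by rewrite !inE => /(AA_neg aj) ->.
Qed.

(** Adding a single basis vector has to make all coordinates nonnegative, so a negative coordinate
    is unique, equals -1, and names the variable that the derivation moves. *)
Lemma root_neg a j : c j a < 0 -> wroot a ->
  [/\ c j a = -1, forall i, i != j -> 0 <= c i a & AA F j (a + e j)].
Proof.
move=> aj /wrootP [i hi]; have ij := AA_neg aj hi; subst i; split => //.
  by have := AA_ge0 j hi; rewrite eqxx; lia.
by move=> i ij; have := AA_ge0 i hi; rewrite (negPf ij); lia.
Qed.

Lemma root_pos a : (forall k, 0 <= c k a) -> wroot a = [exists i, a + e i \in st F].
Proof.
move=> a0; apply/wrootP/existsP => -[i hi]; exists i; first exact: AA_st hi.
by rewrite AA_pos.
Qed.

Lemma root_posW a i : (forall k, 0 <= c k a) -> a + e i \in st F -> wroot a.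
Proof. by move=> a0 h; rewrite root_pos //; apply/existsP; exists i. Qed.

Lemma root_sign a : wroot a ->
  ((forall k, 0 <= c k a) /\ exists i, a + e i \in st F) \/
  (exists j, [/\ c j a = -1, forall i, i != j -> 0 <= c i a & AA F j (a + e j)]).
Proof.
move=> ra; case: (boolP [forall k, 0 <= c k a]) => [/forallP a0|].
  by left; split=> //; apply/existsP; rewrite -root_pos.
rewrite negb_forall => /existsP [j hj]; right; exists j; apply: root_neg => //; lia.
Qed.

Lemma st_ext a i : (forall k, 0 <= c k a) -> a + e i \in st F -> a \in st F.
Proof. by move=> a0 h; apply: (st_le h) => k; rewrite !crdE a0 /=; lia. Qed.

Lemma maxiP s : reflect (s \in st F /\ forall i, s + e i \notin st F) (maxi F s).
Proof. by apply: (iffP andP) => -[h /forallP]. Qed.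

Lemma maxi_ge s v : maxi F s -> (forall k, 0 <= c k v) -> v + s \in st F -> v = 0.
Proof.
move=> /maxiP [sS h] v0 vs; apply: (@crd_inj F) => i; rewrite crd0.
apply/eqP; rewrite eq_le v0 andbT leNgt; apply/negP => vi.
have /negP := h i; apply; apply: (st_le vs) => k; rewrite !crdE.
have := v0 k; have := st_ge0 k sS; case: eqP => [->|_]; lia.
Qed.

Lemma AA_maxi i s : maxi F s -> AA F i s.
Proof.
move=> ms; have [sS _] := maxiP _ ms; apply/AAP; split=> // v v0 /(maxi_ge ms v0) ->.
by rewrite add0r st_vec.
Qed.

Lemma root_maxi i s : maxi F s -> wroot (s - e i).
Proof. by move=> ms; apply/wrootP; exists i; rewrite subrK AA_maxi. Qed.

Lemma nonmax_root s : (s \in st F) -> ~~ maxi F s -> wroot s.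
Proof.
move=> sS; rewrite /maxi sS /= negb_forall => /existsP [i]; rewrite negbK => h.
by apply: root_posW h => k; exact: st_ge0.
Qed.

(** With [nonmax_root]: the nonnegative roots are exactly the non-maximal monomials. The roots thus
    see a staircase except for its maximal elements. *)
Lemma root_nonmax s : (forall k, 0 <= c k s) -> wroot s -> s \in st F /\ ~~ maxi F s.
Proof.
move=> s0; rewrite root_pos // => /existsP [i hi]; split; first exact: st_ext hi.
by apply/negP => /maxiP [_ /(_ i)]; rewrite hi.
Qed.

Lemma max_above (P : pred M) s : s \in st F -> P s ->
  exists m, [/\ m \in st F, P m, forall k, c k s <= c k m &
    forall i, P (m + e i) -> m + e i \notin st F].
Proof.
pose d x := (\sum_i absz (c i x))%N.
pose B := (\max_(x <- st F) d x)%N.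
have dB x : x \in st F -> (d x <= B)%N.
  by move=> xS; apply: leq_bigmax_seq.
have ds x i : x \in st F -> d (x + e i) = (d x).+1.
  move=> xS; rewrite /d (bigD1 i) //= [in RHS](bigD1 i) //= -addSn; congr addn.
    by rewrite !crdE eqxx; have := st_ge0 i xS; lia.
  by apply: eq_bigr => j /negPf ji; rewrite !crdE ji addr0.
move: {2}(B - d s)%N (leqnn (B - d s)%N) => k.
elim: k s => [|k IH] s lek sS Ps;
  case: (boolP [exists i, P (s + e i) && (s + e i \in st F)]).
- by case/existsP=> i /andP [Pi iS]; have := dB _ iS; rewrite ds //; lia.
- rewrite negb_exists => /forallP h; exists s; split=> // i Pi; have := h i.
  by rewrite Pi.
- case/existsP=> i /andP [Pi iS].
  have [|m [mS Pm le h]] := IH _ _ iS Pi; first by rewrite ds //; have := dB _ iS; rewrite ds //; lia.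
  exists m; split=> // j; apply: le_trans (le j); rewrite !crdE; lia.
- rewrite negb_exists => /forallP h; exists s; split=> // i Pi; have := h i.
  by rewrite Pi.
Qed.

(** Otherwise adding [e i] would preserve the staircase, and no element above [e i] could be
    maximal. *)
Lemma not_root_oppvec i : ~~ wroot (- e i).
Proof.
apply/negP => r; have [|_ _] := @root_neg _ i _ r; first by rewrite !crdE eqxx.
rewrite addNr => /AAP [_ h].
have [m [mS _ le hm]] := @max_above predT _ (st_vec F i) isT.
have := hm i isT; rewrite h ?addr0 // => k; exact: st_ge0.
Qed.

Lemma crdMz i x (z : int) : c i (x *~ z) = c i x * z.
Proof. by case: z => k; rewrite ?NegzE ?mulrNz ?crdN -?pmulrn crdMn; lia. Qed.

Lemma crd_decomp x : x = \sum_i e i *~ c i x.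
Proof.
apply: (@crd_inj F) => i; rewrite crd_sum (bigD1 i) //= big1 => [|j ji].
  by rewrite crdMz crd_vec eqxx mul1r addr0.
by rewrite crdMz crd_vec eq_sym (negPf ji) mul0r.
Qed.

(* Thickness depends on [mult] only, and thick basis vectors are common to both frames. *)
Definition thickv a := (1 < mult F a)%N || wroot (a + a).

Lemma crd_vec0 i j : 0 <= c i (e j).
Proof. by rewrite crd_vec. Qed.

Lemma thin_uniq j i i' : ~~ thickv (e j) ->
  e j + e i \in st F -> e j + e i' \in st F -> i = i'.
Proof.
rewrite negb_or => /andP [h _] hi hi'; apply/eqP; apply: contraR h => ii'.
apply/card_gt1P; exists i, i'; split=> //; rewrite inE AA_pos // => k; exact: crd_vec0.
Qed.

Lemma thin_sq j i : ~~ thickv (e j) -> e j + e j + e i \notin st F.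
Proof.
rewrite negb_or => /andP [_ h]; apply: contra h => h.
by apply: root_posW h => k; rewrite !crdE; lia.
Qed.

Lemma thin_pair j i s : ~~ thickv (e j) -> s \in st F -> 0 < c j s -> i != j -> 0 < c i s ->
  [/\ e j + e i \in st F, c j s = 1 & forall k, k != j -> k != i -> c k s = 0].
Proof.
move=> tj sS js ij is_.
have ji : e j + e i \in st F.
  move/eqP: ij => ij; apply: (st_le sS) => k; rewrite !crdE; have := st_ge0 k sS.
  dord.
split=> //.
  apply/eqP; rewrite eq_le -gtz0_ge1 js andbT leNgt; apply/negP => j2.
  suff jj : e j + e j \in st F by move: ij; rewrite (thin_uniq tj ji jj) eqxx.
  by apply: (st_le sS) => k; rewrite !crdE; have := st_ge0 k sS; case: eqP => [->|_]; lia.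
move=> k kj ki; apply/eqP; rewrite eq_le (st_ge0 k sS) andbT leNgt; apply/negP => ks.
suff jk : e j + e k \in st F by move: ki; rewrite (thin_uniq tj ji jk) eqxx.
move/eqP: kj => kj; apply: (st_le sS) => k'; rewrite !crdE; have := st_ge0 k' sS; dord.
Qed.

Lemma vec_neq0 i : e i != 0.
Proof. by apply/eqP => h; have := crd_vec F i i; rewrite h crd0 eqxx. Qed.

Lemma crd_gt0 x : (forall i, 0 <= c i x) -> x != 0 -> exists i, 0 < c i x.
Proof.
move=> x0 xn0; apply/existsP; apply: contraR xn0; rewrite negb_exists => /forallP h.
by apply/eqP; apply: (@crd_inj F) => i; rewrite crd0; have := x0 i; have := h i; lia.
Qed.

Lemma vec_inj : injective e.
Proof. by move=> i j h; have := crd_vec F i j; rewrite -h crd_vec eqxx; case: eqP. Qed.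

End OneFrame.

(** * Thick vectors belong to both bases *)

Section TwoFrames.
Variables E F : frame.
Hypothesis EF : forall a, mult E a = mult F a.

Lemma root_EF a : wroot E a = wroot F a.
Proof. by rewrite /wroot EF. Qed.
Lemma thickv_EF a : thickv E a = thickv F a.
Proof. by rewrite /thickv EF root_EF. Qed.

Lemma thickv_ge0 (G : frame) a k : thickv G a -> 0 <= crd G k a.
Proof.
move=> t; rewrite leNgt; apply/negP => ak; case/orP: t => [|r].
  by have := mult_neg ak; lia.
by have [|h _ _] := @root_neg _ _ k _ r; [rewrite crdD; lia | move: h; rewrite crdD; lia].
Qed.

(** In [F] the vector [a] is a nonnegative combination of basis vectors. If it is not one of them,
    every [vec F k] occurring in it has nonnegative [E]-coordinates; as these vectors add up to
    [vec E j], which is indecomposable in the cone of [E], only one can occur. *)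
Lemma thick_vec j : thickv E (vec E j) -> exists k, vec E j = vec F k.
Proof.
set a := vec E j => ta.
have tF : thickv F a by rewrite -thickv_EF.
have a0 k : 0 <= crd F k a by apply: thickv_ge0.
have ra : wroot F a.
  case/orP: tF => [|]; first by rewrite /wroot; clia.
  rewrite -!root_EF => r; have [||aS _] := @root_nonmax E (a + a); rewrite ?r //.
    by move=> k; rewrite !crdE; clia.
  by apply: root_posW aS => k; exact: crd_vec0.
have /existsP [l hl] : [exists i, a + vec F i \in st F] by rewrite -root_pos.
have aS : a \in st F by apply: st_ext hl.
have [k0 hk0] : exists k, 0 < crd F k a by apply: crd_gt0; rewrite ?vec_neq0.
case: (boolP [exists k, a == vec F k]) => [/existsP [k /eqP ->]|]; first by exists k.
rewrite negb_exists => /forallP nak.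
(* A negative [E]-coordinate makes [vec F k] thin, so its only neighbour is [vec F l], which also
   occurs in [a - vec F k]. Thickness of [a] would give [vec F k] two neighbours or make it a
   neighbour of itself. *)
have key k : 0 < crd F k a -> forall i, 0 <= crd E i (vec F k).
  move=> ck i; rewrite leNgt; apply/negP => ik.
  have tk : ~~ thickv F (vec F k).
    by rewrite -thickv_EF; apply/negP => /(thickv_ge0 i); lia.
  have k0' k1 : 0 <= crd F k1 (a - vec F k).
    by rewrite !crdE; have := a0 k1; case: eqP => [->|_]; lia.
  have [i1 hi1] : exists i, 0 < crd F i (a - vec F k).
    by apply: crd_gt0 => //; rewrite subr_eq0 nak.
  have kl : vec F k + vec F l \in st F.
    by apply: (st_le hl) => k1; rewrite !crdE; have := k0' k1; rewrite !crdE; clia.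
  have ki1 : vec F k + vec F i1 \in st F.
    apply: (st_le aS) => k1; rewrite !crdE; have := k0' k1; rewrite !crdE.
    by move: hi1; rewrite !crdE; case: (k1 =P i1) => [->|_]; clia.
  have li1 := thin_uniq tk kl ki1; subst l.
  case: (i1 =P k) => [ik1|/eqP ik1].
    subst i1; have /negP := thin_sq k tk; apply; apply: (st_le hl) => k1.
    rewrite !crdE; have := k0' k1; rewrite !crdE.
    by move: hi1; rewrite !crdE; case: (k1 =P k) => [->|_]; rewrite ?eqxx; clia.
  case/orP: tF => [|r2].
    rewrite /mult => /card_gt1P [x [y [+ + /eqP xy]]]; rewrite !inE !AA_pos // => hx hy; apply: xy.
    apply: (@thin_uniq F k) tk _ _.
      by apply: (st_le hx) => k1; rewrite !crdE; have := k0' k1; rewrite !crdE; clia.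
    by apply: (st_le hy) => k1; rewrite !crdE; have := k0' k1; rewrite !crdE; clia.
  have [|aa _] := root_nonmax _ r2; first by move=> k1; rewrite !crdE; have := a0 k1; clia.
  have kk : vec F k + vec F k \in st F.
    apply: (st_le aa) => k1; rewrite !crdE; have := k0' k1; rewrite !crdE.
    by have := a0 k1; clia.
  by move: ik1; rewrite (thin_uniq tk ki1 kk) eqxx.
exists k0.
have sub i : 0 <= crd E i (a - vec F k0).
  rewrite (crd_decomp F (a - vec F k0)) crd_sum; apply: sumr_ge0 => k _.
  have h0 : 0 <= crd F k (a - vec F k0).
    by rewrite !crdE; have := a0 k; case: eqP => [->|_]; lia.
  have [z0|kn0] := eqVneq (crd F k (a - vec F k0)) 0; first by rewrite z0 mulr0z crd0.
  have ka : 0 < crd F k a by move: h0 kn0; rewrite !crdE; clia.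
  have := key k ka i; case: (crd F k (a - vec F k0)) h0 => // m _ h.
  by rewrite -pmulrn crdMn; apply: mulr_ge0.
have kk := key _ hk0.
apply/eqP; rewrite -subr_eq0; apply/eqP/(@crd_inj E) => i.
have [i1 hi1] := crd_gt0 kk (vec_neq0 F k0).
have := sub i1; rewrite !crdE; move: hi1; case: (i1 =P j) => [->|_]; last by clia.
move=> h1 h2; have := sub i; have := kk i; rewrite !crdE; case: (i =P j) => [->|_]; lia.
Qed.

End TwoFrames.

Section Relabel.
Variables (F : frame) (s : {perm 'I_n}).

Definition relabel : frame.
Proof.
exists (fun i => vec F (s i)) (fun i => crd F (s i)) (st F).
- by move=> *; rewrite crdD.
- by move=> i j; rewrite crd_vec (inj_eq perm_inj).
- by move=> x y h; apply: (@crd_inj F) => i; rewrite -(permKV s i); apply: h.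
- exact: st_uniq.
- by move=> i x; apply: st_ge0.
- by move=> i x; apply: st_down.
- by move=> i; apply: st_vec.
- exact: st_0.
Defined.

Lemma mult_relabel a : mult relabel a = mult F a.
Proof.
rewrite /mult -[in RHS](card_preimset _ (@perm_inj _ s)); congr #|pred_of_set _|.
by apply/setP => i; rewrite !inE.
Qed.
End Relabel.

End Frames.

(** * Monomials in the thick variables *)

Section Match.
Variables (n : nat) (M : zmodType).
Implicit Types (E F G : frame n M) (i j k h l : 'I_n) (s v a x m : M).

Definition th G i := thickv G (vec G i).
Definition inH G x := [forall i, (0 <= crd G i x) && (th G i || (crd G i x == 0))].
Definition tcount G a := #|[set j | ~~ th G j && (a + vec G j \in st G)]|.
Definition ecount G a := #|[set j | th G j && (a + vec G j \in st G)]|.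

Definition matched E F := [/\ forall a, mult E a = mult F a,
  forall i, th E i -> vec F i = vec E i & forall i, th F i -> vec F i = vec E i].

Lemma matched_sym E F : matched E F -> matched F E.
Proof. by case=> h1 h2 h3; split=> [a|i hi|i hi]; [rewrite h1|rewrite h3|rewrite h2]. Qed.

Lemma inHP G x : reflect ((forall i, 0 <= crd G i x) /\ (forall i, ~~ th G i -> crd G i x = 0)) (inH G x).
Proof.
apply: (iffP forallP) => [h|[h1 h2] i]; last first.
  by rewrite h1 /=; case: (boolP (th G i)) => //= /h2 ->.
split=> i; first by case/andP: (h i).
by move=> /negPf ti; case/andP: (h i) => _; rewrite ti => /eqP.
Qed.

Lemma inH_add G x i : inH G x -> th G i -> inH G (x + vec G i).
Proof.
move=> /inHP [h1 h2] ti; apply/inHP; split=> j; first by rewrite !crdE; have := h1 j; lia.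
move=> tj; rewrite !crdE h2 //; case: eqP => [ji|] //; by rewrite ji ti in tj.
Qed.

Lemma inH_vec G i : th G i -> inH G (vec G i).
Proof.
move=> ti; apply/inHP; split=> j; rewrite crd_vec // => tj.
by case: eqP => // ji; rewrite ji ti in tj.
Qed.

Lemma mult_split G a : (forall k, 0 <= crd G k a) -> mult G a = (ecount G a + tcount G a)%N.
Proof.
move=> a0; rewrite /mult -(cardsID [set j | th G j]); congr (_ + _)%N.
  by apply: eq_card => j; rewrite !inE AA_pos // andbC.
by apply: eq_card => j; rewrite !inE AA_pos.
Qed.

Section EF.
Variables E F : frame n M.
Hypothesis mEF : matched E F.

Lemma rootEF a : wroot E a = wroot F a.
Proof. by apply: root_EF; case: mEF. Qed.

Lemma thEF i : th E i = th F i.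
Proof.
case: mEF => h1 h2 h3; apply/idP/idP => ti.
  by rewrite /th h2 // -(thickv_EF h1).
by rewrite /th -h3 // (thickv_EF h1).
Qed.

Lemma vecEF i : th E i -> vec F i = vec E i.
Proof. by case: mEF => _ h _; exact: h. Qed.

Lemma crdEF x : (forall i, ~~ th E i -> crd E i x = 0) -> forall i, crd F i x = crd E i x.
Proof.
move=> h i; rewrite [in LHS](crd_decomp E x).
have -> : \sum_k vec E k *~ crd E k x = \sum_k vec F k *~ crd E k x.
  apply: eq_bigr => k _; case: (boolP (th E k)) => [/vecEF -> //|/h ->].
  by rewrite !mulr0z.
rewrite crd_sum (bigD1 i) //= big1 => [|j ji]; first by rewrite crdMz crd_vec eqxx mul1r addr0.
by rewrite crdMz crd_vec eq_sym (negPf ji) mul0r.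
Qed.

Lemma inH_EF x : inH E x -> inH F x.
Proof.
move=> /inHP [h1 h2]; apply/inHP; split=> i; first by rewrite crdEF.
by rewrite -thEF crdEF //; exact: h2.
Qed.

Lemma crdH x i : inH E x -> crd F i x = crd E i x.
Proof. by case/inHP=> _ h; rewrite crdEF. Qed.

(* A thick monomial [s] lying in one staircase only is maximal there, with full thick support. The
   contradiction is reached by exchanging variables in [s] ([exch]), then by support size. *)
Lemma Dsub s : s \in st E -> inH E s -> s \notin st F ->
  maxi E s /\ forall i, th E i -> 0 < crd E i s.
Proof.
move=> sE sH sF; have ms : maxi E s.
  apply: contraT => /(nonmax_root sE); rewrite rootEF => /root_nonmax [k|sF' _].
    by rewrite crdH //; exact: st_ge0.
  by rewrite sF' in sF.
split=> // i ti; rewrite lt_neqAle (st_ge0 i sE) andbT eq_sym; apply/eqP => si.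
have := root_maxi i ms; rewrite rootEF => r.
have [|_ _ /AA_st] := @root_neg _ _ F _ i _ r.
  by rewrite crdB crdH // si -vecEF // crd_vec eqxx.
by rewrite vecEF // subrK; apply/negP.
Qed.

(** The weight [s - e_i] has the same multiplicity in both frames, but [x_i] contributes in [E]
    only. [F] compensates by another thick variable, which then replaces one [x_i] in [s], or by
    more thin ones. *)
Lemma exch s i : s \in st E -> inH E s -> s \notin st F -> th E i ->
  (exists i', [/\ i' != i, th E i', s - vec E i + vec E i' \in st F &
      s - vec E i + vec E i' \notin st E]) \/
  (tcount E (s - vec E i) < tcount F (s - vec E i))%N.
Proof.
move=> sE sH sF ti; have [ms full] := Dsub sE sH sF.
set a := s - vec E i.
have aH : inH E a.
  case/inHP: sH => h1 h2; apply/inHP; split=> j.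
    by rewrite crdB crd_vec; case: eqP => [->|_]; have := h1 j; have := full _ ti; lia.
  move=> tj; rewrite crdB crd_vec h2 //; case: eqP => [ji|//]; by rewrite -ji (negPf tj) in ti.
have a0 k : 0 <= crd E k a by case/inHP: aH.
have a0F k : 0 <= crd F k a by rewrite crdH.
have : mult E a = mult F a by case: mEF.
rewrite !mult_split // => e.
case: (boolP [exists i', [&& i' != i, th E i', a + vec E i' \in st F & a + vec E i' \notin st E]]).
  by case/existsP=> i' /and4P [? ? ? ?]; left; exists i'.
rewrite negb_exists => /forallP h; right.
suff : (ecount F a < ecount E a)%N by lia.
apply: proper_card; apply/properP; split.
  apply/subsetP => i'; rewrite !inE -thEF => /andP [ti']; rewrite vecEF // ti' /= => aF.
  have [->|ni] := eqVneq i' i; first by rewrite subrK.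
  by have := h i'; rewrite ni ti' aF /= negbK.
exists i; first by rewrite inE ti subrK.
by rewrite inE -thEF ti /= vecEF // subrK.
Qed.

(* Otherwise the sum [del] of the thin [F]-coordinates is nonnegative on all roots of [F], so it
   vanishes on every [vec E j], hence on the lattice. *)
Lemma nondeg m h0 k0 : th E h0 -> ~~ th E k0 -> inH E m -> maxi E m ->
  exists m', inH F m' /\ maxi F m'.
Proof.
move=> th0 tk0 mH mm.
case: (boolP (has (fun m' => inH F m' && maxi F m') (st F))) => [/hasP [m' _ /andP [? ?]]|/hasPn nd].
  by exists m'.
pose del x := \sum_(i | ~~ th E i) crd F i x.
have delD x y : del (x + y) = del x + del y by rewrite /del -big_split; apply: eq_bigr => i _; rewrite crdD.
have delN x : del (- x) = - del x by rewrite /del -sumrN; apply: eq_bigr => i _; rewrite crdN.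
have delH x : inH F x -> del x = 0.
  by case/inHP=> _ hx; apply: big1 => i ti; rewrite hx -?thEF.
have delv k : ~~ th E k -> del (vec F k) = 1.
  move=> tk; rewrite /del (bigD1 k) //= crd_vec eqxx big1 ?addr0 // => i /andP [_ /negPf ik].
  by rewrite crd_vec ik.
have delr a : wroot F a -> 0 <= del a.
  case/root_sign=> [[a0 _]|[j [aj a0 /AAP [mS r]]]]; first by apply: sumr_ge0 => i _.
  case: (boolP (th E j)) => [tj|tj].
    apply: sumr_ge0 => i ti; apply: a0; apply: contraNneq ti => ->; exact: tj.
  set m1 := a + vec F j in mS r.
  have m10 k : 0 <= crd F k m1 by apply: st_ge0.
  have -> : del a = del m1 - 1 by rewrite /m1 delD delv // addrK.
  (* If [del m1 = 0], take [m2] above [m1], maximal among thick monomials. Only a thin [b] can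
     extend it, and [b] has a thick neighbour dividing [m2] and, through the derivation, the thin
     neighbour [j]. *)
  clearbody m1; suff : 0 < del m1 by clia.
  rewrite lt_neqAle sumr_ge0 ?andbT; last by move=> *; apply: m10.
  rewrite eq_sym; apply/eqP => d0.
  have m1H : inH F m1.
    apply/inHP; split=> // i; rewrite -thEF => ti.
    have /psumr_eq0P/(_ d0 i ti) // : forall i, ~~ th E i -> 0 <= crd F i m1 by [].
  have [m2 [m2S m2H le m2m]] := max_above mS m1H.
  have m2n : ~~ maxi F m2 by have := nd _ m2S; rewrite m2H.
  have [b hb] : exists b, m2 + vec F b \in st F.
    by move: m2n; rewrite /maxi m2S /= negb_forall => /existsP [b]; rewrite negbK; exists b.
  have tb : ~~ th F b.
    by apply/negP => tb; have := m2m b (inH_add m2H tb); rewrite hb.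
  have [h hh] : exists h, 0 < crd F h m2.
    apply: crd_gt0; first by move=> i; apply: st_ge0.
    apply/eqP => z; suff P : inH F (vec F h0).
      by have := m2m h0; rewrite z add0r st_vec P => /(_ isT).
    apply/inHP; split=> i; rewrite ?crd_vec //; last by move=> ti; case: eqP => // ih; move: ti; rewrite ih -thEF th0.
  have thh : th F h by apply: contraTT hh => hh; case/inHP: m2H => _ -> //.
  have bh : vec F b + vec F h \in st F.
    apply: (st_le hb) => k; rewrite !crdE; have := st_ge0 k m2S; have := hh.
    by case: (k =P h) => [->|_]; clia.
  have bj : vec F b + vec F j \in st F.
    have : (m2 - m1 + vec F b) + vec F j \in st F.
      apply: r => [k|]; first by rewrite !crdE; have := le k; clia.
      by rewrite addrAC subrK.
    move=> h1; apply: (st_le h1) => k; rewrite !crdE; have := le k; clia.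
  by move: tj; rewrite thEF -(thin_uniq tb bh bj) thh.
(* For thin [e_j] the root [m - e_j] bounds [del] from above. The bound from below comes from the
   root [e_j], or from [e_j - e_h0] when [e_j] is maximal. *)
have dE j : del (vec E j) = 0.
  case: (boolP (th E j)) => [tj|tj].
    by rewrite delH // inH_EF // inH_vec.
  apply/eqP; rewrite eq_le; apply/andP; split.
    have := root_maxi j mm; rewrite rootEF => /delr; rewrite delD delN delH ?inH_EF //; clia.
  have dh0 : del (vec E h0) = 0.
    by rewrite delH // inH_EF // inH_vec.
  have [mj|mj] := boolP (maxi E (vec E j)).
    by have := root_maxi h0 mj; rewrite rootEF => /delr; rewrite delD delN dh0; clia.
  by apply: delr; rewrite -rootEF; apply: nonmax_root (st_vec _ _) mj.
have : del (vec F k0) = 0.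
  rewrite (crd_decomp E (vec F k0)).
  have delz x (z : int) : del x = 0 -> del (x *~ z) = 0.
    move=> dx; have dn q : del (x *+ q) = 0.
      by elim: q => [|q IH]; rewrite ?mulr0n ?mulrS ?delD ?dx ?IH // /del big1 // => i _; rewrite crd0.
    by case: z => q; rewrite ?NegzE ?mulrNz ?delN -?pmulrn ?dn ?oppr0.
  have -> : del (\sum_i vec E i *~ crd E i (vec F k0)) = \sum_i del (vec E i *~ crd E i (vec F k0)).
    by apply: (big_morph del) => // ; rewrite /del big1 // => i _; rewrite crd0.
  by apply: big1 => i _; apply: delz.
by rewrite delv.
Qed.

End EF.

(** A thin variable attached to [a] would have the two neighbours [i1] and [i2]. *)
Lemma tzero G a i1 i2 : (forall k, 0 <= crd G k a) -> i1 != i2 ->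
  0 < crd G i1 a -> 0 < crd G i2 a -> tcount G a = 0%N.
Proof.
move=> a0 i12 h1 h2; apply: eq_card0 => j; rewrite !inE; apply/negP => /andP [tj jS].
have aux i : 0 < crd G i a -> vec G j + vec G i \in st G.
  move=> hi; apply: (st_le jS) => k; rewrite !crdE; have := a0 k; move: hi.
  by case: (k =P i) => [->|_]; clia.
by move: i12; rewrite (thin_uniq tj (aux _ h1) (aux _ h2)) eqxx.
Qed.

Lemma tpos G a : (0 < tcount G a)%N -> exists j, ~~ th G j /\ a + vec G j \in st G.
Proof. by case/card_gt0P => j; rewrite inE => /andP [? ?]; exists j. Qed.

Lemma att_form G j l x : ~~ th G j -> l != j -> vec G j + vec G l \in st G ->
  x \in st G -> 0 < crd G j x ->
  crd G j x = 1 /\ forall i, i != j -> i != l -> crd G i x = 0.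
Proof.
move=> tj lj jl xS jx.
have [z|zn] := eqVneq (crd G l x) 0; last first.
  have lx : 0 < crd G l x by rewrite lt_neqAle eq_sym zn st_ge0.
  by have [_ ? ?] := thin_pair tj xS jx lj lx.
have aux i : i != j -> crd G i x = 0.
  move=> ij; apply/eqP; apply: contraNT (ij) => xn.
  have ix : 0 < crd G i x by rewrite lt_neqAle eq_sym xn st_ge0.
  have [ji _ _] := thin_pair tj xS jx ij ix.
  by move: xn; rewrite -(thin_uniq tj jl ji) z eqxx.
split; last by move=> i ij _; exact: aux.
apply/eqP; rewrite eq_le -gtz0_ge1 jx andbT leNgt; apply/negP => j2.
suff jj : vec G j + vec G j \in st G by move: lj; rewrite (thin_uniq tj jl jj) eqxx.
apply: (st_le xS) => k; rewrite !crdE; have := st_ge0 k xS; move: j2.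
by case: (k =P j) => [->|_]; clia.
Qed.

(* The remaining case of two thick variables, where [s = h + p l] is in [E] but not in [F]. *)
Section Case2.
Variables E F : frame n M.
Hypothesis mEF : matched E F.
Variables h l : 'I_n.
Hypotheses (hl : h != l) (thh : th E h) (thl : th E l).
Hypothesis only : forall i, th E i -> (i == h) || (i == l).
Variables (s : M) (p : nat).
Hypotheses (sE : s \in st E) (sF : s \notin st F).
Hypotheses (es : s = vec E h + vec E l *+ p) (p0 : (0 < p)%N).
Notation hv := (vec E h).
Notation lv := (vec E l).

Lemma nonfull (G G' : frame n M) x i : matched G G' -> th G i -> inH G x -> crd G i x = 0 ->
  x \in st G -> x \in st G'.
Proof.
move=> mG ti xH xi xS; apply: contraT => xS'.
by have [_ /(_ i ti)] := Dsub mG xS xH xS'; rewrite xi.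
Qed.

Lemma inHc (u w : nat) : inH E (hv *+ u + lv *+ w).
Proof.
apply/inHP; split=> i; first by rewrite !crdE; clia.
move=> ti; rewrite !crdE.
case: (i =P h) => [ih|_]; first by move: ti; rewrite ih thh.
by case: (i =P l) => [il|_]; [move: ti; rewrite il thl | clia].
Qed.

Lemma sH : inH E s.
Proof. by rewrite es -[hv]mulr1n; exact: inHc. Qed.

Lemma ms : maxi E s.
Proof. by have [] := Dsub mEF sE sH sF. Qed.

Lemma axl b : (lv *+ b \in st E) = (lv *+ b \in st F).
Proof.
have H : inH E (lv *+ b) by have := inHc 0 b; rewrite mulr0n add0r.
have z : crd E h (lv *+ b) = 0 by rewrite !crdE (negPf hl).
apply/idP/idP => H1; first exact: (nonfull mEF thh H z H1).
apply: (nonfull (i:=h) (matched_sym mEF) _ (inH_EF mEF H) _ H1); first by rewrite -(thEF mEF).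
by rewrite (crdH mEF).
Qed.

Lemma axh b : (hv *+ b \in st E) = (hv *+ b \in st F).
Proof.
have H : inH E (hv *+ b) by have := inHc b 0; rewrite mulr0n addr0.
have z : crd E l (hv *+ b) = 0 by rewrite !crdE eq_sym (negPf hl).
apply/idP/idP => H1; first exact: (nonfull mEF thl H z H1).
apply: (nonfull (i:=l) (matched_sym mEF) _ (inH_EF mEF H) _ H1); first by rewrite -(thEF mEF).
by rewrite (crdH mEF).
Qed.

(** Both [h] and [l] still occur in [s - l], so [tzero] excludes the thin alternative of [exch], and
    [h] is the only thick index left to exchange for [l]. *)
Lemma swapF : (1 < p)%N -> hv *+ 2 + lv *+ p.-1 \in st F /\ hv *+ 2 + lv *+ p.-1 \notin st E.
Proof.
move=> p1; have e : s - lv = hv + lv *+ p.-1.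
  by rewrite es -[in LHS](prednK p0) mulrSr addrA addrK.
have [[i' [ni ti hF hE]]|] := exch mEF sE sH sF thl; last first.
  rewrite e (@tzero F _ h l) ?ltn0 //.
  - by move=> k; rewrite !crdE -!(vecEF mEF) // !crdE; clia.
  - by rewrite !crdE -!(vecEF mEF) // !crdE eqxx; clia.
  - by rewrite !crdE -!(vecEF mEF) // !crdE eqxx eq_sym (negPf hl); move: p1; clia.
move: hF hE; have /orP [/eqP ->|] := only ti; last by rewrite (negPf ni).
by rewrite e addrAC -mulr2n.
Qed.

Variable k : 'I_n.
Hypothesis tk : ~~ th E k.
Notation fk := (vec F k).
Hypothesis kS : lv *+ p + fk \in st F.
Hypothesis l2 : lv *+ 2 \in st E.

Lemma kh : k != h. Proof. by apply: contraNneq tk => ->. Qed.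
Lemma kl : k != l. Proof. by apply: contraNneq tk => ->. Qed.
Lemma lh : l != h. Proof. by rewrite eq_sym. Qed.

Lemma crdFv i : (crd F i hv = (i == h)%:Z) * (crd F i lv = (i == l)%:Z).
Proof. by rewrite -!(vecEF mEF) // !crd_vec. Qed.

Lemma fkl : fk + vec F l \in st F.
Proof.
rewrite (vecEF mEF thl); apply: (st_le kS) => i; rewrite !crdE !crdFv; move: p0.
by case: (i == k); case: (i == l); clia.
Qed.

(** By [att_form] only [l] can accompany the thin vector [fk] in the staircase of [F]; [q] is the
    largest multiple of [l] that does. *)
Lemma qex : exists q, [/\ (p <= q)%N, maxi F (fk + lv *+ q) & forall v, (forall i, 0 <= crd F i v) ->
  v + fk \in st F -> exists2 b, (b <= q)%N & v = lv *+ b].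
Proof.
have tkF : ~~ th F k by rewrite -(thEF mEF).
have key x : x \in st F -> 0 < crd F k x -> x = fk + lv *+ absz (crd F l x).
  move=> xS xk; have lk : l != k by rewrite eq_sym kl.
  have [xk1 x0] := att_form tkF lk fkl xS xk.
  apply: (@crd_inj _ _ F) => i; rewrite !crdE crdFv.
  have [->|ik] := eqVneq i k; first by rewrite (negPf kl) xk1; clia.
  have [->|il] := eqVneq i l; last by rewrite x0 //; clia.
  by have := st_ge0 l xS; clia.
have [m [mS _ le mm]] := @max_above _ _ F predT _ kS isT.
have mk : 0 < crd F k m.
  by have := le k; rewrite !crdE crdFv eqxx (negPf kl); clia.
have em := key _ mS mk; exists (absz (crd F l m)); split.
- by have := le l; rewrite !crdE crdFv eqxx eq_sym (negPf kl); clia.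
- rewrite -em; apply/maxiP; split=> // i; exact: mm.
move=> v v0 vS.
have vk : 0 < crd F k (v + fk) by rewrite !crdE eqxx; have := v0 k; clia.
move: (absz (crd F l (v + fk))) (key _ vS vk) => z ev; exists z.
  rewrite leqNgt; apply/negP => lt; have /negP := mm l isT; apply.
  rewrite em (vecEF mEF thl) -addrA -mulrSr; apply: (st_le vS) => i; rewrite ev !crdE !crdFv.
  by move: lt; case: (i == k); case: (i == l); clia.
by apply: (@addrI _ fk); rewrite addrC.
Qed.

(** The vector [fk] is examined in the basis of [E]. The roots [F1], [F2], [F3] and the non-root
    [F5], all found in [F], leave only [fk = h - e_j] and [fk = h + l - e_j] with [e_j] thin, and
    both yield the derivation [x_j -> x_h]. *)
Lemma case2_AA : exists2 j, ~~ th E j & AA E j hv.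
Proof.
have [q [pq mq att]] := qex.
have q0 : (0 < q)%N by apply: leq_trans pq.
have rEF := rootEF mEF.
have [mqS mqm] := maxiP _ _ mq.
have F1 c : (c < q)%N -> wroot E (fk + lv *+ c).
  move=> cq; rewrite rEF; apply: (@root_posW _ _ F _ l) => [i|].
    by rewrite !crdE crdFv; clia.
  apply: (st_le mqS) => i; rewrite (vecEF mEF thl) !crdE crdFv; move: cq.
  by case: (i == l); clia.
have F2 : wroot E (fk + lv *+ q - hv) by rewrite rEF -(vecEF mEF thh) root_maxi.
have F3 : lv *+ q.+1 \in st E -> wroot E (fk - lv).
  rewrite axl => q1; rewrite rEF -(vecEF mEF thl); apply/wrootP; exists l; rewrite subrK.
  apply/AAP; split=> [|v v0 /(att v v0) [b bq ->]]; first exact: st_vec.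
  apply: (st_le q1) => i; rewrite (vecEF mEF thl) !crdE crdFv; move: bq.
  by case: (i == l); clia.
(* A derivation of this weight would send [h] to [fk + (q - p) l]. Adding [p l] to the latter gives
   a monomial of [F], so [h + p l], which is [s], would lie in [F] too. *)
have F5 : ~~ wroot E (fk + lv *+ (q - p) - hv).
  apply/negP; rewrite rEF => r; have [|_ _] := @root_neg _ _ F _ h _ r.
    by rewrite !crdE !crdFv eqxx (negPf hl) eq_sym (negPf kh); clia.
  rewrite (vecEF mEF thh) subrK => /AAP [_ /(_ (lv *+ p))].
  rewrite addrCA -mulrnDr subnKC // => hh.
  move: sF; rewrite es addrC -(vecEF mEF thh) hh // => i.
  by rewrite crdMn crdFv; clia.
have top : fk + lv *+ q.+1 \notin st E.
  apply/negP => h1; suff : wroot E (fk + lv *+ q).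
    rewrite rEF => /root_nonmax []; rewrite ?mq // => i; exact: st_ge0.
  have h2 : wroot E (fk + lv *+ q).
    case: (boolP [forall i, 0 <= crd E i (fk + lv *+ q)]) => [/forallP a0|].
      by apply: (root_posW (i:=l) a0); rewrite -addrA -mulrSr.
    rewrite negb_forall => /existsP [i hi]; exfalso; move: hi; have := st_ge0 i h1.
    have := F1 0%N q0; rewrite mulr0n addr0 => r0.
    have [il|il] := eqVneq i l; last by rewrite !crdE (negPf il); clia.
    rewrite il; case/root_sign: r0 => [[a0 _] _|[j [aj a0 _]]].
      by have := a0 l; rewrite !crdE eqxx; clia.
    have [jl|lj] := eqVneq j l; last by have := a0 l; rewrite eq_sym => /(_ lj); rewrite !crdE eqxx; clia.
    by move: aj; rewrite jl !crdE eqxx; move: q0; clia.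
  exact: h2.
(* [fk = e_j + x l] with [fk + q l] in the staircase contradicts [F5]. *)
have gam j : ~~ th E j -> crd E j fk = 1 -> (forall i, i != j -> i != l -> crd E i fk = 0) ->
    fk + lv *+ q \in st E -> 0 <= crd E l fk + (q - p)%N%:Z -> False.
  move=> tj xj x0 qS pos.
  have jl : j != l by apply: contraNneq tj => ->.
  have jh : j != h by apply: contraNneq tj => ->.
  apply: (negP F5); apply/wrootP; exists h; rewrite subrK.
  have nn i : 0 <= crd E i (fk + lv *+ (q - p)).
    rewrite !crdE; have [->|il] := eqVneq i l; first by move: pos; clia.
    have [->|ij] := eqVneq i j; first by rewrite xj; clia.
    by rewrite x0 //; clia.
  apply/AAP; split.
    apply: (st_le qS) => i; rewrite nn !crdE; by case: (i == l); clia.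
  move=> v v0 vS.
  have lx : 0 < crd E l (fk + lv *+ q) by rewrite !crdE eqxx; move: p0 pq pos; clia.
  have jx : 0 < crd E j (fk + lv *+ q) by rewrite !crdE xj (negPf jl); clia.
  have lj : l != j by rewrite eq_sym.
  have [jlS _ _] := thin_pair tj qS jx lj lx.
  have vj : 0 < crd E j (v + (fk + lv *+ (q - p))).
    by rewrite !crdE xj (negPf jl); have := v0 j; clia.
  have [v1 v2] := att_form tj lj jlS vS vj.
  have vl : crd E l v <= p%:Z.
    rewrite leNgt; apply/negP => vl; apply: (negP top); apply: (st_le vS) => i.
    rewrite !crdE; have [->|il] := eqVneq i l; first by move: vl pos pq; clia.
    by have := v0 i; have := nn i; rewrite !crdE (negPf il); clia.
  apply: (st_le sE) => i; rewrite es !crdE.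
  have := v0 i; have := v2 i; have := nn i; rewrite !crdE.
  have [->|il] := eqVneq i l; first by move: vl; clia.
  have [->|ij] := eqVneq i j; first by move: v1; rewrite !crdE xj (negPf jl); clia.
  by rewrite (x0 i ij il) => _ /(_ isT isT); clia.
have nsp : exists2 j, ~~ th E j & crd E j fk != 0.
  have : [exists j, ~~ th E j && (crd E j fk != 0)].
    apply: contraT; rewrite negb_exists => /forallP hh.
    have /(crdEF mEF)/(_ k) : forall i, ~~ th E i -> crd E i fk = 0.
      by move=> i ti; have := hh i; rewrite ti /= negbK => /eqP.
    by rewrite crd_vec eqxx => e1; have := hh k; rewrite tk -e1.
  by case/existsP => j /andP [? ?]; exists j.
(* [fk] is itself a root: its [E]-coordinates are nonnegative, or one is -1, at a thick or at a thin
   index. The first two cases are contradictory. *)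
have := F1 0%N q0; rewrite mulr0n addr0 => /root_sign [[x0 [i1 hi1]]|[j [xj x0 Aj]]].
- exfalso; have [j tj xj] := nsp.
  have xj0 : 0 < crd E j fk by rewrite lt_neqAle eq_sym xj x0.
  have jh : h != j by apply: contraNneq tj => <-.
  have jl : l != j by apply: contraNneq tj => <-.
  have fS : fk \in st E by apply: st_ext hi1.
  have [xh|xh] := eqVneq (crd E h fk) 0.
    have [|_ _] := @root_neg _ _ E _ h _ F2.
      by rewrite !crdE xh eqxx (negPf hl); clia.
    rewrite subrK => /AA_st qS.
    have [||jlS x1 x2] := thin_pair tj qS _ jl _.
      by rewrite !crdE; move: xj0; clia.
      by rewrite !crdE eqxx; have := x0 l; move: q0; clia.
    apply: (gam j) => //.
    - by move: x1; rewrite !crdE eq_sym (negPf jl); clia.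
    - by move=> i ij il; have := x2 i ij il; rewrite !crdE (negPf il); clia.
    - by have := x0 l; clia.
  have xh0 : 0 < crd E h fk by rewrite lt_neqAle eq_sym xh x0.
  have [jhS _ _] := thin_pair tj fS xj0 jh xh0.
  have [|bS _] := root_nonmax _ F2.
    move=> i; rewrite !crdE; have := x0 i; have [->|_] := eqVneq i h; last by clia.
    by move: xh0; clia.
  have [||jlS _ _] := thin_pair tj bS _ jl _.
    by rewrite !crdE (eq_sym j h) (negPf jh); move: xj0; clia.
    by rewrite !crdE eqxx (negPf lh); have := x0 l; move: q0; clia.
  by move: hl; rewrite (thin_uniq tj jhS jlS) eqxx.
case: (boolP (th E j)) => tj.
  exfalso; have /orP [/eqP jh|/eqP jl] := only tj.
    subst j; have [|+ _ _] := @root_neg _ _ E _ h _ F2; rewrite !crdE eqxx (negPf hl) xj //.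
  subst j; have [j tj' xj'] := nsp.
  have jh : h != j by apply: contraNneq tj' => <-.
  have jl : l != j by apply: contraNneq tj' => <-.
  have xj0 : 0 < crd E j fk by rewrite lt_neqAle eq_sym xj' x0 // eq_sym.
  have [q1|q1] := leqP q 1.
    have q1' : q = 1%N by move: q0 q1; clia.
    have := F3; rewrite q1' => /(_ l2) r; have [|+ _ _] := @root_neg _ _ E _ l _ r; rewrite !crdE eqxx xj //.
  have mS := AA_st Aj.
  have [xh|xh] := eqVneq (crd E h fk) 0; last first.
    have xh0 : 0 < crd E h fk by rewrite lt_neqAle eq_sym xh x0.
    have [||jhS _ _] := thin_pair tj' mS _ jh _.
      by rewrite !crdE; move: xj0; clia.
      by rewrite !crdE; move: xh0; clia.
    have [|bS _] := root_nonmax _ F2.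
      move=> i; rewrite !crdE; have [->|il] := eqVneq i l.
        by rewrite xj (negPf lh); move: q1; clia.
      by have := x0 i il; have [->|_] := eqVneq i h; move: xh0; clia.
    have [||jlS _ _] := thin_pair tj' bS _ jl _.
      by rewrite !crdE (eq_sym j h) (negPf jh); move: xj0; clia.
      by rewrite !crdE eqxx (negPf lh) xj; move: q1; clia.
    by move: hl; rewrite (thin_uniq tj' jhS jlS) eqxx.
  have [|_ _] := @root_neg _ _ E _ h _ F2.
    by rewrite !crdE xh eqxx (negPf hl); clia.
  rewrite subrK => /AA_st qS.
  have [||jlS x1 x2] := thin_pair tj' qS _ jl _.
    by rewrite !crdE; move: xj0; clia.
    by rewrite !crdE eqxx xj; move: q1; clia.
  have y1 : crd E j fk = 1 by move: x1; rewrite !crdE eq_sym (negPf jl); clia.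
  have y2 i : i != j -> i != l -> crd E i fk = 0.
    by move=> ij il; have := x2 i ij il; rewrite !crdE (negPf il); clia.
  have [qp|pq'] := leqP q p; last by apply: (gam j) => //; rewrite xj; move: pq'; clia.
  have {qp pq} qp : q = p by apply/eqP; rewrite eqn_leq qp.
  have [zF zE] := swapF (ltac:(rewrite -qp; exact: q1)).
  have zH := inHc 2 p.-1.
  have [zm _] := Dsub (matched_sym mEF) zF (inH_EF mEF zH) zE.
  have := root_maxi k zm; rewrite -rEF => r.
  have [|_ _ /AA_st zS] := @root_neg _ _ E _ j _ r.
    by rewrite !crdE y1 (eq_sym j h) (negPf jh) (eq_sym j l) (negPf jl); clia.
  have [_ /(_ h)/negP] := maxiP _ _ ms; apply; apply: (st_le zS) => i.
  rewrite es !crdE; have [->|ij] := eqVneq i j.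
    by rewrite y1 (eq_sym j h) (negPf jh) (eq_sym j l) (negPf jl); clia.
  have [->|il] := eqVneq i l; first by rewrite xj (negPf lh); move: p0; clia.
  by rewrite y2 //; clia.
have jh : h != j by apply: contraNneq tj => <-.
have jl : l != j by apply: contraNneq tj => <-.
have [|_ x0' /AA_st B1] := @root_neg _ _ E _ j _ F2.
  by rewrite !crdE xj (eq_sym j h) (negPf jh) (eq_sym j l) (negPf jl).
have xh : 1 <= crd E h fk.
  by have := x0' h jh; rewrite !crdE eqxx (negPf hl); clia.
have xl : 0 <= crd E l fk by apply: x0.
have xa i0 : ~~ th E i0 -> i0 != j -> crd E i0 fk = 0.
  move=> ta aj; apply/eqP; apply: contraT => xn; exfalso.
  have xa0 : 0 < crd E i0 fk by rewrite lt_neqAle eq_sym xn x0.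
  have ah : h != i0 by apply: contraNneq ta => <-.
  have al : l != i0 by apply: contraNneq ta => <-.
  have [||ahS _ _] := thin_pair ta (AA_st Aj) _ ah _.
    by rewrite !crdE; move: xa0; clia.
    by rewrite !crdE; move: xh; clia.
  have [||alS _ _] := thin_pair ta B1 _ al _.
    by rewrite !crdE (eq_sym i0 h) (negPf ah); move: xa0; clia.
    by rewrite !crdE eqxx (negPf lh); move: xl q0; clia.
  by move: hl; rewrite (thin_uniq ta ahS alS) eqxx.
have ex : fk + vec E j = hv *+ absz (crd E h fk) + lv *+ absz (crd E l fk).
  apply: (@crd_inj _ _ E) => i; rewrite !crdE.
  have [->|ij] := eqVneq i j.
    by rewrite (eq_sym j h) (negPf jh) (eq_sym j l) (negPf jl) xj; clia.
  case: (boolP (th E i)) => [/only/orP [] /eqP ->|ti].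
  - by rewrite eqxx (negPf hl); move: xh; clia.
  - by rewrite eqxx (negPf lh); move: xl; clia.
  - have ih : (i == h) = false by apply: contraNF ti => /eqP ->.
    have il : (i == l) = false by apply: contraNF ti => /eqP ->.
    by rewrite xa // ih il; clia.
move: (absz (crd E h fk)) (absz (crd E l fk)) ex (gez0_abs (le_trans ler01 xh)) (gez0_abs xl) => X Y ex eX eY.
have {}ex : fk = hv *+ X + lv *+ Y - vec E j by rewrite -ex addrK.
have X1 : (1 <= X)%N by move: xh; rewrite -eX; clia.
have B1' : hv *+ X.-1 + lv *+ (Y + q) \in st E.
  suff <- : fk + lv *+ q - hv + vec E j = hv *+ X.-1 + lv *+ (Y + q) by [].
  rewrite ex -[in LHS](prednK X1) mulrS mulrnDr.
  by apply: (@crd_inj _ _ E) => i; rewrite !crdE; clia.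
have B2 : hv *+ X + lv *+ (Y + q.-1) \in st E.
  have [|_ _ /AA_st] := @root_neg _ _ E _ j _ (F1 q.-1 (ltac:(move: q0; clia))).
    by rewrite !crdE xj (eq_sym j l) (negPf jl).
  suff -> : fk + lv *+ q.-1 + vec E j = hv *+ X + lv *+ (Y + q.-1) by [].
  by rewrite ex mulrnDr; apply: (@crd_inj _ _ E) => i; rewrite !crdE; clia.
(* If [X >= 2], the monomial of [B1'] lies above the maximal [s] and so equals it. This forces
   [X = 2], [Y = 0] and [q = p], which [swapF] refutes when [p > 1] and [F3] when [p = 1]. *)
have [X2|X2] := leqP X 1; last first.
  exfalso; have := maxi_ge (v := hv *+ X.-2 + lv *+ (Y + q - p)) ms.
  have -> : hv *+ X.-2 + lv *+ (Y + q - p) + s = hv *+ X.-1 + lv *+ (Y + q).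
    apply: (@crd_inj _ _ E) => i; rewrite es !crdE; move: X2 pq; clia.
  move=> /(_ _ B1') z0; have {}z0 := z0 (fun i => ltac:(rewrite !crdE; clia)).
  have Xe : X = 2.
    by have := congr1 (crd E h) z0; rewrite !crdE eqxx (negPf hl); move: X2; clia.
  have Ye : Y = 0%N /\ q = p.
    by have := congr1 (crd E l) z0; rewrite !crdE eqxx (negPf lh); move: pq; clia.
  case: Ye => Ye qp; have [p1|p1] := leqP p 1; last first.
    by have [_ /negP] := swapF p1; apply; move: B2; rewrite Xe Ye qp.
  have q1 : q = 1%N by move: qp p1 q0; clia.
  have := F3; rewrite q1 => /(_ l2) r; have [|_ x3 _] := @root_neg _ _ E _ j _ r.
    by rewrite !crdE xj (eq_sym j l) (negPf jl).
  by have := x3 l jl; rewrite !crdE eqxx -eY Ye.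
have {X1 X2} X1 : X = 1%N by move: X1 X2; clia.
rewrite X1 mulr1n in ex B2; rewrite X1 mulr0n add0r in B1'.
exists j => //.
have [Y0|Y0] := posnP Y; first by move: Aj; rewrite ex Y0 mulr0n addr0 subrK.
have Ypq : (Y + q <= p.+1)%N.
  rewrite leqNgt; apply/negP => lt; have [_ /(_ l)/negP] := maxiP _ _ ms; apply.
  apply: (st_le B2) => i; rewrite es !crdE; move: lt; case: (i == h); case: (i == l); clia.
have Y1 : Y = 1%N by move: Ypq pq Y0; clia.
have := F3; rewrite -[q.+1]add1n -Y1 => /(_ B1') r.
have [|_ _] := @root_neg _ _ E _ j _ r.
  by rewrite !crdE xj (eq_sym j l) (negPf jl).
by rewrite ex Y1 mulr1n addrAC subrK addrK.
Qed.

(** The derivation [x_j -> x_h] makes every neighbour of [h] a neighbour of [j], in particular [l].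
    Thickness of [h] supplies a neighbour other than [l]: if it is [h], then [j] has two neighbours;
    otherwise it is thin and has the two neighbours [h] and [j]. *)
Lemma case2_False : False.
Proof.
have [j tj /AAP [_ hj]] := case2_AA.
have jh : h != j by apply: contraNneq tj => <-.
have jl : l != j by apply: contraNneq tj => <-.
have hlS : lv + hv \in st E.
  apply: (st_le sE) => i; rewrite es !crdE; move: p0; case: (i == h); case: (i == l); clia.
have jlS : vec E j + lv \in st E.
  by rewrite addrC; apply: hj => // i; exact: crd_vec0.
case: (boolP (hv + hv \in st E)) => [hh|hh].
  have : hv + vec E j \in st E by apply: hj => // i; exact: crd_vec0.
  by rewrite addrC => jhS; move: hl; rewrite (thin_uniq tj jhS jlS) eqxx.
have := thh; rewrite /th /thickv => /orP [|r]; last first.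
  have [||+ _] := @root_nonmax _ _ E (hv + hv); rewrite ?r ?(negPf hh) //.
  by move=> i; rewrite !crdE; clia.
have Ap i : AA E i (hv + vec E i) = (hv + vec E i \in st E).
  by apply: AA_pos => i'; exact: crd_vec0.
case/card_gt1P => x [y]; rewrite !inE !Ap => -[hx hy xy].
have key i : hv + vec E i \in st E -> i != l -> False.
  move=> iS il; have ti : ~~ th E i.
    by apply/negP => /only; rewrite (negPf il) orbF => /eqP ih; move: iS; rewrite ih (negPf hh).
  have ihS : vec E i + hv \in st E by rewrite addrC.
  have ijS : vec E i + vec E j \in st E by apply: hj => // i'; exact: crd_vec0.
  by move: jh; rewrite (thin_uniq ti ihS ijS) eqxx.
have [xl|/(key _ hx) //] := eqVneq x l.
by apply: (key _ hy); rewrite -xl eq_sym.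
Qed.

End Case2.

End Match.

Section Match3.
Variables (n : nat) (M : zmodType).
Implicit Types (E F G : frame n M) (i j k h l : 'I_n) (s v a x m : M).

(** With one thick variable, thick monomials are comparable. The maximal [m] given by [nondeg] is
    above [s], which puts [s] in [F], or it is at most [s - e_i0], which [vec F k] still extends. *)
Lemma case1_False E F i0 k s : matched E F -> th E i0 -> (forall i, th E i -> i == i0) ->
  s \in st E -> inH E s -> s \notin st F -> ~~ th E k -> s - vec E i0 + vec F k \in st F -> False.
Proof.
move=> mEF t0 only sE sH sF tk kS; have [ms _] := Dsub mEF sE sH sF.
have [m [mH mm]] := nondeg mEF t0 tk sH ms.
have mH' := inH_EF (matched_sym mEF) mH.
have mc i : crd F i m = crd E i m by rewrite -(crdH (matched_sym mEF)).
have z x i : inH E x -> i != i0 -> crd E i x = 0.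
  by case/inHP=> _ h ii; apply: h; apply: contra ii => /only.
have [mS mtop] := maxiP _ _ mm.
have [le|lt] := leP (crd E i0 s) (crd E i0 m).
  apply: (negP sF); apply: (st_le mS) => i; rewrite (crdH mEF) // mc.
  have [->|ii] := eqVneq i i0; first by rewrite le st_ge0.
  by rewrite !z.
apply: (negP (mtop k)); apply: (st_le kS) => i; rewrite -(vecEF mEF t0).
rewrite !crdE mc (crdH mEF) //; have [->|ii] := eqVneq i i0; last by rewrite !z //; clia.
have : 0 <= crd E i0 m by rewrite -mc st_ge0.
by move: lt; clia.
Qed.

(** A thin variable attached to [s - e_i0] leaves only one variable there, and [s] has full thick
    support, so at most two variables are thick. With two, [s = e_i0 + p b] and [Case2] applies,
    unless [p = 1] and both squares vanish; then the maximal monomial from [nondeg] is squarefree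
    and not below a thick vector, so it is [s]. *)
Lemma end_False E F i0 s : matched E F -> s \in st E -> inH E s -> s \notin st F -> th E i0 ->
  (0 < tcount F (s - vec E i0))%N -> False.
Proof.
move=> mEF sE sH sF t0 /tpos [k [tkF kS]]; have tk : ~~ th E k by rewrite (thEF mEF).
have [ms full] := Dsub mEF sE sH sF.
have sc i : crd F i s = crd E i s by rewrite (crdH mEF).
have ac i : crd F i (s - vec E i0) = crd E i s - (i == i0)%:Z.
  by rewrite crdB sc -(vecEF mEF t0) crd_vec.
have a0 i : 0 <= crd F i (s - vec E i0).
  by rewrite ac; have := st_ge0 i sE; case: eqP => [->|_]; have := full _ t0; clia.
have [b hb] : exists b, 0 < crd F b (s - vec E i0).
  apply: crd_gt0 => //; rewrite subr_eq0; apply/eqP => es.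
  by move: sF; rewrite es -(vecEF mEF t0) st_vec.
have tb : th E b.
  apply: contraTT hb => tb; rewrite ac; case/inHP: sH => _ -> //.
  by clia.
have bk : b != k by apply: contraNneq tk => <-.
have kb : k != b by rewrite eq_sym.
have ik0 : k != i0 by apply: contraNneq tk => ->.
have [||kbS _ z] := thin_pair tkF kS _ bk _.
- by rewrite crdD crd_vec eqxx; have := a0 k; clia.
- by rewrite crdD crd_vec (negPf bk) addr0.
have only i : th E i -> i != b -> i = i0.
  move=> ti ib; apply/eqP; apply: contraT => ii0; have := full _ ti.
  have ik : i != k by apply: contraNneq tk => <-.
  by have := z i ik ib; rewrite crdD ac crd_vec (negPf ii0) (negPf ik); clia.
have [eb|nb] := eqVneq b i0.
  apply: (case1_False mEF t0 _ sE sH sF tk kS) => i ti.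
  by have [->|/(only i ti) ->] := eqVneq i b; rewrite ?eb.
have onlyhl h l : [set h; l] = [set b; i0] -> forall i, th E i -> (i == h) || (i == l).
  move=> e i ti; suff : i \in [set h; l] by rewrite !inE.
  by rewrite e !inE; have [//|/(only i ti) ->] := eqVneq i b; rewrite eqxx orbT.
have o1 := onlyhl i0 b (setUC _ _); have o2 := onlyhl b i0 erefl.
have sb1 := full _ tb; have si1 : crd E i0 s = 1.
  have := full _ t0; have := z i0 _ _; rewrite eq_sym ik0 (eq_sym i0 b) nb crdD ac crd_vec eqxx (eq_sym i0 k) (negPf ik0).
  by move=> /(_ isT isT); clia.
have es : s = vec E i0 + vec E b *+ absz (crd E b s).
  apply: (@crd_inj _ _ E) => i; rewrite !crdE.
  have [->|ib] := eqVneq i b; first by rewrite (negPf nb); move: sb1; clia.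
  have [->|ii] := eqVneq i i0; first by rewrite si1; clia.
  case: (boolP (th E i)) => [/only/(_ ib) e|ti]; first by rewrite e eqxx in ii.
  by case/inHP: sH => _ -> //; clia.
have nb' : i0 != b by rewrite eq_sym.
move: (absz (crd E b s)) es (gtz0_abs sb1) => p es ep.
have p0 : (0 < p)%N by move: sb1; rewrite -ep; clia.
have kS' : vec E b *+ p + vec F k \in st F 
  by move: kS; have -> : s - vec E i0 = vec E b *+ p by rewrite es addrAC subrr add0r.
have R : vec E b *+ 2 \in st E -> False by apply: (case2_False mEF nb' t0 tb o1 sE sF es p0 tk kS').
have [p2|p1] := leqP 2 p.
  apply: R; apply: (st_le sE) => i; rewrite es !crdE; move: p2; clear; case: (i == i0); case: (i == b); lia.
have {}p1 : p = 1%N by move: p0 p1; clia.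
have es2 : s = vec E b + vec E i0 *+ 1 by rewrite es p1 addrC.
have es2' : s - vec E b = vec E i0 *+ 1 by rewrite es2 addrAC subrr add0r.
have [k2 [tk2 kS2]] : exists k2, ~~ th E k2 /\ vec E i0 *+ 1 + vec F k2 \in st F.
  have [[i' [ni ti hF hE]]|] := exch mEF sE sH sF tb.
    have e' : i' = i0 by apply: only.
    exfalso; move: hF hE; rewrite e' es2' mulr1n -mulr2n => hF hE; apply: (negP hE).
    by rewrite (axh mEF nb' t0 tb).
  move=> lt; have /tpos [j [tj jS]] := leq_ltn_trans (leq0n _) lt.
  by exists j; rewrite (thEF mEF); split=> //; move: jS; rewrite es2'.
have R2 : vec E i0 *+ 2 \in st E -> False.
  exact: (case2_False mEF nb tb t0 o2 sE sF es2 isT tk2 kS2).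
have [m [mH mm]] := nondeg mEF t0 tk sH ms.
have mH' := inH_EF (matched_sym mEF) mH.
have mc i : crd F i m = crd E i m by rewrite -(crdH (matched_sym mEF)).
have [mS mtop] := maxiP _ _ mm.
have m0 i : 0 <= crd E i m by rewrite -mc st_ge0.
have mz i : i != i0 -> i != b -> crd E i m = 0.
  move=> ii ib; case/inHP: mH' => _; apply; apply/negP => /only/(_ ib) e; by rewrite e eqxx in ii.
have ax i x : x \in st E -> 1 < crd E i x -> vec E i *+ 2 \in st E.
  move=> xS xi; apply: (st_le xS) => i'; rewrite !crdE; have := st_ge0 i' xS.
  by have [->|_] := eqVneq i' i; move: xi; clia.
have axF i : th E i -> 1 < crd E i m -> vec E i *+ 2 \in st F.
  move=> ti xi; apply: (st_le mS) => i'; rewrite -(vecEF mEF ti) !crdE mc; have := m0 i'.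
  by have [->|_] := eqVneq i' i; move: xi; clia.
have mb : crd E b m <= 1.
  rewrite leNgt; apply/negP => h; apply: R; rewrite (axl mEF nb' t0 tb); exact: axF.
have mi : crd E i0 m <= 1.
  rewrite leNgt; apply/negP => h; apply: R2; rewrite (axh mEF nb' t0 tb); exact: axF.
have small x : x \in st F -> inH F x -> m != x -> (forall i, crd F i m <= crd F i x) -> False.
  move=> xS _ xm le; apply: (negP xm); rewrite eq_sym -subr_eq0; apply/eqP/(maxi_ge mm) => [i|].
    by rewrite crdB; have := le i; clia.
  by rewrite subrK.
have tmF i : th E i -> m != vec F i.
  move=> ti; apply/eqP => e; have : thickv F (vec F i) by rewrite -/(th F i) -(thEF mEF).
  rewrite /thickv -e => /orP [mu|r].
    have r : wroot F m by rewrite /wroot; move: mu; clia.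
    by have [|_] := root_nonmax _ r; rewrite ?mm // => i'; exact: st_ge0.
  have [|xS _] := root_nonmax _ r; first by move=> i'; rewrite crdD; have := st_ge0 i' mS; clia.
  by have := mtop i; rewrite -e xS.
have lem i : th E i -> (forall i', crd E i' m <= (i' == i)%:Z) -> False.
  move=> ti le; apply: (small (vec F i)); rewrite ?st_vec ?tmF //.
    apply/inHP; split=> i'; rewrite crd_vec //.
    by rewrite -(thEF mEF); have [->|//] := eqVneq i' i; rewrite ti.
  by move=> i'; rewrite mc crd_vec.
have [zb|zb] := eqVneq (crd E b m) 0.
  apply: (lem i0 t0) => i; have [->|ii] := eqVneq i i0; first by move: mi; clia.
  by have [->|ib] := eqVneq i b; rewrite ?zb // mz.
have [zi|zi] := eqVneq (crd E i0 m) 0.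
  apply: (lem b tb) => i; have [->|ib] := eqVneq i b; first by move: mb; clia.
  by have [->|ii] := eqVneq i i0; rewrite ?zi // mz.
apply: (negP sF); suff -> : s = m by [].
apply: (@crd_inj _ _ E) => i; rewrite es p1 !crdE.
have [->|ii] := eqVneq i i0; first by rewrite (negPf nb'); have := m0 i0; move: zi mi; clia.
have [->|ib] := eqVneq i b; first by have := m0 b; move: zb mb; clia.
by rewrite mz.
Qed.

(** Take a thick monomial [s] in one staircase only that minimizes [w], the sum of index times
    exponent. Exchanging the largest thick index by [exch] yields such a monomial with smaller [w],
    in the other staircase; the thin alternative is refuted by [end_False]. *)
Lemma D_empty E F x : matched E F -> inH E x -> (x \in st E) = (x \in st F).
Proof.
move=> mEF xH; apply/eqP; apply: contraT => xD; exfalso.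
pose w y := (\sum_(i < n) i * absz (crd E i y))%N.
pose D y := inH E y && ((y \in st E) != (y \in st F)).
have exP : exists N, has (fun y => D y && (w y == N)) (st E ++ st F).
  exists (w x); apply/hasP; exists x; last by rewrite /D xH xD eqxx.
  by rewrite mem_cat; case: (x \in st E) xD => //; case: (x \in st F).
case: (ex_minnP exP) => N /hasP [s _ /andP [Ds /eqP ws]] mn.
have {}mn y : D y -> (w s <= w y)%N.
  move=> Dy; rewrite ws; apply: mn; apply/hasP; exists y; last by rewrite Dy eqxx.
  by case/andP: Dy => _; rewrite mem_cat; case: (y \in st E) => //; case: (y \in st F).
have [i0 t0 imax] : exists2 i0, th E i0 & forall i, th E i -> (i <= i0)%N.
  have [i1 t1] : exists i1, th E i1.
    apply/existsP; apply: contraT; rewrite negb_exists => /forallP nt.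
    have s0 : s = 0.
      by apply: (@crd_inj _ _ E) => i; rewrite crd0; case/andP: Ds => /inHP [_ h] _; exact: h.
    by case/andP: Ds => _; rewrite s0 !st_0.
  by case: (arg_maxnP (fun i : 'I_n => nat_of_ord i) t1) => i ti mx; exists i.
have key G G' : matched G G' -> (forall i, th G i = th E i) -> (forall i, th E i -> vec G i = vec E i) ->
    (forall y, inH G y -> inH E y) -> inH G s -> s \in st G -> s \notin st G' ->
    (forall y, inH G y -> y \in st G' -> y \notin st G -> (w s <= w y)%N) -> False.
  move=> mG tG vG hG sG sS sS' mn'.
  have t0' : th G i0 by rewrite tG.
  have [[i' [ni ti hF hE]]|lt] := exch mG sS sG sS' t0'; last first.
    by apply: (end_False mG sS sG sS' t0'); apply: leq_ltn_trans lt.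
  have [_ full] := Dsub mG sS sG sS'.
  have vi : vec G i0 = vec E i0 by rewrite vG.
  have vi' : vec G i' = vec E i' by rewrite vG // -tG.
  have yH : inH G (s - vec G i0 + vec G i').
    apply: inH_add => //; case/inHP: (sG) => h1 h2; apply/inHP; split=> i.
      by rewrite crdB crd_vec; have := h1 i; have := full _ t0'; case: eqP => [->|_]; clia.
    move=> nti; rewrite crdB crd_vec h2 //; case: eqP => // e; by rewrite e t0' in nti.
  have := mn' _ yH hF hE; apply/negP; rewrite -ltnNge.
  have lt' : (i' < i0)%N by rewrite ltn_neqAle imax -?tG // andbT.
  have sc : 0 < crd E i0 s.
    have := full _ t0'; have := hG _ sG => /inHP [h1 h2].
    rewrite (crd_decomp E s) !crd_sum.
    have -> : \sum_i crd G i0 (vec E i *~ crd E i s) = \sum_i crd E i0 (vec E i *~ crd E i s).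
      apply: eq_bigr => i _; case: (boolP (th E i)) => ti'; last by rewrite h2 // !mulr0z !crd0.
      rewrite -[in LHS]vG //; have := h1 i; case: (crd E i s) => // q _.
      by rewrite -pmulrn !crdMn !crd_vec.
    by [].
  rewrite vi vi' /w.
  rewrite (bigD1 i0) //= (bigD1 i') //= [in X in (_ < X)%N](bigD1 i0) //= [in X in (_ < X)%N](bigD1 i') //=.
  have -> : (\sum_(i < n | (i != i0) && (i != i')) i * `|crd E i (s - vec E i0 + vec E i')| =
    \sum_(i < n | (i != i0) && (i != i')) i * `|crd E i s|)%N.
    by apply: eq_bigr => i /andP [/negPf h1 /negPf h2]; rewrite !crdE h1 h2 subr0 addr0.
  rewrite !addnA ltn_add2r !crdE !eqxx (negPf ni) eq_sym (negPf ni).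
  have s' : 0 <= crd E i' s by have /inHP [h1 _] := hG _ sG; exact: h1.
  move: (crd E i0 s) (crd E i' s) sc s' => [[|u]|] // [u'|] // _ _.
  have -> : `|(Posz u.+1 - true%:Z + false%:Z)%R|%N = u by clia.
  have -> : `|(Posz u' - false%:Z + true%:Z)%R|%N = u'.+1 by clia.
  by rewrite /= !mulnS; move: lt'; clia.
case/andP: (Ds) => sH; case: (boolP (s \in st E)) => sE.
  move=> nF; apply: (key E F) => //.
  by move=> y yH yF yE; apply: mn; rewrite /D yH yF (negPf yE).
move=> nF; have mFE := matched_sym mEF; apply: (key F E) => //.
- by move=> i; rewrite (thEF mEF).
- by move=> i; apply: vecEF.
- exact: (inH_EF mFE).
- exact: (inH_EF mEF).
- by case: (s \in st F) nF.
by move=> y yH yF yE; apply: mn; rewrite /D (inH_EF mFE) // yF (negPf yE).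
Qed.

Lemma tcountEF E F x : matched E F -> inH E x -> tcount E x = tcount F x.
Proof.
move=> mEF xH; have /inHP [x0 _] := xH; have /inHP [x0F _] := inH_EF mEF xH.
have : mult E x = mult F x by case: mEF.
rewrite !mult_split //; suff -> : ecount E x = ecount F x by move/addnI.
apply: eq_card => i; rewrite !inE -(thEF mEF); case: (boolP (th E i)) => //= ti.
by rewrite (vecEF mEF) // (D_empty mEF) // inH_add.
Qed.

Definition allsoc G := forall i j, vec G i + vec G j \notin st G.

Lemma allsoc_st G x : allsoc G -> x \in st G -> x = 0 \/ exists i, x = vec G i.
Proof.
move=> soc xS; have [->|xn] := eqVneq x 0; [by left|right].
have x0 i := st_ge0 i xS.
have [i hi] := crd_gt0 x0 xn; exists i.
have d0 k : 0 <= crd G k (x - vec G i).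
  by rewrite !crdE; have := x0 k; case: eqP => [->|_]; move: hi; clia.
apply/eqP; rewrite -subr_eq0; apply: contraT => dn; have [j hj] := crd_gt0 d0 dn.
exfalso; apply: (negP (soc i j)); apply: (st_le xS) => k; have := d0 k; move: hj; rewrite !crdE.
by have [->|_] := eqVneq k j; clia.
Qed.

(** Here the roots are the differences [e_i - e_j], a symmetric set. In any other staircase some
    [e_i] is a root while [- e_i] never is, so symmetry characterizes [allsoc]. *)
Lemma allsoc_root G a : allsoc G -> wroot G a -> wroot G (- a).
Proof.
move=> soc; have mx i : maxi G (vec G i).
  by apply/maxiP; split=> [|j]; [exact: st_vec|exact: soc].
case/root_sign=> [[a0 [i hi]]|[j [aj a0 /AAP [aS r]]]].
  suff -> : a = 0 by rewrite oppr0; apply: (@root_posW _ _ G _ i) => [k|]; rewrite ?crd0 // add0r st_vec.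
  apply/eqP; apply: contraT => an; have [j hj] := crd_gt0 a0 an.
  exfalso; apply: (negP (soc j i)); apply: (st_le hi) => k; have := a0 k; rewrite !crdE.
  by have [->|_] := eqVneq k j; move: hj; clia.
case: (allsoc_st soc aS) => [e|[i e]].
  have /negP [] := not_root_oppvec G j; suff <- : a = - vec G j by apply/wrootP; exists j; apply/AAP.
  by apply/eqP; rewrite -addr_eq0 e.
have -> : - a = vec G j - vec G i by rewrite -e opprD addrCA subrr addr0.
exact: root_maxi.
Qed.

Lemma allsocEF E F : (forall a, mult E a = mult F a) -> allsoc E -> allsoc F.
Proof.
move=> EF soc i j; apply/negP => h.
have r : wroot F (vec F i) by apply: root_posW h => k; exact: crd_vec0.
have /negP [] := not_root_oppvec F i.
by move: r; rewrite -!(root_EF EF); exact: allsoc_root.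
Qed.

Definition total G := (\sum_i count (AA G i) (st G))%N.

(** The lattice is infinite, so the sum runs over a finite list holding all possible weights
    [s - e_i]. Any larger list will do, which lets two frames share one. *)
Lemma total_sum G (L : seq M) : uniq L -> (forall i s, s \in st G -> s - vec G i \in L) ->
  total G = (\sum_(a <- L) mult G a)%N.
Proof.
move=> uL hL.
have -> : (\sum_(a <- L) mult G a = \sum_(a <- L) \sum_i AA G i (a + vec G i)%R)%N.
  by apply: eq_bigr => a _; rewrite /mult -sum1_card big_mkcond; apply: eq_bigr => i _; rewrite inE; case: AA.
rewrite exchange_big; apply: eq_bigr => i _.
rewrite -sum1_count.
have -> : (\sum_(a <- L) AA G i (a + vec G i)%R = \sum_(a <- L | AA G i (a + vec G i)%R) 1)%N.
  by rewrite [RHS]big_mkcond; apply: eq_bigr => a _; case: AA.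
rewrite -big_filter -[RHS]big_filter.
rewrite -(big_map (fun a => a + vec G i) xpredT (fun=> 1%N)).
apply: perm_big; apply: uniq_perm.
- by rewrite filter_uniq // st_uniq.
- by rewrite map_inj_uniq ?filter_uniq //; exact: addIr.
move=> s; rewrite mem_filter; apply/andP/mapP => [[As sS]|[a]].
  by exists (s - vec G i); rewrite ?subrK // mem_filter subrK As hL.
by rewrite mem_filter => /andP [Aa _] ->; split=> //; exact: AA_st Aa.
Qed.

Lemma totalEF E F : (forall a, mult E a = mult F a) -> total E = total F.
Proof.
move=> EF.
pose LG G := flatten [seq [seq s - vec G i | s <- st G] | i <- enum 'I_n].
have LGP G i s : s \in st G -> s - vec G i \in LG G.
  move=> sS; apply/flatten_mapP; exists i; first by rewrite mem_enum.
  by apply/mapP; exists s.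
rewrite (@total_sum E (undup (LG E ++ LG F))) ?undup_uniq //; last first.
  by move=> i s sS; rewrite mem_undup mem_cat LGP.
rewrite (@total_sum F (undup (LG E ++ LG F))) ?undup_uniq //; last first.
  by move=> i s sS; rewrite mem_undup mem_cat LGP ?orbT.
by apply: eq_bigr.
Qed.

End Match3.

(** * From frames back to staircases *)

Section Bridge.
Variables (n : nat) (M : zmodType).
Implicit Types (E F G : frame n M) (S : seq 'X_{1..n}).

Definition ev (b : 'I_n -> M) (s : 'X_{1..n}) := \sum_i b i *+ s i.

Lemma evD b s t : ev b (s + t)%MM = ev b s + ev b t.
Proof. by rewrite /ev -big_split; apply: eq_bigr => i _; rewrite mnmDE mulrnDr. Qed.
Lemma evU b i : ev b U_(i)%MM = b i.
Proof.
rewrite /ev (bigD1 i) //= big1 ?addr0 ?mnm1E ?eqxx //.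
by move=> j /negPf ji; rewrite mnm1E eq_sym ji.
Qed.
Lemma ev0 b : ev b 0%MM = 0.
Proof. by rewrite /ev big1 // => i _; rewrite mnm0E. Qed.

Lemma crd_ev G s i : crd G i (ev (vec G) s) = (s i)%:Z.
Proof.
rewrite crd_sum (bigD1 i) //= big1 ?addr0; first by rewrite crdMn crd_vec eqxx mul1r.
by move=> j /negPf ji; rewrite crdMn crd_vec eq_sym ji mul0r.
Qed.

Lemma ev_inj G : injective (ev (vec G)).
Proof.
by move=> s t h; apply/mnmP => i; apply/eqP; rewrite -eqz_nat -!(crd_ev G) h.
Qed.

Lemma ev_mn G x : (forall i, 0 <= crd G i x) -> x = ev (vec G) [multinom absz (crd G i x) | i < n].
Proof. by move=> x0; apply: (@crd_inj _ _ G) => i; rewrite crd_ev mnmE gez0_abs. Qed.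

Definition realizes G S := forall s, (ev (vec G) s \in st G) = (s \in S).

Section Realize.
Variables (G : frame n M) (S : seq 'X_{1..n}).
Hypotheses (stS : stair S) (r : realizes G S).

Lemma st_perm : perm_eq (st G) (map (ev (vec G)) S).
Proof.
apply: uniq_perm; first exact: st_uniq.
  by rewrite map_inj_uniq; [case: stS|exact: ev_inj].
move=> x; apply/idP/mapP => [xS|[s sS ->]]; last by rewrite r.
have x0 i := st_ge0 i xS; exists [multinom absz (crd G i x) | i < n]; last exact: ev_mn.
by rewrite -r -ev_mn.
Qed.

Lemma adj_ev i j : adj S j i = (vec G j + vec G i \in st G).
Proof. by rewrite /adj -r evD !evU. Qed.

Lemma xAA_ev i s : xAA S i s = AA G i (ev (vec G) s).
Proof.
rewrite /xAA /AA r; congr (_ && _); rewrite (perm_all _ st_perm) all_map.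
by apply: eq_all => v /=; rewrite -evD r -[in RHS](evU (vec G) i) -evD r.
Qed.

Lemma total_ev : xtotal S = total G.
Proof.
rewrite /xtotal /total; apply: eq_bigr => i _; move/seq.permP: st_perm => ->.
by rewrite count_map; apply: eq_count => s; rewrite /= -xAA_ev.
Qed.

Lemma soc_ev : (forall i j, ~~ adj S i j) <-> allsoc G.
Proof. by split=> h i j; have := h i j; rewrite adj_ev. Qed.

Lemma thin_ev : thin S [set i | th G i].
Proof.
move=> j; rewrite inE => tj; split=> [i i'|i]; first by rewrite !adj_ev; exact: thin_uniq.
by rewrite -r !evD !evU; exact: thin_sq.
Qed.

Lemma supp_ev x : supp [set i | th G i] x -> inH G (ev (vec G) x).
Proof.
move=> /forallP h; apply/inHP; split=> i; rewrite crd_ev // => ti.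
by have := h i; rewrite inE (negPf ti) /= => /eqP ->.
Qed.

Lemma tc_ev x : tc S [set i | th G i] x = tcount G (ev (vec G) x).
Proof.
by rewrite /tc /tcount; apply: eq_card => j; rewrite !inE -r evD evU.
Qed.
End Realize.

(** The type of a thick index is its vector. By [thick_vec] each such vector occurs in both bases,
    and once in each, so the counts agree. *)
Lemma frames_match E F : (forall a, mult E a = mult F a) -> exists p, matched E (relabel F p).
Proof.
move=> EF.
pose t1 i := if th E i then Some (vec E i) else None.
pose t2 i := if th F i then Some (vec F i) else None.
have aux (G G' : frame n M) t : (forall a, mult G a = mult G' a) -> t != None ->
   (#|[set i | (if th G i then Some (vec G i) else None) == t]| <=
    #|[set i | (if th G' i then Some (vec G' i) else None) == t]|)%N.
  move=> GG tn; case: (set_0Vmem [set i | (if th G i then Some (vec G i) else None) == t]) => [->|[i]].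
    by rewrite cards0.
  rewrite inE => /eqP e; case: (boolP (th G i)) e => [ti e|_ e]; last by rewrite -e in tn.
  have [k ek] := thick_vec GG ti.
  have tk : th G' k by rewrite /th -ek -(thickv_EF GG).
  rewrite (@eq_card1 _ i) => [|j].
    by apply/card_gt0P; exists k; rewrite inE tk -ek e.
  rewrite !inE -e; case: ifP => [_|tj]; last by apply/esym/negbTE/eqP => ji; rewrite ji ti in tj.
  by apply/eqP/eqP => [[/vec_inj]|->].
have [|p hp] := @perm_of_counts _ _ t1 t2 None.
  by move=> t tn; apply/eqP; rewrite eqn_leq; apply/andP; split; apply: aux.
have EF' a : mult E a = mult (relabel F p) a by rewrite mult_relabel.
have thp i : th (relabel F p) i = th F (p i).
  by rewrite /th /thickv /= /wroot !mult_relabel.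
exists p; split=> // i; first by move=> ti; have := hp i; rewrite /t1 /t2 ti; case: ifP => // _ [].
by rewrite thp => ti; have := hp i; rewrite /t1 /t2 ti; case: ifP => // _ [].
Qed.

Theorem frames_iso E F S S' : stair S -> stair S' -> realizes E S -> realizes F S' ->
  (forall a, mult E a = mult F a) -> exists p, forall s, (s \in S) = (pm p s \in S').
Proof.
move=> stS stS' rE rF EF; have [p mEF] := frames_match EF.
have stP := stair_permS p stS'.
have rP : realizes (relabel F p) (permS p S').
  move=> s; rewrite mem_permS -rF; suff -> : ev (vec (relabel F p)) s = ev (vec F) (pm p s) by [].
  rewrite /ev [RHS](reindex_inj (@perm_inj _ p)); apply: eq_bigr => i _ /=.
  by rewrite pmE.
have eth : [set i | th (relabel F p) i] = [set i | th E i].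
  by apply/setP => i; rewrite !inE (thEF mEF).
have eev x : supp [set i | th E i] x -> ev (vec (relabel F p)) x = ev (vec E) x.
  move=> /forallP h; rewrite /ev; apply: eq_bigr => i _; have := h i; rewrite inE.
  by case/orP=> [ti|/eqP ->]; [rewrite (vecEF mEF)|rewrite !mulr0n].
have [||||||q hq] := @stair_iso n S (permS p S') [set i | th E i] stS stP.
- exact: thin_ev rE.
- by rewrite -eth; exact: thin_ev rP.
- by move=> x sx; rewrite -rE -rP eev // (D_empty mEF) // supp_ev.
- move=> x sx _; rewrite (tc_ev rE) -eth (tc_ev rP) eev //.
  by apply: tcountEF mEF _; apply: supp_ev.
- have [e _ _] := mEF.
  by rewrite (total_ev stS rE) (total_ev stP rP); exact: totalEF.
- apply: (iff_trans (soc_ev rE)); apply: iff_sym; apply: (iff_trans (soc_ev rP)).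
  have [e _ _] := mEF.
  by split; apply: allsocEF.
by exists (q * p)%g => s; rewrite hq mem_permS pmM.
Qed.

(** The basis part of a frame, kept separate because the weights of the generators of [B] are known
    to form a basis before [B] is known to have a staircase. *)
Record zbasis := ZBasis {
  zvec : 'I_n -> M; zcrd : 'I_n -> M -> int;
  zcrdD : forall i x y, zcrd i (x + y) = zcrd i x + zcrd i y;
  zcrd_vec : forall i j, zcrd i (zvec j) = (i == j)%:Z;
  zcrd_inj : forall x y, (forall i, zcrd i x = zcrd i y) -> x = y }.

Lemma zcrd_ev (b : zbasis) i s : zcrd b i (ev (zvec b) s) = (s i)%:Z.
Proof.
have z0 : zcrd b i 0 = 0 by have := zcrdD b i 0 0; rewrite addr0; lia.
have zM x k : zcrd b i (x *+ k) = zcrd b i x * k%:Z.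
  by elim: k => [|k IH]; rewrite ?mulr0n ?z0 ?mulrS ?zcrdD ?IH; lia.
rewrite /ev (big_morph (zcrd b i) (zcrdD b i) z0) (bigD1 i) //= big1 ?addr0.
  by rewrite zM zcrd_vec eqxx mul1r.
by move=> j /negPf ji; rewrite zM zcrd_vec eq_sym ji mul0r.
Qed.

Lemma zev_inj (b : zbasis) : injective (ev (zvec b)).
Proof. by move=> s t h; apply/mnmP => i; apply/eqP; rewrite -eqz_nat -!(zcrd_ev b) h. Qed.

Lemma frame_of (b : zbasis) S : stair S ->
  exists G : frame n M, [/\ vec G = zvec b, crd G = zcrd b & realizes G S].
Proof.
move=> [uS S0 SU Sd]; have zev := zcrd_ev b; have zinj := @zev_inj b.
have c1 : uniq (map (ev (zvec b)) S) by rewrite map_inj_uniq.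
have c2 i x : x \in map (ev (zvec b)) S -> 0 <= zcrd b i x by case/mapP => s _ ->; rewrite zev.
have c3 i x : x \in map (ev (zvec b)) S -> 0 < zcrd b i x -> x - zvec b i \in map (ev (zvec b)) S.
  case/mapP => s sS ->; rewrite zev => si; apply/mapP.
  have e := mnm_subU si.
  exists (s - U_(i))%MM; first by apply: (Sd _ i); rewrite -e.
  by rewrite {1}e evD evU addrK.
have c4 i : zvec b i \in map (ev (zvec b)) S by apply/mapP; exists U_(i)%MM; rewrite ?evU.
have c5 : 0 \in map (ev (zvec b)) S by apply/mapP; exists 0%MM; rewrite ?ev0.
exists (Frame (@zcrdD b) (@zcrd_vec b) (@zcrd_inj b) c1 c2 c3 c4 c5); split=> // s.
exact: mem_map.
Qed.

End Bridge.

(** * Algebraic groups *)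

Section Act.
Variables (K : fieldType) (C : falgType K).
Local Notation d := (adim C).
Local Notation r2v := (@r2v K C).
Local Notation v2r := (@v2r K C).
Implicit Types (M N : 'M[K]_d) (v w : C).

Lemma mx_act_is_linear M : linear (mx_act M).
Proof. by move=> c v w; rewrite /mx_act linearP mulmxDl -scalemxAl linearP. Qed.
HB.instance Definition _ M := GRing.isLinear.Build K C C *:%R (mx_act M) (mx_act_is_linear M).

Lemma mx_actM M N v : mx_act (M *m N) v = mx_act N (mx_act M v).
Proof. by rewrite /mx_act r2vK mulmxA. Qed.
Lemma mx_act1 v : mx_act 1%:M v = v.
Proof. by rewrite /mx_act mulmx1 v2rK. Qed.
Lemma mx_actZl c M v : mx_act (c *: M) v = c *: mx_act M v.
Proof. by rewrite /mx_act -scalemxAr linearZ. Qed.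
Lemma mx_actDl M N v : mx_act (M + N) v = mx_act M v + mx_act N v.
Proof. by rewrite /mx_act mulmxDr linearD. Qed.

Lemma mx_act0 v : mx_act 0 v = 0.
Proof. by rewrite /mx_act mulmx0 linear0. Qed.
Lemma mx_act_sum (I : Type) (r : seq I) (c : I -> K) (M : I -> 'M[K]_d) v :
  mx_act (\sum_(i <- r) c i *: M i) v = \sum_(i <- r) c i *: mx_act (M i) v.
Proof.
elim/big_ind2: _ => [|x1 M1 x2 M2 e1 e2|i _]; first exact: mx_act0.
  by rewrite mx_actDl e1 e2.
exact: mx_actZl.
Qed.

Lemma mx_act_entry M i j : M i j = v2r (mx_act M (r2v (delta_mx 0 i))) 0 j.
Proof. by rewrite /mx_act !r2vK -rowE mxE. Qed.

Lemma mx_act_inj M N : (forall v, mx_act M v = mx_act N v) -> M = N.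
Proof. by move=> h; apply/matrixP => i j; rewrite !mx_act_entry h. Qed.

Definition mx_of (g : C -> C) : 'M[K]_d := \matrix_(i, j) v2r (g (r2v (delta_mx 0 i))) 0 j.

Lemma mx_ofE (g : C -> C) v : linear g -> mx_act (mx_of g) v = g v.
Proof.
move=> lg; pose g' := HB.pack_for {linear C -> C} g (GRing.isLinear.Build K C C *:%R g lg).
suff e : forall u : 'rV_d, r2v (u *m mx_of g) = g (r2v u) by rewrite /mx_act e v2rK.
move=> u; rewrite {2}(row_sum_delta u) linear_sum -[g _]/(g' _) linear_sum /=.
apply: v2r_inj; rewrite r2vK linear_sum; apply/rowP => j; rewrite mxE summxE.
apply: eq_bigr => i _.
have -> : r2v (u 0 i *: delta_mx 0 i) = u 0 i *: r2v (delta_mx 0 i) by rewrite linearZ.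
by rewrite -[g _]/(g' _) !linearZ !mxE.
Qed.

Lemma AutMx1 : AutMx (1%:M : 'M[K]_d).
Proof. by split; rewrite ?unitmx1 ?mx_act1 // => x y; rewrite !mx_act1. Qed.

Lemma AutMxM M N : AutMx M -> AutMx N -> AutMx (M *m N).
Proof.
move=> [u1 o1 m1] [u2 o2 m2]; split; first by rewrite unitmx_mul u1 u2.
  by rewrite mx_actM o1 o2.
by move=> x y; rewrite !mx_actM m1 m2.
Qed.
End Act.

(** * Zariski topology and polynomial curves *)

Section Zariski.
Variables (K : fieldType) (d : nat).
Implicit Types (Z C : 'M[K]_d -> Prop) (M N : 'M[K]_d).

Lemma mx_eval_mulmx M (p : {mpoly K[d * d]}) :
  exists q : {mpoly K[d * d]}, forall N, mx_eval q N = mx_eval p (M *m N).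
Proof.
pose L (k : 'I_(d * d)) : {mpoly K[d * d]} :=
  \sum_k' mxvec (lin_mulmx M) 0 (mxvec_index k' k) *: 'X_k'.
have hL N k : (L k).@[fun i => mxvec N 0 i] = mxvec (M *m N) 0 k.
  have -> : mxvec (M *m N) = mxvec N *m lin_mulmx M by rewrite mul_vec_lin.
  rewrite /L raddf_sum mxE; apply: eq_bigr => k' _.
  by rewrite /= mevalZ mevalXU mxvecE mulrC.
exists (p \mPo [tuple L k | k < d * d]) => N.
rewrite /mx_eval comp_mpoly_meval; apply: meval_eq => k.
by rewrite tnth_mktuple hL.
Qed.

Lemma Zclosed_mulmx M Z : Zclosed Z -> Zclosed (fun N => Z (M *m N)).
Proof.
case=> S hS.
have [S' hS'] : exists S' : seq {mpoly K[d * d]}, forall N,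
   (forall p, p \in S -> mx_eval p (M *m N) = 0) <-> (forall p, p \in S' -> mx_eval p N = 0).
  elim: S {hS} => [|p S [S' IH]]; first by exists [::].
  have [q hq] := mx_eval_mulmx M p; exists (q :: S') => N; split=> h r.
    rewrite inE => /orP [/eqP ->|rS]; first by rewrite hq h // mem_head.
    by apply: (proj1 (IH N)) rS => r' r'S; apply: h; rewrite inE r'S orbT.
  rewrite inE => /orP [/eqP ->|rS]; first by rewrite -hq h // mem_head.
  by apply: (proj2 (IH N)) rS => r' r'S; apply: h; rewrite inE r'S orbT.
by exists S' => N; rewrite hS hS'.
Qed.

Lemma Zconnected_mulmx M C : M \in unitmx -> Zconnected C -> Zconnected (fun N => C (invmx M *m N)).
Proof.
move=> uM cC Z1 Z2 z1 z2 cov dis.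
have [||h|h] := cC _ _ (Zclosed_mulmx M z1) (Zclosed_mulmx M z2).
- by move=> N CN; apply: cov; rewrite mulKmx.
- by move=> N CN; apply: dis; rewrite mulKmx.
- by left=> N CN; rewrite -(mulKVmx uM N); apply: h.
- by right=> N CN; rewrite -(mulKVmx uM N); apply: h.
Qed.

Lemma Zconnected_union C1 C2 M : Zconnected C1 -> Zconnected C2 -> C1 M -> C2 M ->
  Zconnected (fun N => C1 N \/ C2 N).
Proof.
move=> c1 c2 M1 M2 Z1 Z2 z1 z2 cov dis.
have cov1 N : C1 N -> Z1 N \/ Z2 N by move=> CN; apply: cov; left.
have cov2 N : C2 N -> Z1 N \/ Z2 N by move=> CN; apply: cov; right.
have dis1 N : C1 N -> Z1 N -> Z2 N -> False by move=> CN; apply: dis; left.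
have dis2 N : C2 N -> Z1 N -> Z2 N -> False by move=> CN; apply: dis; right.
case: (c1 _ _ z1 z2 cov1 dis1) => h1; case: (c2 _ _ z1 z2 cov2 dis2) => h2.
- by left=> N [/h1|/h2].
- by case: (dis1 M M1 (h1 M M1) (h2 M M2)).
- by case: (dis1 M M1 (h2 M M2) (h1 M M1)).
- by right=> N [/h1|/h2].
Qed.
End Zariski.

Section Curves.
Variable K : fieldType.
Hypothesis K0 : [pchar K] =i pred0.

Lemma natr_eq0 m : (m%:R == 0 :> K) = (m == 0)%N.
Proof. by move/pcharf0P: K0 => ->. Qed.

Lemma natr_inj : injective (fun m => m%:R : K).
Proof.
suff aux i j : (i <= j)%N -> i%:R = j%:R :> K -> i = j.
  by move=> i j e; case/orP: (leq_total i j) => h; [apply: aux|apply/esym/aux].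
move=> ij /eqP; rewrite eq_sym -subr_eq0 -natrB // natr_eq0 subn_eq0 => ji.
by apply/eqP; rewrite eqn_leq ij ji.
Qed.

Lemma poly_inf (p : {poly K}) : (forall t, p.[t] = 0) -> p = 0.
Proof.
move=> h; apply: contraTeq isT => p0.
have /(max_poly_roots p0) : all (root p) [seq i%:R | i <- iota 0 (size p)].
  by apply/allP => x _; apply/rootP.
rewrite map_inj_uniq ?iota_uniq; last exact: natr_inj.
by move/(_ isT); rewrite size_map size_iota ltnn.
Qed.

Lemma poly_inj (p q : {poly K}) : (forall t, p.[t] = q.[t]) -> p = q.
Proof. by move=> h; apply/eqP; rewrite -subr_eq0; apply/eqP/poly_inf => t; rewrite !hornerE h subrr. Qed.

(* [P] along a polynomial curve through [x0] is polynomial, and its first-order term depends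
   linearly on that of the curve. *)
Definition jet_ok N (x0 : 'I_N -> K) (P : {mpoly K[N]}) := exists c : 'I_N -> K,
  forall e : 'I_N -> {poly K}, (forall i, (e i)`_0 = x0 i) ->
  exists u : {poly K}, [/\ forall t, P.@[fun i => (e i).[t]] = u.[t], u`_0 = P.@[x0] &
    u`_1 = \sum_i (e i)`_1 * c i].

Lemma mpoly_jet N (x0 : 'I_N -> K) P : jet_ok x0 P.
Proof.
have jC c : jet_ok x0 c%:MP.
  exists (fun=> 0) => e he; exists c%:P; split=> [t||]; rewrite ?mevalC ?hornerC ?coefC //=.
  by rewrite big1 // => i _; rewrite mulr0.
have jX i : jet_ok x0 'X_i.
  exists (fun j => (j == i)%:R) => e he; exists (e i); split=> [t||]; rewrite ?mevalXU ?he //.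
  rewrite (bigD1 i) //= eqxx mulr1 big1 ?addr0 // => j /negPf ->; exact: mulr0.
have jD P1 P2 : jet_ok x0 P1 -> jet_ok x0 P2 -> jet_ok x0 (P1 + P2).
  case=> c1 h1 [c2 h2]; exists (fun i => c1 i + c2 i) => e he.
  have [u1 [a1 b1 d1]] := h1 e he; have [u2 [a2 b2 d2]] := h2 e he.
  exists (u1 + u2); split=> [t||]; rewrite ?mevalD ?hornerD ?coefD ?a1 ?a2 ?b1 ?b2 ?d1 ?d2 //.
  by rewrite -big_split; apply: eq_bigr => i _; rewrite mulrDr.
have jM P1 P2 : jet_ok x0 P1 -> jet_ok x0 P2 -> jet_ok x0 (P1 * P2).
  case=> c1 h1 [c2 h2]; exists (fun i => P1.@[x0] * c2 i + c1 i * P2.@[x0]) => e he.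
  have [u1 [a1 b1 d1]] := h1 e he; have [u2 [a2 b2 d2]] := h2 e he.
  exists (u1 * u2); split=> [t||]; rewrite ?mevalM ?hornerM ?a1 ?a2 //.
    by rewrite coefM big_ord1 b1 b2.
  rewrite coefM !big_ord_recl big_ord0 /= /bump /= addr0 b1 b2 d1 d2.
  rewrite mulr_sumr mulr_suml -big_split; apply: eq_bigr => i _ /=.
  by rewrite mulrDr !mulrA (mulrC _ (P1.@[x0])).
rewrite (mpolyE P); apply: (big_ind (jet_ok x0)) => //.
  by rewrite -mpolyC0; exact: jC.
move=> m _; rewrite -mul_mpolyC; apply: (jM) => //.
rewrite mpolyXE_id; apply: (big_ind (jet_ok x0)).
- by rewrite -mpolyC1; exact: jC.
- exact: jM.
move=> i _; have pw k : jet_ok x0 (('X_i : {mpoly K[N]}) ^+ k).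
  elim: k => [|k IH]; first by rewrite expr0 -mpolyC1; exact: jC.
  by rewrite exprS; apply: (jM).
exact: pw.
Qed.

Section Curve.
Variables (d : nat) (E : 'M[{poly K}]_d).
Definition crv (t : K) : 'M[K]_d := map_mx (horner_eval t) E.

Lemma crv_eval (P : {mpoly K[d * d]}) : exists u : {poly K}, forall t, mx_eval P (crv t) = u.[t].
Proof.
have [c hc] := mpoly_jet (fun i => (mxvec E 0 i)`_0) P.
have [u [hu _ _]] := hc (fun i => mxvec E 0 i) (fun=> erefl).
exists u => t; rewrite -hu /mx_eval; apply: meval_eq => i.
by rewrite /crv -map_mxvec mxE.
Qed.

(** [q] removes the parameters where a curve may leave the group. On the curve a closed condition
    holds identically or only at roots of a nonzero polynomial; if neither closed set contained the
    curve, the product of these polynomials and [q] would vanish on the infinite field [K]. *)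
Lemma Zconnected_crv (q : {poly K}) : q != 0 ->
  Zconnected (fun N => exists2 t, q.[t] != 0 & N = crv t).
Proof.
move=> q0 Z1 Z2 [S1 h1] [S2 h2] cov _.
have key (S : seq {mpoly K[d * d]}) : (forall t, q.[t] != 0 -> forall p, p \in S -> mx_eval p (crv t) = 0) \/
   exists u : {poly K}, u != 0 /\ (forall t, q.[t] != 0 -> (forall p, p \in S -> mx_eval p (crv t) = 0) -> u.[t] = 0).
  elim: S => [|p S [IH|[u [u0 hu]]]]; first by left.
    have [v hv] := crv_eval p; have [v0|v0] := eqVneq v 0.
      left=> t qt r; rewrite inE => /orP [/eqP ->|]; last exact: IH.
      by rewrite hv v0 horner0.
    by right; exists v; split=> // t qt h; rewrite -hv h // mem_head.
  by right; exists u; split=> // t qt h; apply: hu => // r rS; apply: h; rewrite inE rS orbT.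
case: (key S1) => [k1|[u1 [u10 hu1]]].
  by left=> N [t qt ->]; apply/h1; exact: k1.
case: (key S2) => [k2|[u2 [u20 hu2]]].
  by right=> N [t qt ->]; apply/h2; exact: k2.
exfalso; have : u1 * u2 * q = 0.
  apply: poly_inf => t; rewrite !hornerM; have [->|qt] := eqVneq q.[t] 0; first by rewrite mulr0.
  have [/h1 z|/h2 z] := cov (crv t) (ex_intro2 _ _ t qt erefl).
    by rewrite hu1 ?mul0r.
  by rewrite hu2 ?mulr0 ?mul0r.
by move/eqP; rewrite !mulf_eq0 (negPf q0) (negPf u10) (negPf u20).
Qed.
End Curve.

Section Aut0.
Variable C : falgType K.
Local Notation d := (adim C).

Lemma Aut0_AutMx (M : 'M[K]_d) : Aut0 M -> AutMx M.
Proof. by case=> X [h _ _ XM]; apply: h. Qed.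

(** The translate by [M] of a connected set through 1 meets [C1] at [M], so the union is
    connected. *)
Lemma Aut0M (M N : 'M[K]_d) : Aut0 M -> Aut0 N -> Aut0 (M *m N).
Proof.
move=> aM aN; have [uM _ _] := Aut0_AutMx aM; case: (aM) => C1 [h1 i1 c1 m1].
case: aN => C2 [h2 i2 c2 m2].
exists (fun X => C1 X \/ C2 (invmx M *m X)); split.
- move=> X [/h1 //|/h2 h]; rewrite -(mulKVmx uM X); apply: AutMxM => //; exact: h1.
- by left.
- by apply: (@Zconnected_union _ _ _ _ M) => //; [exact: Zconnected_mulmx|rewrite mulVmx].
- by right; rewrite mulKmx.
Qed.

Lemma Aut01 : Aut0 (1%:M : 'M[K]_d).
Proof.
exists (fun X => X = 1%:M); split=> // [N ->|]; first exact: AutMx1.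
move=> Z1 Z2 _ _ cov _; case: (cov _ erefl) => h; [left|right] => N -> //.
Qed.

Lemma Aut0_crv (E : 'M[{poly K}]_d) (q : {poly K}) t0 : q.[t0] != 0 -> crv E t0 = 1%:M ->
  (forall t, q.[t] != 0 -> AutMx (crv E t)) -> forall t, q.[t] != 0 -> Aut0 (crv E t).
Proof.
move=> q0 e0 h t qt; exists (fun N => exists2 t, q.[t] != 0 & N = crv E t); split.
- by move=> N [t' qt' ->]; apply: h.
- by exists t0.
- by apply: Zconnected_crv; apply: contraNneq q0 => ->; rewrite horner0.
- by exists t.
Qed.
End Aut0.

Lemma aut0_hom1 (C C' : falgType K) (f : 'M[K]_(adim C) -> 'M[K]_(adim C')) :
  (forall X, Aut0 X -> Aut0 (f X)) ->
  (forall X Y, Aut0 X -> Aut0 Y -> f (X *m Y) = f X *m f Y) -> f 1%:M = 1%:M.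
Proof.
move=> fA fM; have uf : f 1%:M \in unitmx by case: (Aut0_AutMx (fA _ (@Aut01 C))).
have := fM _ _ (@Aut01 C) (@Aut01 C); rewrite mulmx1 => e.
by rewrite -[LHS](mulKmx uf) -e mulVmx.
Qed.

Lemma alg_group_iso_sym (C C' : falgType K) :
  alg_group_iso (@Aut0 K C) (@Aut0 K C') -> alg_group_iso (@Aut0 K C') (@Aut0 K C).
Proof.
case=> f [g [rf rg [fA gA] [gf fg] fM]]; exists g, f; split=> // M N aM aN.
rewrite -[in LHS](fg M aM) -[in LHS](fg N aN) -fM ?gf //; try exact: gA.
by apply: Aut0M; apply: gA.
Qed.
End Curves.

Fixpoint pr (k : nat) : nat := if k is k'.+1 then s2val (prime_above (pr k')) else 2.

Lemma pr_prime k : prime (pr k).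
Proof. by case: k => //= k; case: prime_above. Qed.

Lemma pr_inj : injective pr.
Proof.
have lt i j : (i < j)%N -> (pr i < pr j)%N.
  elim: j => // j IH; rewrite ltnS leq_eqVlt => /orP [/eqP ->|/IH h] /=; case: prime_above => //= p h' _.
  exact: ltn_trans h h'.
by move=> i j e; case: (ltngtP i j) => // /lt; rewrite e ltnn.
Qed.

(** * Exponential sums along the powers of one element *)

Section Theta.
Variables (K : fieldType) (n : nat).
Hypothesis K0 : [pchar K] =i pred0.
Local Notation M := 'rV[int]_n.
Implicit Types (w : M).

Definition theta w : K := \prod_(i < n) (pr i)%:R ^ (w 0 i).

Lemma pr_neq0 k : (pr k)%:R != 0 :> K.
Proof. by rewrite natr_eq0 // -lt0n prime_gt0 ?pr_prime. Qed.

Lemma theta0 : theta 0 = 1.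
Proof. by rewrite /theta big1 // => i _; rewrite mxE expr0z. Qed.
Lemma thetaD w w' : theta (w + w') = theta w * theta w'.
Proof.
by rewrite /theta -big_split; apply: eq_bigr => i _; rewrite mxE expfzDr ?pr_neq0.
Qed.
Lemma theta_neq0 w : theta w != 0.
Proof. by rewrite prodf_seq_neq0; apply/allP => i _; rewrite expfz_neq0 ?pr_neq0. Qed.
Lemma thetaN w : theta (- w) = (theta w)^-1.
Proof. by apply: (mulfI (theta_neq0 w)); rewrite -thetaD subrr theta0 mulfV ?theta_neq0. Qed.

(** Separating positive and negative exponents gives two equal products of prime powers in [nat], by
    characteristic 0; unique factorization concludes. *)
Lemma theta_eq1 w : theta w = 1 -> w = 0.
Proof.
move=> h.
pose a (i : 'I_n) := if 0 <= w 0 i then absz (w 0 i) else 0%N.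
pose b (i : 'I_n) := if 0 <= w 0 i then 0%N else absz (w 0 i).
have e : (\prod_(i < n) pr i ^ a i = \prod_(i < n) pr i ^ b i)%N.
  apply: (natr_inj K0); rewrite /= !natr_prod.
  have -> : \prod_(i < n) (pr i ^ a i)%:R = theta w * \prod_(i < n) (pr i ^ b i)%:R :> K.
    rewrite /theta -big_split; apply: eq_bigr => i _ /=; rewrite !natrX /a /b.
    have := pr_neq0 i; case: (w 0 i) => k /= pk; first by rewrite mulr1.
    by rewrite NegzE -exprnN mulVf // expf_neq0.
  by rewrite h mul1r.
have lg (c : 'I_n -> nat) (j : 'I_n) : logn (pr j) (\prod_(i < n) pr i ^ c i) = c j.
  have lp (r : seq 'I_n) : logn (pr j) (\prod_(i <- r) pr i ^ c i) = (\sum_(i <- r) logn (pr j) (pr i ^ c i))%N.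
    elim: r => [|i r IH]; first by rewrite !big_nil logn1.
    rewrite !big_cons lognM ?IH //; first by rewrite expn_gt0 prime_gt0 ?pr_prime.
    by apply: prodn_gt0 => k; rewrite expn_gt0 prime_gt0 ?pr_prime.
  rewrite lp (bigD1 j) //= big1 ?addn0; first by rewrite pfactorK ?pr_prime.
  move=> i ij; rewrite lognX logn_prime ?pr_prime // (inj_eq pr_inj).
  by case: eqP => [/val_inj ji|]; rewrite ?muln0 //; rewrite ji eqxx in ij.
apply/rowP => j; rewrite mxE; have := lg a j; rewrite e lg /a /b.
by case: ifP => h0; move: (w 0 j) h0 => [] k; lia.
Qed.

Lemma theta_inj : injective theta.
Proof.
move=> w w' e; apply/eqP; rewrite -subr_eq0; apply/eqP/theta_eq1.
by rewrite thetaD thetaN e mulfV ?theta_neq0.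
Qed.

Section VS.
Variables (G : M -> Prop) (V : lmodType K).

(* [vs], [es]: exponential sums in [m] with exponents in [G]. *)
Definition vs (F : nat -> V) := exists l : seq (M * V),
  (forall x, x \in l -> G x.1) /\ forall m, F m = \sum_(x <- l) theta x.1 ^+ m *: x.2.

Lemma vs_ext F F' : F =1 F' -> vs F -> vs F'.
Proof. by move=> e [l [h1 h2]]; exists l; split=> // m; rewrite -e. Qed.

Lemma vs_sum (I : Type) (r : seq I) (F : I -> nat -> V) :
  (forall i, vs (F i)) -> vs (fun m => \sum_(i <- r) F i m).
Proof.
move=> h; elim: r => [|i r [l' [h1' h2']]]; first by exists [::]; split=> // m; rewrite !big_nil.
have [l [h1 h2]] := h i; exists (l ++ l'); split=> [x|m]; last by rewrite big_cons big_cat h2 h2'.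
by rewrite mem_cat => /orP [/h1|/h1'].
Qed.

Lemma vs_uniq F : vs F -> exists (W : seq M) (u : M -> V), [/\ uniq W, forall w, w \in W -> G w &
  forall m, F m = \sum_(w <- W) theta w ^+ m *: u w].
Proof.
case=> l [hl hF]; exists (undup (map fst l)), (fun w => \sum_(x <- l | x.1 == w) x.2); split.
- exact: undup_uniq.
- by move=> w; rewrite mem_undup => /mapP [x /hl + ->].
move=> m; rewrite hF.
under [RHS]eq_bigr => w _ do rewrite scaler_sumr big_mkcond.
rewrite exchange_big big_seq [RHS]big_seq; apply: eq_bigr => x xl /=.
rewrite (bigD1_seq x.1) ?undup_uniq ?mem_undup ?map_f //= eqxx big1 ?addr0 //.
by move=> w /negPf; rewrite eq_sym => ->.
Qed.

(** Combining the equations with the coefficients of a polynomial that vanishes at every [theta w']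
    except [theta w] isolates [u w]. *)
Lemma vandermonde (W : seq M) (u : M -> V) : uniq W ->
  (forall m, \sum_(w <- W) theta w ^+ m *: u w = 0) -> forall w, w \in W -> u w = 0.
Proof.
move=> uW h w wW; pose p : {poly K} := \prod_(w' <- W | w' != w) ('X - (theta w')%:P).
have e : \sum_(w' <- W) p.[theta w'] *: u w' = 0.
  rewrite (eq_bigr (fun w' => \sum_(m < size p) p`_m *: (theta w' ^+ m *: u w'))); last first.
    by move=> w' _; rewrite horner_coef scaler_suml; apply: eq_bigr => m _; rewrite scalerA.
  rewrite exchange_big big1 // => m _; rewrite -scaler_sumr h scaler0 //.
move: e; rewrite (bigD1_seq w) //= [X in _ + X]big_seq_cond big1 ?addr0; last first.
  move=> w' /andP [w'W w'w]; rewrite /p -big_filter horner_prod (bigD1_seq w') /=; last 2 first.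
  - by rewrite mem_filter w'w.
  - exact: filter_uniq.
  by rewrite !hornerE subrr mul0r scale0r.
move/eqP; rewrite scaler_eq0 => /orP [|/eqP //]; rewrite /p horner_prod prodf_seq_eq0 => /hasP [w' _].
rewrite !hornerE subr_eq0 => /andP [w'w /eqP/theta_inj e]; by rewrite e eqxx in w'w.
Qed.
End VS.

Section ES.
Variable G : M -> Prop.
Hypotheses (G0 : G 0) (GD : forall x y, G x -> G y -> G (x + y)).

Definition es (F : nat -> K) := exists l : seq (M * K),
  (forall x, x \in l -> G x.1) /\ forall m, F m = \sum_(x <- l) theta x.1 ^+ m * x.2.

Lemma es_ext F F' : F =1 F' -> es F -> es F'.
Proof. by move=> e [l [h1 h2]]; exists l; split=> // m; rewrite -e. Qed.

Lemma es_vs (V : lmodType K) F (u : V) : es F -> vs G (fun m => F m *: u).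
Proof.
case=> l [h1 h2]; exists [seq (x.1, x.2 *: u) | x <- l]; split=> [x /mapP [y yl ->]|m]; first exact: (h1 _ yl).
by rewrite h2 big_map scaler_suml; apply: eq_bigr => x _; rewrite scalerA.
Qed.

Lemma es_const c : es (fun=> c).
Proof.
exists [:: (0, c)]; split=> [x|m]; first by rewrite inE => /eqP ->.
by rewrite big_seq1 theta0 expr1n mul1r.
Qed.

Lemma esD F F' : es F -> es F' -> es (fun m => F m + F' m).
Proof.
case=> l [h1 h2] [l' [h1' h2']]; exists (l ++ l'); split=> [x|m]; last by rewrite big_cat h2 h2'.
by rewrite mem_cat => /orP [/h1|/h1'].
Qed.

Lemma esM F F' : es F -> es F' -> es (fun m => F m * F' m).
Proof.
case=> l [h1 h2] [l' [h1' h2']]; exists [seq (x.1 + y.1, x.2 * y.2) | x <- l, y <- l']; split.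
  by move=> x /allpairsP [[y z] [/= yl zl ->]]; apply: GD; [apply: h1|apply: h1'].
move=> m; rewrite h2 h2' big_distrlr big_allpairs_dep /=.
apply: eq_bigr => x _; apply: eq_bigr => y _ /=.
by rewrite thetaD exprMn mulrACA.
Qed.

Lemma es_sum (I : Type) (r : seq I) (F : I -> nat -> K) :
  (forall i, es (F i)) -> es (fun m => \sum_(i <- r) F i m).
Proof.
move=> h; elim: r => [|i r IH].
  by apply: (es_ext _ (es_const 0)) => m; rewrite big_nil.
by apply: (es_ext _ (esD (h i) IH)) => m; rewrite big_cons.
Qed.

Lemma es_prod (I : Type) (r : seq I) (F : I -> nat -> K) :
  (forall i, es (F i)) -> es (fun m => \prod_(i <- r) F i m).
Proof.
move=> h; elim: r => [|i r IH].
  by apply: (es_ext _ (es_const 1)) => m; rewrite big_nil.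
by apply: (es_ext _ (esM (h i) IH)) => m; rewrite big_cons.
Qed.

Lemma es_exp F k : es F -> es (fun m => F m ^+ k).
Proof.
move=> h; elim: k => [|k IH]; first by apply: (es_ext _ (es_const 1)) => m; rewrite expr0.
by apply: (es_ext _ (esM h IH)) => m; rewrite exprS.
Qed.

Lemma es_eval N (P : {mpoly K[N]}) (v : nat -> 'I_N -> K) :
  (forall i, es (v^~ i)) -> es (fun m => P.@[v m]).
Proof.
move=> h; apply: (@es_ext (fun m => \sum_(s <- msupp P) P@_s * \prod_i v m i ^+ s i)).
  by move=> m; rewrite -mevalE.
apply: es_sum => s; apply: esM; first exact: es_const.
by apply: es_prod => i; apply: es_exp.
Qed.

Lemma es_det d (H : nat -> 'M[K]_d) : (forall i j, es (fun m => H m i j)) -> es (fun m => \det (H m)).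
Proof.
move=> h; apply: es_sum => s; apply: esM; first exact: es_const.
by apply: es_prod => i.
Qed.
End ES.

Definition mpow d (H : 'M[K]_d) m := iter m (mulmx H) 1%:M.
Lemma mpowSr d (H : 'M[K]_d) m : mpow H m.+1 = mpow H m *m H.
Proof. by elim: m => [|m IH] /=; rewrite ?mul1mx ?mulmx1 // -mulmxA -IH. Qed.

Section Dec.
Variables (C : falgType K) (G : M -> Prop).
Implicit Types (H : 'M[K]_(adim C)).
Local Notation v2r := (@v2r K C).
Local Notation r2v := (@r2v K C).

(* [H] is diagonalizable with eigenvalues [theta w], [w] in [G]. *)
Definition dec H := forall v : C, exists l : seq (M * C),
  (forall x, x \in l -> G x.1 /\ mx_act H x.2 = theta x.1 *: x.2) /\ v = \sum_(x <- l) x.2.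

Lemma mpow_eig H c v m : mx_act H v = c *: v -> mx_act (mpow H m) v = c ^+ m *: v.
Proof.
move=> e; elim: m => [|m IH]; first by rewrite mx_act1 expr0 scale1r.
by rewrite /= mx_actM e linearZ /= IH scalerA exprS.
Qed.

Lemma dec_vs H v : dec H -> vs G (fun m => mx_act (mpow H m) v).
Proof.
move=> dH; have [l [hl ->]] := dH v; exists l; split=> [x /hl [] //|m].
rewrite linear_sum big_seq [RHS]big_seq; apply: eq_bigr => x /hl [_ e].
exact: mpow_eig.
Qed.

Lemma dec_es H i j : dec H -> es G (fun m => mpow H m i j).
Proof.
move=> dH; have [l [hl hF]] := dec_vs (r2v (delta_mx 0 i)) dH.
exists [seq (x.1, v2r x.2 0 j) | x <- l]; split=> [x /mapP [y yl ->]|m]; first exact: (hl _ yl).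
rewrite mx_act_entry hF linear_sum summxE big_map; apply: eq_bigr => x _.
by rewrite linearZ mxE.
Qed.

(** Applying [H] shifts [m] by one; [vandermonde] compares the two exponential sums term by term and
    makes every coefficient an eigenvector. *)
Lemma vs_eig H v : vs G (fun m => mx_act (mpow H m) v) ->
  exists (W : seq M) (u : M -> C), [/\ uniq W, forall w, w \in W -> G w,
    forall m, mx_act (mpow H m) v = \sum_(w <- W) theta w ^+ m *: u w,
    forall w, w \in W -> mx_act H (u w) = theta w *: u w & v = \sum_(w <- W) u w].
Proof.
move=> hv; have [W [u [uW hW hF]]] := vs_uniq hv; exists W, u; split=> // [w wW|]; last first.
  by rewrite -[LHS]mx_act1 -[1%:M]/(mpow H 0) hF; apply: eq_bigr => w _; rewrite expr0 scale1r.
apply/eqP; rewrite -subr_eq0; apply/eqP.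
apply: (@vandermonde C W (fun w => mx_act H (u w) - theta w *: u w)) => // m.
have comm : mx_act H (mx_act (mpow H m) v) = mx_act (mpow H m.+1) v by rewrite -mx_actM mpowSr.
rewrite !hF linear_sum in comm.
under eq_bigr => w' _ do rewrite scalerBr.
rewrite sumrB; apply/eqP; rewrite subr_eq0; apply/eqP.
under eq_bigr => w' _ do rewrite -linearZ.
rewrite comm; apply: eq_bigr => w' _.
by rewrite scalerA exprSr.
Qed.

Lemma es_dec H : (forall i j, es G (fun m => mpow H m i j)) -> dec H.
Proof.
move=> h v.
have [|W [u [_ hW _ eig ->]]] := @vs_eig H v.
  apply: (@vs_ext _ _ (fun m => \sum_j \sum_i mpow H m i j *: (v2r v 0 i *: r2v (delta_mx 0 j)))).
    move=> m; apply: (@v2r_inj K C).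
    rewrite /mx_act r2vK [RHS]row_sum_delta linear_sum; apply: eq_bigr => j _ /=.
    rewrite linear_sum mxE scaler_suml; apply: eq_bigr => i _ /=.
    by rewrite !linearZ /= r2vK scalerA mulrC.
  by do 2![apply: vs_sum => ?]; apply: es_vs.
exists [seq (w, u w) | w <- W]; split=> [x /mapP [w wW ->]|]; first by split; [exact: hW|exact: eig].
by rewrite big_map.
Qed.

(** If [w] were not among the exponents of [v], adjoining it with coefficient [- v] would give a
    vanishing exponential sum with a nonzero coefficient. *)
Lemma dec_weight H v w : dec H -> v != 0 -> mx_act H v = theta w *: v -> G w.
Proof.
move=> dH v0 ev; have [W [u [uW hW hF]]] := vs_uniq (dec_vs v dH).
case: (boolP (w \in W)) => [/hW //|wW]; case/eqP: v0.
have uW' : uniq (w :: W) by rewrite /= wW.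
rewrite -[v]opprK; apply/eqP; rewrite oppr_eq0; apply/eqP.
have := @vandermonde C (w :: W) (fun w' => if w' == w then - v else u w') uW' _ w (mem_head _ _).
rewrite eqxx; apply=> m; rewrite big_cons eqxx scalerN -(mpow_eig m ev) hF addrC.
apply/eqP; rewrite subr_eq0; apply/eqP; rewrite [LHS]big_seq [RHS]big_seq; apply: eq_bigr => w' w'W.
by case: eqP => // e; rewrite -e w'W in wW.
Qed.
End Dec.

(* [f (H^m) = f(H)^m] has exponential-sum entries, hence [f H] is diagonalizable
   with weights in the same group. *)
Lemma transfer_dec (C C' : falgType K) (G : M -> Prop) f (H : 'M[K]_(adim C)) :
  G 0 -> (forall x y, G x -> G y -> G (x + y)) -> (forall x, G x -> G (- x)) ->
  regular_on (@Aut0 K C) f -> (forall X, Aut0 X -> @Aut0 K C' (f X)) ->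
  (forall X Y, Aut0 X -> Aut0 Y -> f (X *m Y) = f X *m f Y) ->
  Aut0 H -> dec G H -> dec G (f H).
Proof.
move=> G0 GD GN [k [P hP]] fA fM aH dH.
have uH : H \in unitmx by case: (Aut0_AutMx aH).
have aHm m : Aut0 (mpow H m).
  by elim: m => [|m IH]; [exact: Aut01|exact: Aut0M].
have f1 := aut0_hom1 fA fM.
have fm m : f (mpow H m) = mpow (f H) m.
  by elim: m => [|m IH]; rewrite // /= fM // IH.
(* [f] has a power of [det] in its denominator. Its reciprocal is read off the powers of the inverse
   of [H], whence the closure of [G] under negation. *)
have dV : dec G (invmx H).
  move=> v; have [l [hl ->]] := dH v; exists [seq (- x.1, x.2) | x <- l].
  split=> [x /mapP [y /hl [g e] ->]|]; last by rewrite big_map.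
  split; first exact: GN.
  rewrite /= thetaN; have := congr1 (mx_act (invmx H)) e.
  rewrite -mx_actM mulmxV // mx_act1 linearZ => {2}->.
  by rewrite scalerA mulVf ?theta_neq0 // scale1r.
have mV m : mpow H m *m mpow (invmx H) m = 1%:M.
  elim: m => [|m IH]; first by rewrite mulmx1.
  by rewrite mpowSr /= mulmxA -(mulmxA (mpow H m)) mulmxV // mulmx1.
apply: es_dec => i j.
apply: (@es_ext _ (fun m => mx_eval (P i j) (mpow H m) * \det (mpow (invmx H) m) ^+ k)).
  move=> m; rewrite -fm hP //; congr (_ * _); rewrite -exprVn; congr (_ ^+ _).
  have := congr1 determinant (mV m); rewrite det_mulmx det1 => e.
  have d0 : \det (mpow H m) != 0 by apply: contra_eq_neq e => ->; rewrite mul0r eq_sym oner_eq0.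
  by apply: (mulfI d0); rewrite e mulfV.
apply: esM => //; last by apply/es_exp/es_det => // i' j'; exact: dec_es.
apply: es_eval => // i'.
have [[i1 j1] e] : exists x, i' = mxvec_index x.1 x.2.
  by case: (mxvec_indexP i') => i1 j1; exists (i1, j1).
apply: (@es_ext _ (fun m => mpow H m i1 j1)); first by move=> m; rewrite e mxvecE.
exact: dec_es.
Qed.
End Theta.

(** * Monomial algebras and their derivations *)

Section EvalA.
Variables (K : fieldType) (n : nat) (C : falgType K).
Hypothesis Cc : forall u v : C, u * v = v * u.
Implicit Types (x : 'I_n -> C) (p q : {mpoly K[n]}) (s : 'X_{1..n}).

Definition mon x s : C := mmap1 x s.

Lemma mon0 x : mon x 0%MM = 1.
Proof. exact: mmap11. Qed.
Lemma monD x s s' : mon x (s + s')%MM = mon x s * mon x s'.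
Proof. by apply: commr_mmap1_M => i u; apply: Cc. Qed.
Lemma monU x i : mon x U_(i)%MM = x i.
Proof. exact: mmap1U. Qed.

Lemma evalAE x p : evalA x p = \sum_(s <- msupp p) p@_s *: mon x s.
Proof. by apply: eq_bigr => s _; rewrite mulr_algl. Qed.

Lemma evalA_is_linear x : linear (evalA x).
Proof.
move=> c p q; change (mmap (in_alg C) x (c *: p + q) = c *: mmap (in_alg C) x p + mmap (in_alg C) x q).
by rewrite mmapD mmapZ mulr_algl.
Qed.
HB.instance Definition _ x := GRing.isLinear.Build K {mpoly K[n]} C *:%R (evalA x) (evalA_is_linear x).

Lemma evalAX x s : evalA x 'X_[s] = mon x s.
Proof. by change (mmap (in_alg C) x 'X_[s] = mon x s); rewrite mmapX. Qed.

Lemma evalA1 x : evalA x 1 = 1.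
Proof. by rewrite -mpolyX0 evalAX mon0. Qed.

Lemma evalAM x p q : evalA x (p * q) = evalA x p * evalA x q.
Proof.
rewrite [in LHS](mpolyE p) [in LHS](mpolyE q) big_distrlr linear_sum /=.
rewrite [in RHS](evalAE x p) [in RHS](evalAE x q) big_distrlr /=.
apply: eq_bigr => s _; rewrite linear_sum; apply: eq_bigr => s' _.
by rewrite -scalerAl -scalerAr !linearZ /= -mpolyXD evalAX monD -scalerAl -scalerAr.
Qed.

Lemma mon_le x s s' : mon x (s + s')%MM != 0 -> mon x s != 0.
Proof. by apply: contraNneq => e; rewrite monD e mul0r. Qed.
End EvalA.

Section MonoAlg.
Variables (K : fieldType) (n : nat).
Implicit Types (p q : {mpoly K[n]}) (s : 'X_{1..n}).

(** [mker] expresses that the nonzero monomials are linearly independent; [mgen] uses boolean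
    equality so that [xchoose] can pick a preimage. *)
Record mono_alg (C : falgType K) (x : 'I_n -> C) (S : seq 'X_{1..n}) : Prop := MonoAlg {
  mcomm : forall u v : C, u * v = v * u;
  mgen : forall c : C, exists p, evalA x p == c;
  mker : forall p, evalA x p = 0 -> forall s, s \in S -> p@_s = 0;
  mS : forall s, (s \in S) = (mon x s != 0);
  mstair : stair S }.

(** The point is finiteness of [S]: a nonzero monomial has nonzero divisors of every smaller degree,
    these are independent, and so its degree is bounded by the dimension. *)
Lemma mono_algI (C : falgType K) (x : 'I_n -> C) : (forall u v : C, u * v = v * u) ->
  (forall c : C, exists p, evalA x p = c) ->
  (forall p, evalA x p = 0 -> forall s, mon x s != 0 -> p@_s = 0) ->
  (forall i, x i != 0) -> exists S, mono_alg x S.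
Proof.
move=> Cc gen ker x0.
have chain s : mon x s != 0 -> exists L : seq 'X_{1..n},
    [/\ uniq L, size L = (mdeg s).+1 & forall t, t \in L -> mon x t != 0 /\ (mdeg t <= mdeg s)%N].
  elim/mnm_ind: s => [|s i IH] sn; first exists [:: 0%MM].
    by split=> [||t]; rewrite ?mdeg0 // inE => /eqP ->; rewrite mdeg0.
  have [L [uL sL hL]] := IH (mon_le Cc sn); rewrite mdegD mdeg1 addn1.
  exists ((s + U_(i))%MM :: L); split; rewrite /= ?sL //.
    by rewrite uL andbT; apply/negP => /hL [_]; rewrite mdegD mdeg1 addn1 ltnn.
  move=> t; rewrite inE => /orP [/eqP ->|/hL [h1 h2]]; last by split=> //; apply: leqW.
  by rewrite mdegD mdeg1 addn1.
have bound s : mon x s != 0 -> (mdeg s < (\dim {:C}).+1)%N.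
  move=> sn; have [L [uL sL hL]] := chain s sn.
  suff fL : free (map (mon x) L).
    have := dimvS (subvf <<map (mon x) L>>); rewrite (eqP fL) size_map sL.
    by move=> h; apply: leq_trans h _.
  apply/(@freeP _ _ _ (in_tuple (map (mon x) L))) => k e i.
  have szm : size (map (mon x) L) = size L by rewrite size_map.
  have iL : (i < size L)%N by rewrite -szm.
  pose p : {mpoly K[n]} := \sum_(j < size (map (mon x) L)) k j *: 'X_[nth 0%MM L j].
  have pe : evalA x p = 0.
    rewrite linear_sum -[RHS]e; apply: eq_bigr => j _; rewrite linearZ /= evalAX.
    by rewrite (nth_map 0%MM) // -szm.
  have := ker _ pe (nth 0%MM L i) (proj1 (hL _ (mem_nth _ iL))).
  rewrite raddf_sum (bigD1 i) //= mcoeffZ mcoeffX eqxx mulr1 big1 ?addr0 // => j ji.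
  have jL : (j < size L)%N by rewrite -szm.
  by rewrite mcoeffZ mcoeffX nth_uniq // (inj_eq val_inj) (negPf ji) mulr0.
pose S := [seq bmnm m | m <- enum {: 'X_{1..n < (\dim {:C}).+1}} & mon x (bmnm m) != 0].
have SP s : (s \in S) = (mon x s != 0).
  apply/mapP/idP => [[m]|sn]; first by rewrite mem_filter => /andP [? _] ->.
  by exists (BMultinom (bound s sn)); rewrite // mem_filter mem_enum andbT.
exists S; split=> //.
- by move=> c; have [p <-] := gen c; exists p.
- by move=> p pe s; rewrite SP; apply: ker.
split.
- rewrite map_inj_uniq; first by rewrite filter_uniq // enum_uniq.
  by move=> m1 m2 e; apply/eqP; rewrite bmeqP e.
- by rewrite SP mon0 oner_neq0.
- by move=> i; rewrite SP monU.
- by move=> s i; rewrite !SP => /(mon_le Cc).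
Qed.

Section Quot.
Variables (C : falgType K) (x : 'I_n -> C) (S : seq 'X_{1..n}).
Hypothesis mA : mono_alg x S.

Definition rep (c : C) : {mpoly K[n]} := xchoose (mgen mA c).
Lemma repK c : evalA x (rep c) = c.
Proof. exact/eqP/(xchooseP (mgen mA c)). Qed.

Lemma span_mon (V : lmodType K) (g h : C -> V) : linear g -> linear h ->
  (forall s, s \in S -> g (mon x s) = h (mon x s)) -> g =1 h.
Proof.
move=> lg lh e c; rewrite -(repK c) evalAE.
pose g' := HB.pack_for {linear C -> V} g (GRing.isLinear.Build K C V *:%R g lg).
pose h' := HB.pack_for {linear C -> V} h (GRing.isLinear.Build K C V *:%R h lh).
rewrite -[g _]/(g' _) -[h _]/(h' _) !linear_sum; apply: eq_bigr => s _.
rewrite !linearZ /=; case: (boolP (s \in S)) => [/e -> //|].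
by rewrite (mS mA) negbK => /eqP ->; congr (_ *: _); exact: (etrans (linear0 g') (esym (linear0 h'))).
Qed.
End Quot.

Section Hom.
Variables (C C' : falgType K) (x : 'I_n -> C) (S : seq 'X_{1..n}) (y : 'I_n -> C').
Hypotheses (mA : mono_alg x S) (Cc' : forall u v : C', u * v = v * u).
Hypothesis ker : forall s, s \notin S -> mon y s = 0.

Definition hom_of (c : C) : C' := evalA y (rep mA c).

(** Polynomials with equal values in [C] differ only at monomials outside [S], which [y] kills, so
    the choice made by [rep] is immaterial. *)
Lemma hom_ofE p : hom_of (evalA x p) = evalA y p.
Proof.
apply/eqP; rewrite -subr_eq0 /hom_of -linearB; apply/eqP => /=.
have /(mker mA) z : evalA x (rep mA (evalA x p) - p) = 0 by rewrite linearB /= repK subrr.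
rewrite (evalAE y) big1 // => s _.
by case: (boolP (s \in S)) => [/z ->|/ker ->]; rewrite ?scale0r ?scaler0.
Qed.

Lemma hom_of_linear : linear hom_of.
Proof.
by move=> c u v; rewrite -{1}(repK mA u) -{1}(repK mA v) -linearP hom_ofE linearP.
Qed.

Lemma hom_ofZ c v : hom_of (c *: v) = c *: hom_of v.
Proof. by rewrite -{1}(repK mA v) -linearZ hom_ofE linearZ. Qed.

Lemma hom_of_mon s : hom_of (mon x s) = mon y s.
Proof. by rewrite -!evalAX hom_ofE. Qed.

Lemma hom_of1 : hom_of 1 = 1.
Proof. by rewrite -(evalA1 x) hom_ofE evalA1. Qed.

Lemma hom_ofM u v : hom_of (u * v) = hom_of u * hom_of v.
Proof.
by rewrite -{1}(repK mA u) -{1}(repK mA v) -(evalAM (mcomm mA)) hom_ofE (evalAM Cc').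
Qed.
End Hom.
End MonoAlg.

Lemma mono_alg_iso (K : fieldType) n (C C' : falgType K) (x : 'I_n -> C) (x' : 'I_n -> C') S S' :
  mono_alg x S -> mono_alg x' S' -> S =i S' -> alg_iso C C'.
Proof.
move=> mA mA' eS.
have k1 s : s \notin S -> mon x' s = 0 by rewrite eS (mS mA') negbK => /eqP.
have k2 s : s \notin S' -> mon x s = 0 by rewrite -eS (mS mA) negbK => /eqP.
exists (hom_of x' mA); split.
- exists (hom_of x mA') => c; first by rewrite {2}/hom_of hom_ofE // repK.
  by rewrite {2}/hom_of hom_ofE // repK.
- exact: hom_of_linear.
- exact: hom_of1.
exact: hom_ofM (mcomm mA') k1.
Qed.

Lemma AutMx_of (K : fieldType) (C : falgType K) (g g' : C -> C) : linear g -> linear g' ->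
  cancel g g' -> g 1 = 1 -> (forall u v, g (u * v) = g u * g v) -> AutMx (mx_of g).
Proof.
move=> lg lg' gK g1 gM; split.
- have : mx_of g *m mx_of g' = 1%:M.
    by apply: mx_act_inj => v; rewrite mx_actM !mx_ofE // gK mx_act1.
  by case/mulmx1_unit.
- by rewrite mx_ofE.
- by move=> u v; rewrite !mx_ofE.
Qed.

(** * The automorphism with prime eigenvalues *)

Section Torus.
Variables (K : fieldType) (n : nat) (C : falgType K) (x : 'I_n -> C) (S : seq 'X_{1..n}).
Hypotheses (K0 : [pchar K] =i pred0) (mA : mono_alg x S).

Let dil (l : 'I_n -> K) i := l i *: x i.

Lemma mon_dil l s : mon (dil l) s = (\prod_i l i ^+ s i) *: mon x s.
Proof. by rewrite /mon /mmap1 -scaler_prod; apply: eq_bigr => i _; rewrite /dil exprZn. Qed.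

Lemma dil_ker l s : s \notin S -> mon (dil l) s = 0.
Proof. by rewrite (mS mA) negbK mon_dil => /eqP ->; rewrite scaler0. Qed.

Let hom l := hom_of (dil l) mA.
Let hom_lin l : linear (hom l) := hom_of_linear mA (@dil_ker l).

Lemma hom_mon l s : hom l (mon x s) = (\prod_i l i ^+ s i) *: mon x s.
Proof. by rewrite -mon_dil; apply: hom_of_mon (@dil_ker l) s. Qed.

Lemma hom_Aut l : (forall i, l i != 0) -> AutMx (mx_of (hom l)).
Proof.
move=> l0; apply: (@AutMx_of _ _ _ (hom (fun i => (l i)^-1))).
- exact: hom_lin.
- exact: hom_lin.
- apply: (span_mon mA) => [||s _].
  + by move=> c u v /=; rewrite !hom_lin.
  + by [].
  rewrite hom_mon /hom hom_ofZ; last exact: dil_ker.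
  rewrite -/(hom _) hom_mon scalerA -big_split /=.
  by rewrite big1 ?scale1r // => i _; rewrite -exprMn mulfV // expr1n.
- exact: hom_of1 (@dil_ker l).
- exact: hom_ofM (mcomm mA) (@dil_ker l).
Qed.

Lemma torus : exists g, Aut0 g /\ forall i, mx_act g (x i) = theta K (delta_mx 0 i) *: x i.
Proof.
(* A line from 1 at [t = 0] to [pr i] at [t = 1]; it joins the identity to the required element,
   through automorphisms wherever the product [q] is nonzero. *)
pose l (i : 'I_n) : {poly K} := 1 + 'X * ((pr i)%:R - 1)%:P.
pose E : 'M[{poly K}]_(adim C) := \matrix_(i, j)
  let p := rep mA (@r2v K C (delta_mx 0 i)) in
  \sum_(s <- msupp p) (p@_s * @v2r K C (mon x s) 0 j)%:P * \prod_k l k ^+ s k.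
have hE t : crv E t = mx_of (hom (fun i => (l i).[t])).
  apply/matrixP => i j; rewrite !mxE /horner_eval /hom /hom_of evalAE.
  rewrite horner_sum linear_sum summxE; apply: eq_bigr => s _.
  rewrite mon_dil !linearZ /= !mxE hornerM hornerC horner_prod mulrAC -mulrA; congr (_ * _).
  by congr (_ * _); apply: eq_bigr => k _; rewrite horner_exp.
have l0 i : (l i).[0] = 1 by rewrite /l !hornerE.
have l1 i : (l i).[1] = (pr i)%:R by rewrite /l hornerD hornerM hornerX !hornerC mul1r addrC subrK.
pose q := \prod_i l i.
have q0 : q.[0] != 0 by rewrite horner_prod big1 ?oner_eq0.
have q1 : q.[1] != 0.
  by rewrite horner_prod; apply/prodf_neq0 => i _; rewrite l1 pr_neq0.
have hx i t : mx_act (crv E t) (x i) = (l i).[t] *: x i.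
  rewrite hE mx_ofE; last exact: hom_lin.
  rewrite -(monU x i) hom_mon (bigD1 i) //= mnm1E eqxx expr1 big1 ?mulr1 //.
  by move=> j ji; rewrite mnm1E eq_sym (negPf ji).
have A0 : Aut0 (crv E 1).
  apply: (Aut0_crv K0 q0) => //.
    apply: mx_act_inj => v; rewrite hE mx_ofE; last exact: hom_lin.
    rewrite mx_act1; move: v; apply: (span_mon mA) => // s _.
    by rewrite hom_mon big1 ?scale1r // => i _; rewrite l0 expr1n.
  move=> t qt; rewrite hE; apply: hom_Aut => i.
  by move: qt; rewrite horner_prod => /prodf_neq0 /(_ i isT).
exists (crv E 1); split=> // i; rewrite hx l1 /theta (bigD1 i) //= mxE !eqxx expr1z.
rewrite big1 ?mulr1 // => j ji.
by rewrite mxE eqxx (negPf ji) expr0z.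
Qed.
End Torus.

(** * Curves of automorphisms and their linear terms *)

Section Scl.
Variable R : comNzRingType.
Definition scl (c : R) (p : {poly R}) := \poly_(k < size p) (c ^+ k * p`_k).
Lemma scl_horner c p t : (scl c p).[t] = p.[c * t].
Proof.
rewrite horner_poly horner_coef; apply: eq_bigr => k _.
by rewrite exprMn mulrA (mulrC (c ^+ k)).
Qed.
Lemma coef_scl c p k : (scl c p)`_k = c ^+ k * p`_k.
Proof. by rewrite coef_poly; case: ltnP => // h; rewrite nth_default // mulr0. Qed.
End Scl.

Section VPoly.
Variables (K : fieldType) (C : falgType K).
Hypotheses (K0 : [pchar K] =i pred0).
Local Notation v2r := (@v2r K C).
Local Notation r2v := (@r2v K C).
Implicit Types (p q : {poly C}) (t : K) (E : 'M[{poly K}]_(adim C)).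

Lemma hornerA p t : p.[t%:A] = \sum_(k < size p) t ^+ k *: p`_k.
Proof.
rewrite horner_coef; apply: eq_bigr => k _.
by rewrite exprZn expr1n -scalerAr mulr1.
Qed.

(** The type of [C] does not provide commutativity, but the scalars [t%:A] are central. *)
Lemma hornerAM p q t : (p * q).[t%:A] = p.[t%:A] * q.[t%:A].
Proof.
apply: hornerM_comm; rewrite /comm_poly hornerA mulr_sumr mulr_suml.
by apply: eq_bigr => k _; rewrite mulr_algl -[in RHS](scale1r (_ *: _)) -scalerAr mulr1 scale1r.
Qed.

Definition coordp j p : {poly K} := \poly_(k < size p) v2r p`_k 0 j.

Lemma coordp_horner j p t : (coordp j p).[t] = v2r p.[t%:A] 0 j.
Proof.
rewrite horner_poly hornerA linear_sum summxE; apply: eq_bigr => k _.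
by rewrite linearZ mxE mulrC.
Qed.
Lemma coef_coordp j p k : (coordp j p)`_k = v2r p`_k 0 j.
Proof. by rewrite coef_poly; case: ltnP => // h; rewrite nth_default // linear0 mxE. Qed.

Lemma vp_inj p q : (forall t, p.[t%:A] = q.[t%:A]) -> p = q.
Proof.
move=> h; apply/polyP => k; apply: v2r_inj; apply/rowP => j.
rewrite -!coef_coordp; suff -> : coordp j p = coordp j q by [].
by apply: (poly_inj K0) => t; rewrite !coordp_horner h.
Qed.

Definition lin E : 'M[K]_(adim C) := map_mx (coefp 1) E.

Lemma crv_vp E v : exists2 q : {poly C}, forall t, mx_act (crv E t) v = q.[t%:A] & q`_1 = mx_act (lin E) v.
Proof.
pose N := (\sum_i \sum_j size (E i j)).+2.
have sE i j : (size (E i j) <= N)%N.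
  rewrite /N (bigD1 i) //= (bigD1 j) //=; apply: leq_trans (leq_addr _ _) _.
  by rewrite -!addnA leqW // leqW // -addnA leq_addr.
pose Ek k : 'M[K]_(adim C) := map_mx (coefp k) E.
exists (\poly_(k < N) mx_act (Ek k) v) => [t|]; last by rewrite coef_poly.
have -> : (\poly_(k < N) mx_act (Ek k) v).[t%:A] = \sum_(k < N) t ^+ k *: mx_act (Ek k) v.
  rewrite horner_poly; apply: eq_bigr => k _.
  by rewrite exprZn expr1n -scalerAr mulr1.
have -> : crv E t = \sum_(k < N) t ^+ k *: Ek k.
  apply/matrixP => i j; rewrite summxE mxE /horner_eval (horner_coef_wide _ (sE i j)).
  by apply: eq_bigr => k _; rewrite !mxE mulrC.
exact: mx_act_sum.
Qed.

Definition mder (X : 'M[K]_(adim C)) := forall u v, mx_act X (u * v) = mx_act X u * v + u * mx_act X v.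

(** Multiplicativity of all [crv E t] is an equality of polynomials over [C]; the Leibniz rule is
    its coefficient of degree 1. *)
Lemma lin_der E : crv E 0 = 1%:M -> (forall t, AutMx (crv E t)) -> mder (lin E).
Proof.
move=> E0 aE u v; have [p hp hp1] := crv_vp E u; have [q hq hq1] := crv_vp E v.
have [r hr hr1] := crv_vp E (u * v).
have p0 : p`_0 = u by rewrite -horner_coef0 -(scale0r (1 : C)) -hp E0 mx_act1.
have q0 : q`_0 = v by rewrite -horner_coef0 -(scale0r (1 : C)) -hq E0 mx_act1.
have e : r = p * q.
  by apply: vp_inj => t; rewrite hornerAM -hp -hq -hr; case: (aE t).
by rewrite -hr1 e coefM !big_ord_recl big_ord0 /= /bump /= addr0 p0 q0 hp1 hq1 addrC.
Qed.

Variable n : nat.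
Local Notation M := 'rV[int]_n.
Local Notation theta := (@theta K n).

(* A curve through the identity on which conjugation by [H] acts as [t -> theta a * t]. *)
Definition crvW (a : M) (H : 'M[K]_(adim C)) E := [/\ crv E 0 = 1%:M, forall t, Aut0 (crv E t) &
  forall t, crv E t *m H = H *m crv E (theta a * t)].

Lemma theta_exp (a : M) k : theta a ^+ k = theta (a *+ k).
Proof. by elim: k => [|k IH]; rewrite ?expr0 ?mulr0n ?theta0 // exprS IH mulrS thetaD. Qed.

Lemma theta_exp_neq1 (a : M) k : a != 0 -> theta a ^+ k.+1 != 1.
Proof.
move=> a0; rewrite theta_exp; apply: contra a0 => /eqP /(theta_eq1 K0) /rowP h.
by apply/eqP/rowP => i; have := h i; rewrite mulmxnE !mxE => /eqP; rewrite mulrn_eq0 /= => /eqP.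
Qed.

(* [det E_t] is a polynomial invariant under [t -> theta a * t], and [theta a] is not a
   root of unity. *)
Lemma det_crvW a H E : a != 0 -> H \in unitmx -> crv E 0 = 1%:M ->
  (forall t, crv E t *m H = H *m crv E (theta a * t)) -> forall t, \det (crv E t) = 1.
Proof.
move=> a0 uH E0 EH t.
have dE s : \det (crv E s) = (\det E).[s] by rewrite det_map_mx.
have e : scl (theta a) (\det E) = \det E.
  apply: (poly_inj K0) => s; rewrite scl_horner -!dE.
  have := congr1 determinant (EH s); rewrite !det_mulmx mulrC => /mulfI -> //.
  by rewrite -unitfE -unitmxE.
have -> : \det (crv E t) = (((\det E)`_0)%:P).[t].
  rewrite dE; congr horner; apply/polyP => -[|k]; rewrite coefC //=.
  have := coef_scl (theta a) (\det E) k.+1; rewrite e => /eqP.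
  rewrite -subr_eq0 -{1}[_`__]mul1r -mulrBl mulf_eq0 subr_eq0 eq_sym.
  by rewrite (negPf (theta_exp_neq1 k a0)) /= => /eqP.
by rewrite hornerC -horner_coef0 -dE E0 det1.
Qed.

Lemma lin_weight a H E v : crvW a H E ->
  mx_act H (mx_act (lin E) v) = theta a *: mx_act (lin E) (mx_act H v).
Proof.
move=> [_ _ EH]; rewrite -mx_actM -mx_actM -mx_actZl; congr mx_act.
apply/matrixP => i j; rewrite !mxE.
pose p := \sum_k E i k * (H k j)%:P; pose q := \sum_k (H i k)%:P * scl (theta a) (E k j).
have e : p = q.
  apply: (poly_inj K0) => t; have /matrixP /(_ i j) := EH t; rewrite !mxE !horner_sum => h.
  transitivity (\sum_k crv E t i k * H k j); first by apply: eq_bigr => k _; rewrite !mxE hornerM hornerC.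
  by rewrite h; apply: eq_bigr => k _; rewrite !mxE hornerM hornerC scl_horner.
transitivity p`_1; first by rewrite coef_sum; apply: eq_bigr => k _; rewrite !mxE coefMC.
rewrite e coef_sum mulr_sumr; apply: eq_bigr => k _.
by rewrite !mxE coefCM coef_scl expr1 mulrCA.
Qed.
End VPoly.

(** The determinant is 1 along the curve, so the denominators of [f] disappear and the image has
    polynomial entries. [L] is the differential of [f] at the identity, built from [mpoly_jet], and
    does not depend on the curve. *)
Lemma crv_transfer (K : fieldType) (K0 : [pchar K] =i pred0) n (C C' : falgType K) f :
  regular_on (@Aut0 K C) f -> (forall X, Aut0 X -> @Aut0 K C' (f X)) ->
  (forall X Y, Aut0 X -> Aut0 Y -> f (X *m Y) = f X *m f Y) ->
  exists L : {linear 'M[K]_(adim C) -> 'M[K]_(adim C')}, forall (a : 'rV[int]_n) H E, a != 0 -> Aut0 H ->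
    crvW a H E -> exists E', [/\ crvW a (f H) E', forall t, f (crv E t) = crv E' t & lin E' = L (lin E)].
Proof.
move=> [k [P hP]] fA fM.
have [c hc] := fin_all_exists (fun ij => mpoly_jet (fun l => mxvec (1%:M : 'M[K]_(adim C)) 0 l) (P ij.1 ij.2)).
pose L (X : 'M[K]_(adim C)) : 'M[K]_(adim C') := \matrix_(i, j) \sum_l mxvec X 0 l * c (i, j) l.
have lL : linear L.
  move=> b X Y; apply/matrixP => i j; rewrite !mxE mulr_sumr -big_split; apply: eq_bigr => l _ /=.
  by rewrite linearP !mxE mulrDl mulrA.
pose L' := HB.pack_for {linear 'M[K]_(adim C) -> 'M[K]_(adim C')} L (GRing.isLinear.Build K _ _ *:%R L lL).
exists L' => a H E a0 aH [E0 aE EH].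
have uH : H \in unitmx by case: (Aut0_AutMx aH).
have dE := det_crvW K0 a0 uH E0 EH.
have f1 := aut0_hom1 fA fM.
have e0 l : (mxvec E 0 l)`_0 = mxvec (1%:M : 'M[K]_(adim C)) 0 l.
  by rewrite -E0 -map_mxvec mxE -horner_coef0.
have [u hu] := fin_all_exists (fun ij => hc ij (fun l => mxvec E 0 l) e0).
pose E' : 'M[{poly K}]_(adim C') := \matrix_(i, j) u (i, j).
have fE t : f (crv E t) = crv E' t.
  apply/matrixP => i j; rewrite hP // dE expr1n divr1 !mxE.
  have [h _ _] := hu (i, j); rewrite /horner_eval -h; apply: meval_eq => l.
  by rewrite -map_mxvec mxE.
exists E'; split=> //.
  split; first by rewrite -fE E0.
    by move=> t; rewrite -fE; apply: fA.
  by move=> t; rewrite -!fE -!fM // EH.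
apply/matrixP => i j; rewrite !mxE /=; have [_ _ ->] := hu (i, j).
by apply: eq_bigr => l _; rewrite /lin -map_mxvec mxE.
Qed.

Lemma aut_mon (K : fieldType) n (C : falgType K) (H : 'M[K]_(adim C)) (y : 'I_n -> C) (w : 'I_n -> 'rV[int]_n) :
  [pchar K] =i pred0 -> (forall u v : C, u * v = v * u) -> AutMx H ->
  (forall i, mx_act H (y i) = theta K (w i) *: y i) ->
  forall t, mx_act H (mon y t) = theta K (ev w t) *: mon y t.
Proof.
move=> K0 Cc [_ H1 HM] hy; elim/mnm_ind => [|t j e]; first by rewrite mon0 ev0 theta0 scale1r.
by rewrite monD // HM e monU hy evD evU thetaD // -scalerAl -scalerAr scalerA.
Qed.

Section Weighted.
Variables (K : fieldType) (n : nat).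
Hypothesis K0 : [pchar K] =i pred0.
Local Notation M := 'rV[int]_n.
Local Notation theta := (@theta K n).

Record weighted (C : falgType K) (x : 'I_n -> C) S (H : 'M[K]_(adim C)) (F : frame n M) : Prop := Weighted {
  wmono : mono_alg x S;
  wreal : realizes F S;
  wAut : Aut0 H;
  wE : forall i, mx_act H (x i) = theta (vec F i) *: x i }.

Section One.
Variables (C : falgType K) (x : 'I_n -> C) (S : seq 'X_{1..n}) (H : 'M[K]_(adim C)) (F : frame n M).
Hypothesis W : weighted x S H F.
Let mA := wmono W.
Let Cc := mcomm mA.

Lemma mult_monE (g : C -> C) : (forall u v, g (u * v) = g u * g v) -> g 1 = 1 ->
  forall s, g (mon x s) = mon (g \o x) s.
Proof.
move=> gM g1; apply: mnm_ind => [|s j e]; first by rewrite !mon0.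
by rewrite !monD // !monU gM e.
Qed.

Lemma hom_ext (g h : C -> C) : linear g -> linear h -> (forall u v, g (u * v) = g u * g v) ->
  (forall u v, h (u * v) = h u * h v) -> g 1 = 1 -> h 1 = 1 -> (forall i, g (x i) = h (x i)) -> g =1 h.
Proof.
move=> lg lh gM hM g1 h1 e; apply: (span_mon mA) => // s _.
by rewrite !mult_monE //; apply: mmap1_eq => i; exact: e.
Qed.

Lemma H_mon s : mx_act H (mon x s) = theta (ev (vec F) s) *: mon x s.
Proof. by apply: (aut_mon K0 Cc (Aut0_AutMx (wAut W))); exact: (wE W). Qed.

Section Curve.
Variables (i : 'I_n) (s : 'X_{1..n}).
Hypothesis xs : xAA S i s.

Let sS : s \in S. Proof. by case/andP: xs. Qed.

Lemma xAA_mon v : mon x (v + U_(i))%MM = 0 -> mon x (v + s)%MM = 0.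
Proof.
move=> v0; apply/eqP; rewrite -[_ == _]negbK -(mS mA); apply/negP => vs.
have vS : v \in S by move: vs; rewrite !(mS mA); exact: mon_le.
case/andP: xs => _ /allP /(_ v vS); rewrite vs /= (mS mA) v0 eqxx //.
Qed.

Let y t j := if j == i then x i + t *: mon x s else x j.

(** In the expansion each factor [x_i] may be replaced by [x^s]: by [xAA_mon] a product that
    vanishes continues to vanish. *)
Lemma y_pow t k r : mon x (r + U_(i) *+ k)%MM = 0 -> mon x r * (y t i) ^+ k = 0.
Proof.
elim: k r => [|k IH] r; first by rewrite mulm0n addm0 expr0 mulr1.
have -> : (r + U_(i) *+ k.+1 = (r + U_(i) *+ k) + U_(i))%MM.
  by apply/mnmP => j; rewrite !mnmDE !mulmnE; lia.
move=> h; rewrite exprS {1}/y eqxx mulrA mulrDr -scalerAr mulrDl -scalerAl -{1}(monU x i) -!monD //.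
rewrite !IH ?scaler0 ?addr0 //.
  have -> : (r + s + U_(i) *+ k = (r + U_(i) *+ k) + s)%MM by rewrite -!addmA (addmC s).
  exact: xAA_mon.
have -> : (r + U_(i) + U_(i) *+ k = (r + U_(i) *+ k) + U_(i))%MM by rewrite -!addmA (addmC U_(i)%MM).
exact: h.
Qed.

Lemma y_ker t v : v \notin S -> mon (y t) v = 0.
Proof.
rewrite (mS mA) negbK => /eqP v0.
pose r := [multinom (if j == i then 0 else v j)%N | j < n].
have er : v = (r + U_(i) *+ v i)%MM.
  apply/mnmP => j; rewrite mnmDE mulmnE mnm1E mnmE eq_sym; case: eqP => [->|_]; lia.
suff -> : mon (y t) v = mon x r * (y t i) ^+ v i by apply: y_pow; rewrite -er.
rewrite {1}er monD //; congr (_ * _).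
  rewrite /mon /mmap1; apply: eq_bigr => j _; rewrite mnmE /y.
  by case: eqP => // _; rewrite !expr0.
elim: (v i) => [|k IH]; first by rewrite mulm0n mon0.
by rewrite mulmS monD // IH monU exprS.
Qed.

Let hom t := hom_of (y t) mA.
Let hlin t : linear (hom t) := hom_of_linear mA (@y_ker t).
Let h1 t : hom t 1 = 1 := hom_of1 mA (@y_ker t).
Let hM t u v : hom t (u * v) = hom t u * hom t v := hom_ofM mA Cc (@y_ker t) u v.
Let hZ t b v : hom t (b *: v) = b *: hom t v := hom_ofZ mA (@y_ker t) b v.
Let hx t j : hom t (x j) = y t j.
Proof. by rewrite -(monU x j) /hom (hom_of_mon _ (@y_ker t)) monU. Qed.

(* The family [x_i -> x_i + t x^s] is not a one-parameter group, but it is polynomial in [t],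
   consists of automorphisms, and has the derivation [x_i -> x^s] as linear term. *)
Lemma curve_of : ev (vec F) s - vec F i != 0 -> exists E, crvW (ev (vec F) s - vec F i) H E /\
  forall j, mx_act (lin E) (x j) = if j == i then mon x s else 0.
Proof.
set a := _ - _ => a0.
pose Y j : {poly C} := if j == i then (x i)%:P + 'X * (mon x s)%:P else (x j)%:P.
have XA t : ('X : {poly C}).[t%:A] = t%:A by rewrite hornerX.
have Yh j t : (Y j).[t%:A] = y t j.
  rewrite /Y /y; case: eqP => _; last by rewrite hornerC.
  by rewrite hornerD hornerAM hornerX !hornerC mulr_algl.
have Yv v : exists q : {poly C}, forall t, mon (y t) v = q.[t%:A].
  elim/mnm_ind: v => [|v j [q hq]]; first by exists 1 => t; rewrite mon0 hornerC.
  by exists (q * Y j) => t; rewrite monD // monU hq hornerAM Yh.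
have Yp p : exists q : {poly C}, forall t, evalA (y t) p = q.[t%:A].
  pose Q (p : {mpoly K[n]}) := exists q : {poly C}, forall t, evalA (y t) p = q.[t%:A].
  rewrite -/(Q p) (mpolyE p); apply: (big_ind Q).
  - by exists 0 => t; rewrite linear0 horner0.
  - by move=> p1 p2 [q1 e1] [q2 e2]; exists (q1 + q2) => t; rewrite linearD /= hornerD e1 e2.
  move=> v _; have [q hq] := Yv v; exists ((p@_v)%:A%:P * q) => t.
  by rewrite linearZ /= evalAX hornerAM hornerC mulr_algl hq.
have [u hu] := fin_all_exists (fun k : 'I_(adim C) => Yp (rep mA (@r2v K C (delta_mx 0 k)))).
pose E : 'M[{poly K}]_(adim C) := \matrix_(k, j) coordp j (u k).
have crvE t : crv E t = mx_of (hom t).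
  by apply/matrixP => k j; rewrite !mxE /horner_eval coordp_horner -hu.
have EA t v : mx_act (crv E t) v = hom t v by rewrite crvE mx_ofE.
have [uH H1 HM] := Aut0_AutMx (wAut W).
have EH t : crv E t *m H = H *m crv E (theta a * t).
  apply: mx_act_inj => v; rewrite !mx_actM !EA; move: v; apply: hom_ext.
  - by move=> c u1 u2 /=; rewrite hlin linearP.
  - by move=> c u1 u2 /=; rewrite linearP hlin.
  - by move=> u1 u2; rewrite hM HM.
  - by move=> u1 u2; rewrite HM hM.
  - by rewrite h1 H1.
  - by rewrite H1 h1.
  move=> j; rewrite hx (wE W) hZ hx /y; case: eqP => [->|_]; last by rewrite (wE W).
  rewrite linearD linearZ /= H_mon (wE W) scalerDr !scalerA; congr (_ + _ *: _).
  by rewrite mulrA -thetaD // /a addrC subrK mulrC.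
have E0 : crv E 0 = 1%:M.
  apply: mx_act_inj => v; rewrite EA mx_act1; move: v; apply: hom_ext => //.
  by move=> j; rewrite hx /y scale0r addr0; case: eqP => [->|].
exists E; split.
  split=> // t; apply: (@Aut0_crv _ K0 _ E 1 0) => //; rewrite ?hornerC ?oner_neq0 // => {}t _.
  split; last 2 first.
  - by rewrite EA.
  - by move=> u1 u2; rewrite !EA.
  by rewrite unitmxE (det_crvW K0 a0 uH E0 EH) unitr1.
move=> j; have [q hq <-] := crv_vp E (x j).
have -> : q = Y j by apply: (vp_inj K0) => t; rewrite -hq EA hx Yh.
rewrite /Y; case: eqP => _; last by rewrite coefC.
by rewrite coefD coefC add0r coefXM coefC.
Qed.
End Curve.

Lemma mder1 (D : 'M[K]_(adim C)) : mder D -> mx_act D 1 = 0.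
Proof. by move=> /(_ 1 1) /eqP; rewrite !mulr1 mul1r -subr_eq subrr eq_sym => /eqP. Qed.

(** This is [D x^v = v_k x^(v - e_k) D x_k], multiplied by [x_k] to avoid lowering an exponent. *)
Lemma mder_mon (D : 'M[K]_(adim C)) k : mder D -> (forall j, j != k -> mx_act D (x j) = 0) ->
  forall v, mx_act D (mon x v) * x k = (v k)%:R *: (mon x v * mx_act D (x k)).
Proof.
move=> dD hj; elim/mnm_ind => [|v j e]; first by rewrite mon0 mder1 // mul0r mnm0E scale0r.
rewrite monD // monU dD mulrDl -mulrA (Cc (x j)) mulrA e mnmDE mnm1E.
rewrite natrD scalerDl -scalerAl -!mulrA (Cc _ (x j)); congr (_ + _).
case: eqP => [->|/eqP jk] /=; first by rewrite scale1r (Cc (x k)).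
by rewrite hj // mul0r mulr0 scale0r.
Qed.

(** Distinct monomials have distinct weights, so a nonzero weight space is the line of one
    monomial. *)
Lemma eig_mon c b : mx_act H c = theta b *: c -> c != 0 ->
  exists2 s, s \in S & ev (vec F) s = b /\ exists d, c = d *: mon x s.
Proof.
move=> hc c0; pose p := rep mA c.
have Hp : evalA x (\sum_(s <- msupp p) ((theta (ev (vec F) s) - theta b) * p@_s) *: 'X_[s]) = 0.
  rewrite linear_sum; transitivity (mx_act H c - theta b *: c); last by rewrite hc subrr.
  rewrite -[in RHS](repK mA c) -/p evalAE linear_sum scaler_sumr -sumrB; apply: eq_bigr => s _.
  by rewrite linearZ /= evalAX [mx_act _ _]linearZ /= H_mon 2!scalerA -scalerBl mulrBl (mulrC p@_s).
have z r : ev (vec F) r != b -> p@_r *: mon x r = 0.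
  move=> rb; have [rS|] := boolP (r \in S); last first.
    by rewrite (mS mA) negbK => /eqP ->; rewrite scaler0.
  suff -> : p@_r = 0 by rewrite scale0r.
  have [rp|] := boolP (r \in msupp p); last by rewrite mcoeff_msupp negbK => /eqP.
  have := mker mA Hp rS; rewrite raddf_sum (bigD1_seq r) ?msupp_uniq //= mcoeffZ mcoeffX eqxx mulr1.
  rewrite big1 ?addr0 => [|r' /negPf rr']; last by rewrite mcoeffZ mcoeffX rr' mulr0.
  by move/eqP; rewrite mulf_eq0 subr_eq0 => /orP [/eqP /(theta_inj K0) e|/eqP //]; rewrite e eqxx in rb.
have ec : c = \sum_(s <- msupp p) p@_s *: mon x s by rewrite -evalAE repK.
have [/hasP [s sS /eqP es]|none] := boolP (has (fun s => ev (vec F) s == b) S).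
  exists s => //; split=> //; exists p@_s; rewrite {1}ec.
  have z' r : r != s -> p@_r *: mon x r = 0.
    by move=> rs; apply: z; rewrite -es (inj_eq (@ev_inj _ _ F)).
  have [sp|] := boolP (s \in msupp p).
    by rewrite (bigD1_seq s) ?msupp_uniq //= big1 ?addr0.
  rewrite mcoeff_msupp negbK => /eqP ps; rewrite ps scale0r big1 // => r _.
  by have [->|/z' //] := eqVneq r s; rewrite ps scale0r.
case/negP: c0; rewrite ec big1 // => r _; have [rS|] := boolP (r \in S).
  by apply: z; apply: contraNneq none => e; apply/hasP; exists r; rewrite // e.
by rewrite (mS mA) negbK => /eqP ->; rewrite scaler0.
Qed.

(* A weight-[a] derivation sends [x_k] to a multiple of the monomial of weight [a + w_k],
   which must then annihilate the annihilator of [x_k]. *)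
Lemma mder_coord (D : 'M[K]_(adim C)) a : mder D ->
  (forall v, mx_act H (mx_act D v) = theta a *: mx_act D (mx_act H v)) ->
  forall k, mx_act D (x k) != 0 -> exists s, [/\ a + vec F k = ev (vec F) s, xAA S k s &
    exists d, mx_act D (x k) = d *: mon x s].
Proof.
move=> dD wD.
have eig k : mx_act D (x k) != 0 -> exists2 s, s \in S & ev (vec F) s = a + vec F k /\ exists d, mx_act D (x k) = d *: mon x s.
  by apply: eig_mon; rewrite wD (wE W) linearZ /= scalerA thetaD.
move=> k Dk; have [s sS [es [d ed]]] := eig k Dk.
exists s; split=> //; last by exists d.
have d0 : d != 0 by apply: contraNneq Dk => d0; rewrite ed d0 scale0r.
rewrite /xAA sS; apply/allP => v vS; apply/implyP; rewrite !(mS mA) => vs.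
have [sk|sk] := posnP (s k); last first.
  apply: (@mon_le _ _ _ Cc x _ (s - U_(k))%MM).
  suff -> : (v + U_(k) + (s - U_(k)) = v + s)%MM by [].
  by apply/mnmP => j; rewrite !mnmDE mnmBE mnm1E; case: eqP => [<-|]; lia.
(* Here [a] has [k]-coordinate -1, so a nonzero image of another variable would be a monomial with a
   negative exponent. *)
have hj j : j != k -> mx_act D (x j) = 0.
  move=> jk; apply/eqP; apply: contraT => /eig [r _ [er _]].
  have := congr1 (crd F k) er; have := congr1 (crd F k) es.
  rewrite !crdD !crd_ev !crd_vec eqxx sk [k == j]eq_sym (negPf jk); lia.
(* Applying [D] to [x^v x_k = 0] and multiplying out gives [(v_k + 1) d x^(v + s) = 0], where
   [v_k + 1] is nonzero in characteristic 0. *)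
apply: contraNneq vs => v0.
have := congr1 (mx_act D) v0; rewrite linear0 monD // monU dD mder_mon // ed.
rewrite -[X in _ + X]scale1r -scalerDl -scalerAr scalerA -monD // => /eqP.
have nz : (v k)%:R + 1 != 0 :> K by rewrite natr1 natr_eq0.
by rewrite scaler_eq0 mulf_eq0 (negPf d0) (negPf nz).
Qed.

Lemma mder_eq0 (D : 'M[K]_(adim C)) : mder D -> (forall k, mx_act D (x k) = 0) -> forall v, mx_act D v = 0.
Proof.
move=> dD h; apply: (span_mon mA) => [||s _]; first exact: mx_act_is_linear.
  by move=> c u v; rewrite scaler0 addr0.
elim/mnm_ind: s => [|s j e]; first by rewrite mon0 mder1.
by rewrite monD // monU dD e h mul0r mulr0 addr0.
Qed.
End One.
End Weighted.

(** * Comparison of multiplicities under the group isomorphism *)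

Section MultLe.
Variables (K : fieldType) (n : nat).
Hypothesis K0 : [pchar K] =i pred0.
Variables (C C' : falgType K) (x : 'I_n -> C) (x' : 'I_n -> C').
Variables (S S' : seq 'X_{1..n}) (H : 'M[K]_(adim C)) (H' : 'M[K]_(adim C')) (F F' : frame n 'rV[int]_n).
Hypotheses (W : weighted x S H F) (W' : weighted x' S' H' F').
Variables (f : 'M[K]_(adim C) -> 'M[K]_(adim C')) (g : 'M[K]_(adim C') -> 'M[K]_(adim C)).
Hypotheses (rf : regular_on (@Aut0 K C) f) (rg : regular_on (@Aut0 K C') g).
Hypotheses (fA : forall X, Aut0 X -> Aut0 (f X)) (gA : forall X, Aut0 X -> Aut0 (g X)).
Hypotheses (fM : forall X Y, Aut0 X -> Aut0 Y -> f (X *m Y) = f X *m f Y).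
Hypotheses (gM : forall X Y, Aut0 X -> Aut0 Y -> g (X *m Y) = g X *m g Y).
Hypotheses (gf : forall X, Aut0 X -> g (f X) = X) (fH : f H = H').

Lemma AA_mon (G : frame n 'rV[int]_n) T i a : stair T -> realizes G T ->
  AA G i (a + vec G i) -> exists2 s, xAA T i s & a + vec G i = ev (vec G) s.
Proof.
move=> sT rT aa; have aS : a + vec G i \in st G by case/andP: aa.
have e := ev_mn (fun k => st_ge0 k aS).
by eexists; last exact: e; rewrite (xAA_ev sT rT) -e.
Qed.

(** The derivations [X r] of weight [a] are carried one at a time to [X' r], whose coefficients on
    the generators are the rows of [Bm]. A relation between rows makes a combination [Y] of the
    [X' r] zero. [Y] need not come from a curve, but the linear map [Lg] takes it to the same
    combination of the [X r], which are independent. *)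
Lemma mult_le a : a != 0 -> (mult F a <= mult F' a)%N.
Proof.
move=> a0; rewrite /mult; set I := [set i | _]; set I' := [set i | _].
have [Lf hf] := crv_transfer K0 n rf fA fM; have [Lg hg] := crv_transfer K0 n rg gA gM.
have mA := wmono W; have mA' := wmono W'.
have key (r : 'I_#|I|) : exists s (X : 'M_(adim C)) (X' : 'M_(adim C')), [/\ s \in S,
    forall j, mx_act X (x j) = if j == enum_val r then mon x s else 0, X = Lg X', mder X' &
    forall v, mx_act H' (mx_act X' v) = theta K a *: mx_act X' (mx_act H' v)].
  have := enum_valP r; rewrite inE => /(AA_mon (mstair mA) (wreal W)) [s xs es].
  have ea : ev (vec F) s - vec F (enum_val r) = a by rewrite -es addrK.
  have [|E] := curve_of K0 W xs; rewrite ea // => -[cE lE].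
  have [E' [cE' eE' _]] := hf a H E a0 (wAut W) cE; rewrite fH in cE'.
  have [E'' [cE'' eE'' lE'']] := hg a H' E' a0 (wAut W') cE'.
  have EE : E'' = E.
    apply/matrixP => i j; apply: (poly_inj K0) => t.
    have : crv E'' t = crv E t by case: cE => _ aE _; rewrite -eE'' -eE' gf.
    by move/matrixP/(_ i j); rewrite !mxE.
  exists s, (lin E), (lin E'); split=> //.
  - by case/andP: xs.
  - by rewrite -lE'' EE.
  - by case: cE' => E0 aE _; apply: (lin_der K0) => // t; apply: Aut0_AutMx.
  - by move=> v; apply: (lin_weight K0 _ cE').
have [s /fin_all_exists [X /fin_all_exists [X' hX]]] := fin_all_exists key.
have cof (rc : 'I_#|I| * 'I_#|I'|) : exists d : K, exists m, [/\ m \in S', a + vec F' (enum_val rc.2) = ev (vec F') m &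
    mx_act (X' rc.1) (x' (enum_val rc.2)) = d *: mon x' m].
  have [_ _ _ dX wX] := hX rc.1.
  have := enum_valP rc.2; rewrite inE => /(AA_mon (mstair mA') (wreal W')) [m xm em].
  have mS' : m \in S' by case/andP: xm.
  have [->|nz] := eqVneq (mx_act (X' rc.1) (x' (enum_val rc.2))) 0.
    by exists 0, m; rewrite scale0r.
  have [m' [em' _ [d ed]]] := mder_coord K0 W' dX wX nz.
  by exists d, m; split=> //; rewrite ed; congr (_ *: mon _ _); apply: (@ev_inj _ _ F'); rewrite -em -em'.
have [d hd] := fin_all_exists cof.
pose Bm := \matrix_(r < #|I|, c < #|I'|) d (r, c).
suff /eqP <- : row_free Bm by exact: rank_leq_col.
apply: inj_row_free => v vB; apply/rowP => r; rewrite mxE.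
pose Y := \sum_r v 0 r *: X' r.
have YA u : mx_act Y u = \sum_r v 0 r *: mx_act (X' r) u by exact: mx_act_sum.
have dY : mder Y.
  move=> u1 u2; rewrite !YA mulr_suml mulr_sumr -big_split; apply: eq_bigr => k _ /=.
  by have [_ _ _ -> _] := hX k; rewrite scalerDr scalerAl scalerAr.
have Y0 u : mx_act Y u = 0.
  move: u; apply: (mder_eq0 W' dY) => k.
  have [kI|kI] := boolP (k \in I'); last first.
    rewrite YA big1 // => r' _; have [_ _ _ dX wX] := hX r'.
    have [->|nz] := eqVneq (mx_act (X' r') (x' k)) 0; first by rewrite scaler0.
    have [m [em xm _]] := mder_coord K0 W' dX wX nz.
    by move: kI; rewrite inE em -(xAA_ev (mstair mA') (wreal W')) xm.
  have /matrixP /(_ 0 (enum_rank_in kI k)) := vB; rewrite !mxE => e.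
  have [m0 [_ em0 _]] := hd (r, enum_rank_in kI k).
  have -> : mx_act Y (x' k) = (\sum_j v 0 j * Bm j (enum_rank_in kI k)) *: mon x' m0.
    rewrite YA scaler_suml; apply: eq_bigr => j _; rewrite mxE -scalerA; congr (_ *: _).
    have [m1 [_ em1]] := hd (j, enum_rank_in kI k); rewrite /= in em0 em1 *.
    rewrite enum_rankK_in // in em0 em1 * => ->; congr (_ *: mon _ _).
    by apply: (@ev_inj _ _ F'); rewrite -em1 -em0.
  by rewrite e scale0r.
have YZ : Y = 0 by apply: mx_act_inj => u; rewrite Y0 mx_act0.
have : mx_act (Lg Y) (x (enum_val r)) = 0 by rewrite YZ linear0 mx_act0.
have -> : Lg Y = \sum_k v 0 k *: X k.
  by rewrite linear_sum; apply: eq_bigr => k _; rewrite linearZ; have [_ _ -> _ _] := hX k.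
rewrite mx_act_sum (bigD1 r) //= big1 ?addr0 => [|k kr]; last first.
  have [_ -> _ _ _] := hX k.
  by rewrite (inj_eq enum_val_inj) eq_sym (negPf kr) scaler0.
have [sS -> _ _ _] := hX r; rewrite eqxx.
by move/eqP; rewrite scaler_eq0; move: sS; rewrite (mS mA) => /negPf ->; rewrite orbF => /eqP.
Qed.
End MultLe.

Lemma mult_0 n (F : frame n 'rV[int]_n) : mult F 0 = n.
Proof.
rewrite /mult -[RHS](card_ord n) -cardsT; congr #|pred_of_set _|.
apply/setP => i; rewrite !inE add0r /AA st_vec; apply/allP => v _; exact/implyP.
Qed.

Lemma mono_alg_presentation (K : fieldType) n (A : falgType K) (a : 'I_n -> A) :
  (forall u v : A, u * v = v * u) -> monomial_presentation a -> exists S, mono_alg a S.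
Proof.
move=> Ac [gen ker a0]; apply: mono_algI => // [p /ker [l [-> hl]] s sn|i]; last first.
  by have := a0 i; rewrite evalAX monU.
rewrite raddf_sum big_seq big1 // => t tl; apply/eqP; rewrite mcoeff_eq0.
rewrite (perm_mem (msuppMX _ _)); apply: contraNN sn => /mapP [r _ ->].
by rewrite monD // -(evalAX a) hl // mul0r.
Qed.

Lemma mono_alg_perm (K : fieldType) n (B : falgType K) (y : 'I_n -> B) S T (p : {perm 'I_n}) :
  mono_alg y S -> stair T -> (forall s, (s \in T) = (pm p s \in S)) -> mono_alg (y \o p) T.
Proof.
move=> mB stT eT; have Bc := mcomm mB.
have monp s : mon (y \o p) s = mon y (pm p s).
  elim/mnm_ind: s => [|s j e]; first by rewrite pm0 !mon0.
  by rewrite pmD pmU !monD // !monU e.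
have msymE s : msym p 'X_[s] = 'X_[pm p s] :> {mpoly K[n]}.
  by rewrite msymX; congr 'X_[_]; apply/mnmP => i; rewrite !mnmE tnth_mktuple.
have ep q : evalA (y \o p) q = evalA y (msym p q).
  rewrite {2}(mpolyE q) (linear_sum (msym p)) linear_sum evalAE; apply: eq_bigr => s _ /=.
  by rewrite msymZ linearZ /= msymE evalAX monp.
split=> //.
- move=> c; have [q hq] := mgen mB c; exists (msym p^-1%g q).
  by rewrite ep -msymMm mulVg msym1m.
- move=> q; rewrite ep => /(mker mB) h s; rewrite eT => /h; rewrite mcoeff_sym => <-.
  by congr (q @_ _); apply/mnmP => i; rewrite !mnmE permK.
by move=> s; rewrite eT (mS mB) monp.
Qed.

Section Basis.
Variables (n : nat) (Wm V : 'M[int]_n).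
Hypothesis VW : V *m Wm = 1%:M.

Lemma zb_inj (x y : 'rV[int]_n) : (forall i, (x *m V) 0 i = (y *m V) 0 i) -> x = y.
Proof.
move=> h; have e : x *m V = y *m V by apply/rowP.
by rewrite -[x]mulmx1 -[y]mulmx1 -VW !mulmxA e.
Qed.

Lemma zb_crd i j : (row j Wm *m V) 0 i = (i == j)%:Z.
Proof. by rewrite -row_mul (mulmx1C VW) !mxE eq_sym natz. Qed.

Definition zbasis_mx : zbasis n 'rV[int]_n.
Proof.
refine (@ZBasis n _ (fun i => row i Wm) (fun i x => (x *m V) 0 i) _ zb_crd zb_inj).
abstract by move=> i x y; rewrite mulmxDl mxE.
Defined.
End Basis.

(** * Local algebras *)

Section Local.
Variables (K : fieldType) (B : falgType K) (m : {vspace B}).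
Hypotheses (Bc : forall u v : B, u * v = v * u).
Hypotheses (Bloc : is_local_max m) (Bres : residue_field_K m).

Lemma one_notin : 1 \notin m.
Proof.
case: Bloc => mI mf _; apply: contraNN mf => m1; rewrite eqEsubv subvf /=.
by apply/subvP => v _; rewrite -(mulr1 v); exact: mI.
Qed.

Let img u : {vspace B} := (amull u @: fullv)%VS.
Let imgP u v : reflect (exists w, v = u * w) (v \in img u).
Proof.
apply: (iffP memv_imgP) => [[w _ ->]|[w ->]]; first by exists w; rewrite lfunE.
by exists w; rewrite ?memvf // lfunE.
Qed.

Lemma local_unit u : u \notin m -> exists v, u * v = 1.
Proof.
move=> um; case: Bloc => _ _ mmax; have [full|nf] := eqVneq (img u) fullv.
  have : 1 \in img u by rewrite full memvf.
  by move=> /imgP [v ->]; exists v.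
case/negP: um; apply: (subvP (mmax (img u) _ nf)).
  by move=> y _ /imgP [w ->]; apply/imgP; exists (w * y); rewrite Bc mulrA.
by apply/imgP; exists 1; rewrite mulr1.
Qed.

(* The chain [u^k B] stabilizes, so [u^k (1 - u b) = 0] for some [k, b]. *)
Lemma local_nilp u : u \in m -> exists k, u ^+ k = 0.
Proof.
move=> um; pose d k := \dim (img (u ^+ k)%R).
have sub k : (img (u ^+ k.+1)%R <= img (u ^+ k)%R)%VS.
  by apply/subvP => _ /imgP [w ->]; apply/imgP; exists (u * w); rewrite mulrA -exprSr.
have [k dk] : exists k, d k = d k.+1.
  have [/existsP [k /eqP ek]|] := boolP [exists k : 'I_(d 0%N).+1, d k == d k.+1]; first by exists k.
  rewrite negb_exists => /forallP h.
  have key k : (k <= (d 0%N).+1)%N -> (d k + k <= d 0%N)%N.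
    elim: k => [|k IH] kd; first by rewrite addn0.
    have := IH (ltnW kd); have := h (Ordinal kd); have := dimvS (sub k); rewrite -/(d k) -/(d k.+1) /=.
    by clia.
  by have := key _ (leqnn _); clia.
have e : img (u ^+ k)%R = img (u ^+ k.+1)%R by apply/eqP; rewrite eq_sym eqEdim sub -/(d k) dk leqnn.
have : u ^+ k \in img (u ^+ k.+1)%R by rewrite -e; apply/imgP; exists 1; rewrite mulr1.
case/imgP => b eb; exists k.
have [|v uv] := @local_unit (1 - u * b).
  case: Bloc => mI _ _; apply: contraNN one_notin => h.
  by rewrite -(subrK (u * b) 1); apply: memvD => //; by rewrite Bc; apply: mI.
by rewrite -[_ ^+ _]mulr1 -uv mulrA mulrBr mulr1 mulrA -exprSr -eb subrr mul0r.
Qed.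

(* [pw k] plays the role of the k-th power of [m]. *)
Let u (i : 'I_(\dim m)) : B := (vbasis m)`_i.
Let um i : u i \in m.
Proof. by apply: vbasis_mem; rewrite mem_nth // size_tuple. Qed.
Let pw k v := exists p : {mpoly K[\dim m]}, evalA u p = v /\ forall s, s \in msupp p -> (k <= mdeg s)%N.

Let pwD k v w : pw k v -> pw k w -> pw k (v + w).
Proof.
move=> [p [<- hp]] [q [<- hq]]; exists (p + q); split=> [|s /msuppD_le]; first by rewrite linearD.
by rewrite mem_cat => /orP [/hp|/hq].
Qed.
Let pwM k l v w : pw k v -> pw l w -> pw (k + l) (v * w).
Proof.
move=> [p [<- hp]] [q [<- hq]]; exists (p * q); split=> [|s /msuppM_le /allpairsP [[s1 s2] /= [/hp h1 /hq h2 ->]]].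
  by rewrite evalAM.
by rewrite mdegD leq_add.
Qed.
Let pwC c : pw 0 c%:A.
Proof. by exists c%:MP; split=> //; rewrite -[c%:MP]mulr1 mul_mpolyC linearZ /= evalA1. Qed.
Let pwZ k c v : pw k v -> pw k (c *: v).
Proof. by move=> h; rewrite -mulr_algl -[k]add0n; apply: pwM. Qed.
Let pw0 k : pw k 0.
Proof. by exists 0; split=> [|s]; rewrite ?linear0 ?msupp0. Qed.
Let pw_le k l v : (k <= l)%N -> pw l v -> pw k v.
Proof. by move=> kl [p [<- hp]]; exists p; split=> // s /hp; apply: leq_trans. Qed.
Let pw_sum k (I : Type) (r : seq I) (F : I -> B) : (forall i, pw k (F i)) -> pw k (\sum_(i <- r) F i).
Proof. by move=> h; elim/big_ind: _ => // *; apply: pwD. Qed.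
Let pwu i : pw 1 (u i).
Proof. by exists 'X_i; split=> [|s]; rewrite ?evalAX ?monU // msuppX inE => /eqP ->; rewrite mdeg1. Qed.
Let pwm v : v \in m -> pw 1 v.
Proof. by move/coord_vbasis ->; apply: pw_sum => i; apply: pwZ; rewrite -tnth_nth (tnth_nth 0); apply: pwu. Qed.
Let pwmm v : v \in (m * m)%VS -> pw 2 v.
Proof.
rewrite unlock => /coord_span ->; apply: pw_sum => i; apply: pwZ.
have : nth 0 [seq v * w | v <- vbasis m, w <- vbasis m] i \in [seq v * w | v <- vbasis m, w <- vbasis m].
  by rewrite mem_nth // size_allpairs !size_tuple.
case/allpairsP => -[a b] /= [/vbasis_mem am /vbasis_mem bm ->].
by rewrite -[2%N]/(1 + 1)%N; apply: pwM; apply: pwm.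
Qed.
Let pwT v : pw 0 v.
Proof.
have e : (m + <[1]> = fullv)%VS.
  apply/eqP; rewrite eqEdim subvf /= -Bres dimv_disjoint_sum ?dim_vline ?oner_neq0 ?addn1 //.
  apply/eqP; rewrite -subv0; apply/subvP => w /memv_capP [wm /vlineP [c ec]]; rewrite memv0.
  have [c0|c0] := eqVneq c 0; first by rewrite ec c0 scale0r.
  by case/negP: one_notin; rewrite -[1](scalerK c0) -ec memvZ.
have : v \in (m + <[1]>)%VS by rewrite e memvf.
by case/memv_addP => a /pwm am [_ /vlineP [c ->] ->]; apply: pwD; [apply: pw_le am|apply: pwC].
Qed.
Let pw_nilp : exists N, forall v, pw N v -> v = 0.
Proof.
have [e he] := fin_all_exists (fun i => local_nilp (um i)).
pose N := (\sum_i e i).+1; exists N => v [p [<- hp]]; rewrite evalAE big_seq big1 // => s /hp sN.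
have [i hi] : exists i, (e i <= s i)%N.
  apply/existsP; apply: contraLR sN; rewrite negb_exists => /forallP h.
  rewrite -ltnNge ltnS mdegE; apply: leq_sum => i _; have := h i; lia.
suff -> : mon u s = 0 by rewrite scaler0.
have -> : s = (s - U_(i) *+ s i + U_(i) *+ s i)%MM.
  by apply/mnmP => j; rewrite mnmDE mnmBE mulmnE mnm1E; case: eqP => [<-|]; lia.
rewrite monD //; suff -> : mon u (U_(i) *+ s i)%MM = 0 by rewrite mulr0.
have -> k : mon u (U_(i) *+ k)%MM = u i ^+ k.
  by elim: k => [|k IH]; rewrite ?mulm0n ?mon0 // mulmS monD // IH monU exprS.
by rewrite -(subnK hi) exprD he mulr0.
Qed.

(** Successive approximation: an element of [pw k] is a polynomial in the [y i] up to an element of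
    [pw k.+1], and [pw N] is zero for some [N]. *)
Lemma local_gen n (y : 'I_n -> B) : (forall i, y i \in m) ->
  (m <= m * m + <<[seq y i | i <- enum 'I_n]>>)%VS -> forall c, exists p, evalA y p = c.
Proof.
move=> ym gen; pose Q c := exists p, evalA y p = c.
have QD a b : Q a -> Q b -> Q (a + b) by move=> [p <-] [q <-]; exists (p + q); rewrite linearD.
have QM a b : Q a -> Q b -> Q (a * b) by move=> [p <-] [q <-]; exists (p * q); rewrite evalAM.
have QZ c a : Q a -> Q (c *: a) by move=> [p <-]; exists (c *: p); rewrite linearZ.
have Q0 : Q 0 by exists 0; rewrite linear0.
have step1 v : v \in m -> exists2 c, Q c & pw 2 (v - c).
  move/(subvP gen)/memv_addP => [a /pwmm a2 [b bs ->]]; exists b; last by rewrite addrK.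
  rewrite (coord_span (X := in_tuple _) bs); elim/big_ind: _ => // i _; apply: QZ => /=.
  have : nth 0 [seq y i | i <- enum 'I_n] i \in [seq y i | i <- enum 'I_n] by rewrite mem_nth.
  by case/mapP => j _ ->; exists 'X_j; rewrite evalAX monU.
have stepm s : exists2 c, Q c & pw (mdeg s).+1 (mon u s - c).
  elim/mnm_ind: s => [|s i [c Qc pc]].
    by exists 1; [exists 1; rewrite evalA1|rewrite mon0 subrr].
  have [d Qd pd] := step1 _ (um i); exists (c * d); first exact: QM.
  have -> : mon u (s + U_(i))%MM - c * d = (mon u s - c) * u i + c * (u i - d).
    by rewrite monD // monU mulrBl mulrBr addrA subrK.
  rewrite mdegD mdeg1 addn1; apply: pwD; first by rewrite -[X in pw X]addn1; apply: pwM.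
  have -> : (mdeg s).+2 = (mdeg s + 2)%N by rewrite addn2.
  apply: pwM => //; have -> : c = mon u s + (-1) *: (mon u s - c) by rewrite scaleN1r opprB addrC subrK.
  apply: pwD; last by apply: pwZ; apply: pw_le pc.
  by exists 'X_[s]; split=> [|t]; rewrite ?evalAX // msuppX inE => /eqP ->.
have step k v : pw k v -> exists2 c, Q c & pw k.+1 (v - c).
  move=> [p [<- hp]]; rewrite evalAE.
  have h s : s \in msupp p -> exists2 c, Q c & pw k.+1 (p@_s *: mon u s - c).
    move=> /hp ks; have [c Qc pc] := stepm s; exists (p@_s *: c); first exact: QZ.
    by rewrite -scalerBr; apply: pwZ; apply: pw_le pc.
  elim: (msupp p) h => [|s r IH] h; first by exists 0; rewrite ?big_nil ?subrr.
  have [c Qc pc] := h s (mem_head _ _); have [|d Qd pd] := IH.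
    by move=> t tr; apply: h; rewrite inE tr orbT.
  exists (c + d); first exact: QD.
  by rewrite big_cons opprD addrACA; apply: pwD.
have [N hN] := pw_nilp.
have fin j k v : (N - k <= j)%N -> pw k v -> Q v.
  elim: j k v => [|j IH] k v kj pk.
    by rewrite (hN v) //; apply: pw_le pk; move: kj; clia.
  have [c Qc pc] := step _ _ pk; rewrite -(subrK c v); apply: QD => //.
  by apply: IH pc; move: kj; clia.
by move=> c; apply: (fin N 0%N) => //; rewrite subn0.
Qed.
End Local.

(** The basis modulo [U] is selected from the given list because its members have to remain
    eigenvectors. *)
Lemma basis_mod (K : fieldType) (vT : vectType K) (U : {vspace vT}) (X : seq vT) :
  exists Y, [/\ {subset Y <= X}, (U + <<Y>> = U + <<X>>)%VS,
    (size Y + \dim U = \dim (U + <<X>>))%N & 0 \notin Y].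
Proof.
elim: X => [|x X [Y [sY eY dY zY]]]; first by exists [::]; rewrite span_nil addv0.
have eX : (U + <<x :: X>> = <[x]> + (U + <<Y>>))%VS by rewrite span_cons eY addvA (addvC U) addvA.
have [xY|xY] := boolP (x \in (U + <<Y>>)%VS).
  have e : (U + <<x :: X>> = U + <<Y>>)%VS by rewrite eX; apply/addv_idPr.
  exists Y; split=> //; first by move=> y /sY yX; rewrite inE yX orbT.
  by rewrite e eY.
have x0 : x != 0 by apply: contraNneq xY => ->; rewrite mem0v.
exists (x :: Y); split.
- by move=> y; rewrite !inE => /orP [->//|/sY ->]; rewrite orbT.
- by rewrite eX span_cons addvA (addvC U) -addvA.
- rewrite eX dimv_disjoint_sum ?dim_vline ?x0 /= ?addSn ?dY ?eY //.
  apply/eqP; rewrite -subv0; apply/subvP => w /memv_capP [/vlineP [c ->] cx].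
  have [->|c0] := eqVneq c 0; first by rewrite scale0r mem0v.
  by case/negP: xY; rewrite -[x](scalerK c0) eY memvZ ?cx ?orbT.
- by rewrite inE negb_or eq_sym x0.
Qed.

(** * Eigenvectors generating a local algebra *)

Section Eig.
Variables (K : fieldType) (n : nat) (B : falgType K) (H : 'M[K]_(adim B)).
Hypotheses (K0 : [pchar K] =i pred0).
Local Notation M := 'rV[int]_n.
Local Notation theta := (@theta K n).

Lemma eig_span (m : {vspace B}) : (forall v, v \in m -> mx_act H v \in m) -> dec (fun _ : M => True) H ->
  exists l : seq (M * B), (forall z, z \in l -> z.2 \in m /\ mx_act H z.2 = theta z.1 *: z.2) /\
    (m <= <<map snd l>>)%VS.
Proof.
move=> st dH.
have one v : v \in m -> exists l : seq (M * B),
    (forall z, z \in l -> z.2 \in m /\ mx_act H z.2 = theta z.1 *: z.2) /\ v \in <<map snd l>>%VS.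
  move=> vm; have [W [u [uW _ hF eu evW]]] := vs_eig K0 (dec_vs v dH).
  have um w : w \in W -> u w \in m.
    (* The map [t - projv m t] is linear with kernel [m]. It kills all iterates of [v], hence, by
       [vandermonde], every eigencomponent of [v]. *)
    move=> wW; have piE t : (t \in m) = (t - projv m t == 0).
      apply/idP/eqP => [tm|]; first by rewrite projv_id ?subrr.
      by move/eqP; rewrite subr_eq0 => /eqP ->; rewrite memv_proj.
    rewrite piE; apply/eqP; apply: (@vandermonde K n K0 B W (fun w => u w - projv m (u w))) => // k.
    have hk : mx_act (mpow H k) v \in m.
      by elim: k => [|k IH]; rewrite ?mx_act1 // mpowSr mx_actM; apply: st.
    move: hk; rewrite piE => /eqP hk; rewrite -[RHS]hk hF (linear_sum (projv m)) -sumrB.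
    by apply: eq_bigr => w' _; rewrite linearZ scalerBr.
  exists [seq (w, u w) | w <- W]; split=> [z /mapP [w wW ->]|].
    by split; [apply: um|apply: eu].
  rewrite evW big_seq; apply: memv_suml => w wW; apply: memv_span.
  by apply/mapP; exists (w, u w) => //; apply: map_f.
have all_one (X : seq B) : (forall v, v \in X -> v \in m) -> exists l : seq (M * B),
    (forall z, z \in l -> z.2 \in m /\ mx_act H z.2 = theta z.1 *: z.2) /\ (<<X>> <= <<map snd l>>)%VS.
  elim: X => [|v X IH] h; first by exists [::]; rewrite span_nil sub0v.
  have [|l [hl sl]] := IH; first by move=> t tX; apply: h; rewrite inE tX orbT.
  have [l' [hl' sl']] := one v (h v (mem_head _ _)).
  exists (l' ++ l); split=> [z|]; first by rewrite mem_cat => /orP [/hl'|/hl].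
  by rewrite map_cat span_cat span_cons addvS // -memvE.
have [l [hl sl]] := all_one (vbasis m) (fun v => @vbasis_mem _ _ _ _).
by exists l; split=> //; rewrite -(span_basis (vbasisP m)).
Qed.

(** The image of [m] is an ideal, and it is proper because a linear image cannot gain dimension; so
    it is contained in [m]. *)
Lemma AutMx_stable (m : {vspace B}) : is_local_max m -> residue_field_K m -> AutMx H ->
  forall v, v \in m -> mx_act H v \in m.
Proof.
move=> [mI mf mmax] res [uH H1 HM].
pose h : 'End(B) := linfun (mx_act H).
have hE v : h v = mx_act H v by rewrite lfunE.
suff /subvP sub : (h @: m <= m)%VS by move=> v vm; apply: sub; rewrite -hE memv_img.
apply: mmax.
  move=> x _ /memv_imgP [u um ->]; apply/memv_imgP; exists (mx_act (invmx H) x * u); first exact: mI.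
  by rewrite !hE HM -mx_actM mulVmx // mx_act1.
apply/eqP => e; have := limg_ker_dim h m; rewrite e -res => /eqP.
by have := leq_addl (\dim (m :&: lker h)) (\dim m).+1; clia.
Qed.

Lemma local_eig (m : {vspace B}) : (forall u v : B, u * v = v * u) -> is_local_max m -> residue_field_K m ->
  cotangent_dim m = n -> AutMx H -> dec (fun _ : M => True) H ->
  exists (y : 'I_n -> B) (w : 'I_n -> M), [/\ forall i, mx_act H (y i) = theta (w i) *: y i,
    forall i, y i != 0 & forall c, exists p, evalA y p = c].
Proof.
move=> Bc loc res dm aH dH.
have [l [hl sl]] := eig_span (AutMx_stable loc res aH) dH.
have [Y [sY eY dY zY]] := basis_mod (m * m)%VS (map snd l).
have mm : (m * m <= m)%VS by case: (loc) => mI _ _; apply/prodvP => u v um vm; apply: mI.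
have em : (m * m + <<map snd l>> = m)%VS.
  apply/eqP; rewrite eqEsubv; apply/andP; split.
    rewrite subv_add mm /=; apply/span_subvP => _ /mapP [z zl ->].
    by case: (hl z zl).
  exact: subv_trans sl (addvSr _ _).
have szY : size Y = n by move: dY; rewrite em -dm /cotangent_dim => <-; rewrite addnK.
have hY i : (i < n)%N -> exists2 z, z \in l & nth 0 Y i = z.2.
  by move=> iY; apply/mapP/sY/mem_nth; rewrite szY.
have hw (i : 'I_n) : exists w, nth 0 Y i \in m /\ mx_act H (nth 0 Y i) = theta w *: nth 0 Y i.
  by have [z zl ->] := hY i (ltn_ord i); exists z.1; apply: hl.
have [w hyw] := fin_all_exists hw.
exists (fun i => nth 0 Y i), w; split=> [i|i|].
- by case: (hyw i).
- by apply: contraNneq zY => <-; rewrite mem_nth // szY.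
apply: (local_gen Bc loc res) => [i|]; first by case: (hyw i).
have -> : [seq nth 0 Y i | i : 'I_n <- enum 'I_n] = Y.
  by rewrite (map_comp (nth 0 Y) val) val_enum_ord -szY map_nth_iota0 // take_size.
by rewrite eY em.
Qed.

(** Weights forming a basis give distinct monomials distinct weights. Applying the powers of [H] to
    a polynomial relation and using [vandermonde], each term vanishes separately. *)
Lemma mono_alg_weights (y : 'I_n -> B) (b : zbasis n M) : (forall u v : B, u * v = v * u) -> AutMx H ->
  (forall i, mx_act H (y i) = theta (zvec b i) *: y i) ->
  (forall i, y i != 0) -> (forall c, exists p, evalA y p = c) -> exists S, mono_alg y S.
Proof.
move=> Bc aH hy y0 gen; apply: mono_algI => // p pe s sn.
have Hmon := aut_mon K0 Bc aH hy; have evI := @zev_inj _ _ b.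
have [sp|] := boolP (s \in msupp p); last by rewrite mcoeff_msupp negbK => /eqP.
pose u w := \sum_(t <- msupp p | ev (zvec b) t == w) p@_t *: mon y t.
have := @vandermonde K n K0 B (map (ev (zvec b)) (msupp p)) u _ _ (ev (zvec b) s) (map_f _ sp).
rewrite map_inj_uniq // msupp_uniq => /(_ isT) h.
have uE t : u (ev (zvec b) t) = p@_t *: mon y t.
  rewrite /u; have [tp|] := boolP (t \in msupp p).
    rewrite big_mkcond (bigD1_seq t) ?msupp_uniq //= eqxx big1 ?addr0 // => t' t't.
    by rewrite (inj_eq evI) (negPf t't).
  rewrite mcoeff_msupp negbK => /eqP pt; rewrite pt scale0r big1 // => t'.
  by rewrite (inj_eq evI) => /eqP ->; rewrite pt scale0r.
have /eqP : p@_s *: mon y s = 0; last by rewrite scaler_eq0 (negPf sn) orbF => /eqP.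
rewrite -uE h // => k; have /(congr1 (mx_act (mpow H k))) := pe.
rewrite linear0 => e; rewrite -[RHS]e evalAE linear_sum big_map; apply: eq_bigr => t _.
by rewrite linearZ /= (mpow_eig k (Hmon t)) uE !scalerA mulrC.
Qed.

Lemma dec_span_weights (G : M -> Prop) (y : 'I_n -> B) (w : 'I_n -> M) : (forall u v : B, u * v = v * u) ->
  AutMx H -> G 0 -> (forall a b, G a -> G b -> G (a + b)) -> (forall i, G (w i)) ->
  (forall i, mx_act H (y i) = theta (w i) *: y i) -> (forall c, exists p, evalA y p = c) -> dec G H.
Proof.
move=> Bc aH G0 GD Gw hy gen v; have [p <-] := gen v.
exists [seq (ev w t, p@_t *: mon y t) | t <- msupp p]; split; last by rewrite big_map evalAE.
move=> _ /mapP [t _ ->] /=; split.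
  by elim/mnm_ind: t => [|t j e]; rewrite ?ev0 // evD evU; apply: GD.
by rewrite linearZ /= (aut_mon K0 Bc aH hy) !scalerA mulrC.
Qed.
End Eig.

Unset Implicit Arguments. Set Strict Implicit. Set Printing Implicit Defensive.

Theorem theorem1p1 (K : fieldType) (Kchar0 : [pchar K] =i pred0)
  (n : nat) (A : falgType K) (a : 'I_n -> A)
  (Acomm : forall x y : A, x * y = y * x)
  (Amono : monomial_presentation a)
  (B : falgType K) (Bcomm : forall x y : B, x * y = y * x)
  (m : {vspace B}) (Bloc : is_local_max m) (Bres : residue_field_K m)
  (Bdim : cotangent_dim m = n)
  (Hiso : alg_group_iso (@Aut0 K B) (@Aut0 K A)) :
  alg_iso B A.
Proof.
have [S mA] := mono_alg_presentation Acomm Amono.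
have [g0 [ag0 g0E]] := torus Kchar0 mA.


have [phi [f' [rphi rf' [phiA f'A] [f'phi phif'] phiM]]] := alg_group_iso_sym Hiso.
have f'M M N : Aut0 M -> Aut0 N -> f' (M *m N) = f' M *m f' N.
  move=> aM aN; rewrite -[in LHS](phif' M aM) -[in LHS](phif' N aN) -phiM ?f'phi //; try exact: f'A.
  by apply: Aut0M => //; apply: f'A.
pose H := phi g0; have aH : Aut0 H by apply: phiA.
have hA := Aut0_AutMx aH.
have a0 i : a i != 0 by case: Amono => _ _ /(_ i); rewrite evalAX monU.
have genA c : exists p, evalA a p = c by case: Amono.
have dec0 : dec (fun _ : 'rV[int]_n => True) g0.
  by apply: (dec_span_weights (w := fun i => delta_mx 0 i) Kchar0 Acomm (Aut0_AutMx ag0)) => //; exact: g0E.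
have decH : dec (fun _ : 'rV[int]_n => True) H by apply: (transfer_dec Kchar0 _ _ _ rphi) => //.
have [y [w [hy y0 geny]]] := local_eig Kchar0 Bcomm Bloc Bres Bdim hA decH.
pose Wm : 'M[int]_n := \matrix_(i, j) w i 0 j.
have rowW i : row i Wm = w i by apply/rowP => j; rewrite !mxE.
pose G (x : 'rV[int]_n) := exists c : 'rV[int]_n, x = c *m Wm.
(* [G] is the subgroup generated by the weights of the [y i]. Carrying [H] back to [g0] confines all
   weights of [g0] to [G]. *)
have decG : dec G g0.
  rewrite -(f'phi _ ag0) -/H.
  have G0 : G 0 by exists 0; rewrite mul0mx.
  have GD u v : G u -> G v -> G (u + v) by move=> [c ->] [d ->]; exists (c + d); rewrite mulmxDl.
  apply: (transfer_dec Kchar0 G0 GD _ rf') => //; first by move=> u [c ->]; exists (- c); rewrite mulNmx.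
  apply: (dec_span_weights (w := w) Kchar0 Bcomm hA) => //.
  by move=> i; exists (delta_mx 0 i); rewrite -rowE rowW.
(* The variables of [A] have the standard basis vectors as weights, so these lie in [G]; their
   coefficients are the rows of [V]. *)
have [V VW] : exists V, V *m Wm = 1%:M.
  have [c hc] := fin_all_exists (fun i => dec_weight Kchar0 decG (a0 i) (g0E i)).
  exists (\matrix_(i, j) c i 0 j); apply/row_matrixP => i; rewrite row_mul row1 hc; congr (_ *m _).
  by apply/rowP => j; rewrite !mxE.
pose bB := zbasis_mx VW; pose bA := zbasis_mx (mulmx1 (1%:M : 'M[int]_n)).
have bBE i : zvec bB i = w i by apply: rowW.
have [T mB] : exists T, mono_alg y T.
  by apply: (mono_alg_weights (b := bB) Kchar0 Bcomm hA) => // i; rewrite bBE.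
have [E [EA _ rE]] := frame_of bA (mstair mA); have [F [FB _ rF]] := frame_of bB (mstair mB).
have WA : weighted a S g0 E by split=> // i; rewrite EA /= row1.
have WB : weighted y T H F by split=> // i; rewrite FB /= rowW.
have eqm x : mult E x = mult F x.
  have [->|x0] := eqVneq x 0; first by rewrite !mult_0.
  apply/eqP; rewrite eqn_leq (mult_le Kchar0 WA WB rphi rf') //.
  by rewrite (mult_le Kchar0 WB WA rf' rphi) // f'phi.
have [p hp] := frames_iso (mstair mA) (mstair mB) rE rF eqm.
exact: (mono_alg_iso (mono_alg_perm mB (mstair mA) hp) mA).
Qed.
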